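(* Let $\varphi,\psi\in L^2(\mathscr G)$ be such that $\mathcal E^\Gamma(\varphi)$ is an $\mathcal S^\Gamma(\varphi)$-subspace frame and $\mathcal E^\Gamma(\psi)$ is an $\mathcal S^\Gamma(\psi)$-subspace frame. Put $\Omega_\varphi=\{\alpha\in\widehat\Gamma:[\varphi,\varphi](\alpha)\neq0\}$ and $\Omega_\psi=\{\alpha\in\widehat\Gamma:[\psi,\psi](\alpha)\neq0\}$. If for some constant $C>0$ the inequality $|[\varphi,\psi](\alpha)|\ge C$ holds for a.e. $\alpha\in\Omega_\varphi$, then there exists $\tilde\psi\in\mathcal S^\Gamma(\psi)$ such that $\mathcal E^\Gamma(\tilde\psi)$ is an $\mathcal S^\Gamma(\varphi)$-subspace dual to $\mathcal E^\Gamma(\varphi)$. Moreover, such a $\tilde\psi\in\mathcal S^\Gamma(\psi)$ is unique if and only if $\Omega_\varphi=\Omega_\psi$ up to a null set. In that case the unique $\tilde\psi\in\mathcal S^\Gamma(\psi)$ satisfies, for a.e. $\alpha\in\Omega_\varphi$, $$\overline{[\varphi,\psi](\alpha)}\,(\mathcal Z\tilde\psi)(\alpha,\Gamma x)=(\mathcal Z\psi)(\alpha,\Gamma x)\,\chi_{\Omega_\varphi}(\alpha)\quad\text{for all }\Gamma x\in\Gamma\backslash\mathscr G.$$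
   Context: $\mathscr G$ is a second countable locally compact group (not necessarily abelian) with left Haar measure, $\Gamma$ is a closed discrete abelian subgroup with counting measure, and $\widehat\Gamma$ is its (compact) dual group with normalized Haar measure. $(L_\gamma f)(x)=f(\gamma^{-1}x)$, $\mathcal E^\Gamma(\varphi)=\{L_\gamma\varphi\}_{\gamma\in\Gamma}$, $\mathcal S^\Gamma(\varphi)=\overline{\operatorname{span}}\,\mathcal E^\Gamma(\varphi)$. $\Gamma\backslash\mathscr G$ is the space of right cosets $\Gamma x$, $\Xi:\Gamma\backslash\mathscr G\to\mathscr G$ is a Borel section, and $\Gamma\backslash\mathscr G$ carries the measure with $\int_{\mathscr G}f=\int_{\Gamma\backslash\mathscr G}\sum_{\gamma\in\Gamma}f(\gamma\,\Xi(\Gamma x))\,d\mu_{\Gamma\backslash\mathscr G}(\Gamma x)$. The Zak transform $\mathcal Z:L^2(\mathscr G)\to L^2(\widehat\Gamma\times\Gamma\backslash\mathscr G)\cong L^2(\widehat\Gamma;L^2(\Gamma\backslash\mathscr G))$ is the unitary extension of $(\mathcal Zf)(\alpha,\Gamma x)=\sum_{\gamma\in\Gamma}f(\gamma\,\Xi(\Gamma x))\,\alpha(\gamma^{-1})$, $f\in L^1\cap L^2$. Identities ''for all $\Gamma x$'' are identities in $L^2(\Gamma\backslash\mathscr G)$. The bracket is $[\psi,\varphi](\alpha)=\int_{\Gamma\backslash\mathscr G}\mathcal Z\psi(\alpha,\Gamma x)\overline{\mathcal Z\varphi(\alpha,\Gamma x)}\,d\mu_{\Gamma\backslash\mathscr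 G}(\Gamma x)$. A countable family $\{f_k\}$ in a Hilbert space $\mathcal H$ is a $\mathcal K$-subspace frame ($\mathcal K$ a closed subspace) if $A\|f\|^2\le\sum_k|\langle f,f_k\rangle|^2\le B\|f\|^2$ for all $f\in\mathcal K$ and some $0<A\le B<\infty$; it is Bessel if the upper bound holds for all $f\in\mathcal H$. For Bessel families, $\{g_k\}$ is a $\mathcal K$-subspace dual to $\{f_k\}$ if $\sum_k\langle f,g_k\rangle f_k=f$ for all $f\in\mathcal K$. *)

(* Defs.v *)
From HB Require Import structures.
From mathcomp Require Import all_boot all_order all_algebra finmap.
From mathcomp Require Import all_classical all_reals all_analysis.
From mathcomp Require Import measurable_realfun complex generic_quotient.
From mathcomp.analysis.showcase Require Import summability.

Set Implicit Arguments.
Unset Strict Implicit.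
Unset Printing Implicit Defensive.

Import Order.TTheory GRing.Theory Num.Theory.
Import numFieldNormedType.Exports.

Notation normc := ComplexField.Normc.normc.

Local Open Scope classical_set_scope.
Local Open Scope complex_scope.
Local Open Scope ring_scope.
Local Open Scope quotient_scope.

(* No compatibility between the group law and the topology is required here; *)
(* the structure is pointed because Borel sigma-algebras of the library are.  *)
#[short(type="preTopGroupType")]
HB.structure Definition PreTopGroup :=
  {G of Group G & PointedTopological G}.

HB.mixin Record PreTopGroup_isTopGroup G & PreTopGroup G := {
  mulg_continuous : continuous (fun xy : G * G => (xy.1 * xy.2)%g);
  invg_continuous : continuous (fun x : G => x^-1%g)
}.

#[short(type="topGroupType")]
HB.structure Definition TopGroup :=
  {G of PreTopGroup G & PreTopGroup_isTopGroup G}.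

Notation borel T := (g_sigma_algebraType (@open T)).

(* On a second countable locally compact Hausdorff space every Borel measure *)
(* that is finite on compact sets is regular, so regularity is not required. *)
Definition left_haar (R : realType) (G : preTopGroupType)
    (mu : {measure set (borel G) -> \bar R}) :=
  [/\ forall (x : G) (A : set (borel G)), measurable A ->
        mu [set (x * y)%g | y in A] = mu A,
      forall K : set G, compact K -> (mu K < +oo)%E &
      forall U : set G, open U -> U !=set0 -> (0 < mu U)%E].

Record subgroup (G : groupType) := Subgroup {
  subgroup_set :> set G;
  subgroup_closed : group_closed (mem subgroup_set)
}.

#[warning="-HB.no-new-instance"]
HB.instance Definition _ (G : groupType) (H : subgroup G) :=
  SubChoice.copy (set_type H) {x : G | x \in subgroup_set H}.
HB.instance Definition _ (G : groupType) (H : subgroup G) :=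
  SubChoice_isSubGroup.Build G _ (set_type H) (subgroup_closed H).

Definition abelian_subgroup (G : groupType) (H : subgroup G) :=
  forall x y : H, commute x y.

Definition discrete_subgroup (G : topGroupType) (H : subgroup G) :=
  forall x : H, open [set x].

Record dual (R : realType) (G : groupType) (H : subgroup G) := Character {
  character :> H -> R[i];
  normr_character : forall x : H, `|character x| = 1;
  characterM : forall x y : H, character (x * y)%g = character x * character y
}.

Section dual_group.
Context (R : realType) (G : groupType) (H : subgroup G).
Local Notation dual := (dual R H).

HB.instance Definition _ := gen_eqMixin dual.
HB.instance Definition _ := gen_choiceMixin dual.

Lemma dualP (a b : dual) : (forall x : H, a x = b x) -> a = b.
Proof.
case: a b => [a a1 aM] [b b1 bM] /= /funext ab; case: _ / ab in b1 bM *.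
by congr Character; exact: Prop_irrelevance.
Qed.

Lemma character_neq0 (a : dual) (x : H) : a x != 0.
Proof. by rewrite -normr_eq0 normr_character oner_neq0. Qed.

Definition dual_one : dual.
Proof.
exists (fun=> 1) => [x|x y]; first exact: normr1.
by rewrite mulr1.
Defined.

Definition dual_mul (a b : dual) : dual.
Proof.
exists (fun x => a x * b x) => [x|x y].
- by rewrite normrM !normr_character mulr1.
- by rewrite !characterM mulrACA.
Defined.

Definition dual_inv (a : dual) : dual.
Proof.
exists (fun x => (a x)^-1) => [x|x y].
- by rewrite normfV normr_character invr1.
- by rewrite characterM invfM.
Defined.

Lemma dual_mulA : associative dual_mul.
Proof. by move=> a b c; apply: dualP => x /=; rewrite mulrA. Qed.

Lemma dual_mul1 : left_id dual_one dual_mul.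
Proof. by move=> a; apply: dualP => x /=; rewrite mul1r. Qed.

Lemma dual_1mul : right_id dual_one dual_mul.
Proof. by move=> a; apply: dualP => x /=; rewrite mulr1. Qed.

Lemma dual_mulV : left_inverse dual_one dual_inv dual_mul.
Proof.
by move=> a; apply: dualP => x /=; rewrite mulVf ?character_neq0.
Qed.

Lemma dual_Vmul : right_inverse dual_one dual_inv dual_mul.
Proof.
by move=> a; apply: dualP => x /=; rewrite divff ?character_neq0.
Qed.

HB.instance Definition _ := isGroup.Build dual
  dual_mulA dual_mul1 dual_1mul dual_mulV dual_Vmul.

(* The compact-open topology: as H is meant to be discrete, its compact *)
(* subsets are finite and this is the topology of pointwise convergence. *)
HB.instance Definition _ := Topological.copy dual
  (initial_topology (@character R G H : dual -> {ptws H -> R[i]^o})).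
HB.instance Definition _ := isPointed.Build dual dual_one.

End dual_group.

Section cosets.
Context (G : topGroupType) (H : subgroup G).

(* H x = H y iff x y^-1 is in H *)
Definition coset_rel (x y : G) : bool := (x / y)%g \in subgroup_set H.

Lemma coset_rel_equiv : equiv_class_of coset_rel.
Proof.
have [H1 HB] := subgroup_closed H.
split=> [x|x y|y x z]; rewrite /coset_rel.
- by rewrite mulgV.
- by apply/idP/idP => Hxy; rewrite -invgF; exact: group_closedV.
- move=> Hxy Hyz; have -> : (x / z = (x / y) * (y / z))%g.
    by rewrite mulgA divgK.
  exact: group_closedM.
Qed.

Canonical coset_equiv := EquivRelPack coset_rel_equiv.

Definition right_cosets := quotient_topology {eq_quot coset_equiv}.

HB.instance Definition _ := Quotient.on right_cosets.
HB.instance Definition _ := PointedTopological.on right_cosets.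

Definition borel_section (Xi : right_cosets -> G) :=
  measurable_fun [set: borel right_cosets] (Xi : borel right_cosets -> borel G)
  /\ forall c : right_cosets, \pi_(right_cosets) (Xi c) = c.

End cosets.

Definition weil_formula (R : realType) (G : topGroupType) (H : subgroup G)
    (mu : {measure set (borel G) -> \bar R}) (Xi : right_cosets H -> G)
    (muQ : {measure set (borel (right_cosets H)) -> \bar R}) :=
  forall f : G -> \bar R,
    measurable_fun [set: borel G] (f : borel G -> \bar R) ->
    (forall x, 0 <= f x)%E ->
    (\int[mu]_x f x =
     \int[muQ]_c \esum_(h in [set: H]) f (\val h * Xi c)%g)%E.

(* Elements of L^2 are represented by functions; equality in L^2 is equality *)
(* almost everywhere.                                                        *)
Section L2.
Context d (T : measurableType d) (R : realType).
Variable mu : {measure set T -> \bar R}.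
Implicit Types f g h : T -> R[i].

Definition cmeasurable f :=
  measurable_fun setT (fun x => complex.Re (f x)) /\
  measurable_fun setT (fun x => complex.Im (f x)).

Definition cintegral f : R[i] :=
  (\int[mu]_x complex.Re (f x)) +i* (\int[mu]_x complex.Im (f x)).

Definition L1 f :=
  cmeasurable f /\ (\int[mu]_x (normc (f x))%:E < +oo)%E.

Definition normL2_sq f : \bar R := (\int[mu]_x (normc (f x) ^+ 2)%:E)%E.

Definition L2 f := cmeasurable f /\ (normL2_sq f < +oo)%E.

Definition inner f g : R[i] := cintegral (fun x => f x * (g x)^*).

Definition span (I : choiceType) (e : I -> T -> R[i]) : set (T -> R[i]) :=
  [set f | exists (F : {fset I}) (c : I -> R[i]),
     f = fun x => \sum_(k <- F) c k * e k x].

Definition closureL2 (D : set (T -> R[i])) : set (T -> R[i]) :=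
  [set f | L2 f /\ forall eps : R, 0 < eps ->
     exists2 g, D g & (normL2_sq (fun x => f x - g x)%R < eps%:E)%E].

Definition coef_sq (I : choiceType) (e : I -> T -> R[i]) f : \bar R :=
  \esum_(k in [set: I]) (normc (inner f (e k)) ^+ 2)%:E.

Definition subspace_frame (I : choiceType) (K : set (T -> R[i]))
    (e : I -> T -> R[i]) :=
  exists A B : R, [/\ 0 < A, A <= B & forall f, K f ->
    (A%:E * normL2_sq f <= coef_sq e f /\ coef_sq e f <= B%:E * normL2_sq f)%E].

Definition bessel (I : choiceType) (e : I -> T -> R[i]) :=
  exists2 B : R, 0 < B &
    forall f, L2 f -> (coef_sq e f <= B%:E * normL2_sq f)%E.

(* g is a K-subspace dual to e; the series converges in L^2, as the net of *)
(* its finite partial sums.                                                *)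
Definition subspace_dual (I : choiceType) (K : set (T -> R[i]))
    (g e : I -> T -> R[i]) :=
  [/\ bessel g, bessel e & forall f, K f ->
    (fun F : {fset I} =>
       normL2_sq (fun x => (\sum_(k <- F) inner f (g k) * e k x) - f x))
    @ totally --> 0%E].

End L2.

Section zak.
Context (R : realType) (G : topGroupType) (H : subgroup G).
Context (mu : {measure set (borel G) -> \bar R}).

Definition translates (f : G -> R[i]) : H -> G -> R[i] :=
  fun h x => f ((\val h)^-1 * x)%g.

Definition span_translates (f : G -> R[i]) : set (G -> R[i]) :=
  closureL2 mu (span (translates f : H -> borel G -> R[i])).

Context (nu : {measure set (borel (dual R H)) -> \bar R}).
Context (muQ : {sigma_finite_measure set (borel (right_cosets H)) -> \bar R}).
Context (Xi : right_cosets H -> G).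

Local Notation dualQ := (borel (dual R H) * borel (right_cosets H))%type.
Local Notation nuQ := (nu \x muQ : {measure set dualQ -> \bar R})%E.

Definition zak_partial_sum (f : G -> R[i]) (p : dualQ) (F : {fset H}) : R[i] :=
  \sum_(h <- F) f (\val h * Xi p.2)%g * (p.1 : dual R H) (h^-1)%g.

(* Z is the unitary operator from L^2(G) onto L^2(dual H x H\G) given by the *)
(* defining series on the intersection of L^1 and L^2, on which that series   *)
(* converges absolutely almost everywhere.                                    *)
Definition zak_transform (Z : (G -> R[i]) -> dualQ -> R[i]) :=
  [/\ forall f, L2 mu f -> L2 nuQ (Z f),
      forall (a : R[i]) f g, L2 mu f -> L2 mu g ->
        {ae nuQ, forall p, Z (fun x => a * f x + g x) p = a * Z f p + Z g p},
      forall f g, L2 mu f -> L2 mu g -> inner nuQ (Z f) (Z g) = inner mu f g,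
      forall F, L2 nuQ F -> exists2 f, L2 mu f & {ae nuQ, forall p, Z f p = F p} &
      forall f, L1 mu f -> L2 mu f ->
        {ae nuQ, forall p,
           zak_partial_sum f p @ totally --> (Z f p : R[i]^o)}].

Definition bracket (Z : (G -> R[i]) -> dualQ -> R[i]) (f g : G -> R[i])
    (a : dual R H) : R[i] :=
  cintegral muQ (fun c => Z f (a, c) * (Z g (a, c))^*).

Definition bracket_support (Z : (G -> R[i]) -> dualQ -> R[i])
    (f : G -> R[i]) : set (dual R H) :=
  [set a | bracket Z f f a != 0].

End zak.

Arguments translates {R G} H f.
Arguments span_translates {R G} H mu f.

(* Main.v *)
(* The Zak transform turns the translation L_k into multiplication by the      *)
(* character chi_k(a) = a(k^-1), and S(phi) into the closed span of the        *)
(* functions chi_k Z phi.  Pulling back m tensor 1_E through Z yields slices   *)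
(* <m, chi_h> 1_E, so unitarity of Z gives Parseval's identity for the chi_k;  *)
(* hence this span is stable under bounded functions of a (approximated by     *)
(* truncated trigonometric polynomials), and the upper frame bound says that   *)
(* [phi, phi] is bounded.                                                      *)
(*                                                                             *)
(* By Parseval, the expansion of f along L_k psit and L_k phi becomes          *)
(* [f, psit] Z phi.  Thus psit is a dual exactly when [phi, psit] = 1 on       *)
(* Omega_phi.  If Z psit = m Z psi this reads conj(m) [phi, psi] = 1 on        *)
(* Omega_phi: the lower bound on |[phi, psi]| provides a bounded such m, which *)
(* is unconstrained on Omega_psi \ Omega_phi, and Omega_phi is contained in    *)
(* Omega_psi by Cauchy-Schwarz.  Conversely every psit in S(psi) satisfies     *)
(* [psi, phi] Z psit = [psit, phi] Z psi, since this identity is closed in     *)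
(* psit, commutes with modulations and holds for psi; this determines a dual   *)
(* on Omega_phi.                                                               *)

Require Import Defs.
From HB Require Import structures.
From mathcomp Require Import all_boot all_order all_algebra finmap.
From mathcomp Require Import all_classical all_reals all_analysis.
From mathcomp Require Import measurable_realfun complex generic_quotient.
From mathcomp.analysis.showcase Require Import summability.
From mathcomp Require Import ring lra.

Set Implicit Arguments.
Unset Strict Implicit.
Unset Printing Implicit Defensive.

Import Order.TTheory GRing.Theory Num.Theory.
Import numFieldNormedType.Exports.

Local Open Scope classical_set_scope.
Local Open Scope complex_scope.
Local Open Scope ring_scope.

(** The Zak transform moves the problem to functions [F (a, c)] on the product of the dual group and
    the coset space, where translations act as unimodular functions [chi k] of the variable [a]
    alone. There [S(phi)] becomes a space stable under multiplication by every bounded measurable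
    function of [a] ([multiplier_bounded]), and the bracket becomes the fibrewise inner product
    [mixed_inner].

    Two facts reduce frame theory to fibres. The [chi k] satisfy Parseval's identity
    ([zak_parseval]), so the coefficients of [F] along the modulations of [H] are the Fourier
    coefficients of the bracket of [F] and [H], and the series with these coefficients along the
    modulations of [G] converges to that bracket times [G] ([mixed_synthesis]). Moreover translates
    form a Bessel family exactly when the diagonal bracket is essentially bounded
    ([bessel_bounded_weight]), which makes all these operations bounded.

    Hence a Bessel [H] gives a dual of [F] iff the bracket of [F] and [H] equals 1 a.e. on the
    support of [F] ([modulation_dual_of_identity], [modulation_dual_identity], [identityP]). For
    existence take [H = m G], where [m] inverts the conjugate of the bracket of [F] and [G] on the
    support of [F] and is bounded by [1 / C] ([inverse_symbol], [dual_of_multiplier]). Every [H] in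
    the space generated by [G] satisfies [[G, F] H = [H, F] G], which gives the formula for a dual
    ([dual_formula]). If the supports agree, [H] vanishes off them and is determined
    ([dual_unique]); otherwise adding to [m] the indicator of the difference of the supports gives a
    second dual ([supports_of_unique]). *)

Local Notation Re := complex.Re.
Local Notation Im := complex.Im.

(** * Complex numbers through real and imaginary parts *)

Section complex_numbers.
Context {R : realType}.
Implicit Types x y z : R[i].

Lemma ReD x y : Re (x + y) = Re x + Re y. Proof. by case: x y => [? ?] []. Qed.
Lemma ImD x y : Im (x + y) = Im x + Im y. Proof. by case: x y => [? ?] []. Qed.
Lemma ReN x : Re (- x) = - Re x. Proof. by case: x. Qed.
Lemma ImN x : Im (- x) = - Im x. Proof. by case: x. Qed.
Lemma ReM x y : Re (x * y) = Re x * Re y - Im x * Im y.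
Proof. by case: x y => [? ?] []. Qed.
Lemma ImM x y : Im (x * y) = Re x * Im y + Im x * Re y.
Proof. by case: x y => [? ?] []. Qed.
Lemma ReJ x : Re x^* = Re x. Proof. by case: x. Qed.
Lemma ImJ x : Im x^* = - Im x. Proof. by case: x. Qed.

Definition reimE := (ReD, ImD, ReN, ImN, ReM, ImM, ReJ, ImJ).

Lemma complexP x y : Re x = Re y -> Im x = Im y -> x = y.
Proof. by case: x y => [? ?] [? ?] /= -> ->. Qed.

Lemma normc_ge0 x : 0 <= normc x.
Proof. by case: x => a b /=; exact: sqrtr_ge0. Qed.

Lemma normc2E x : normc x ^+ 2 = Re x ^+ 2 + Im x ^+ 2.
Proof. by case: x => a b /=; rewrite sqr_sqrtr// addr_ge0// sqr_ge0. Qed.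

Lemma normc2_ge0 x : 0 <= normc x ^+ 2. Proof. exact: sqr_ge0. Qed.

Lemma normc2_real (r : R) : normc r%:C ^+ 2 = r ^+ 2.
Proof. by rewrite normc2E/= expr0n addr0. Qed.

Lemma normr_normc x : `|x| = (normc x)%:C.
Proof. by case: x. Qed.

Lemma normc2M x y : normc (x * y) ^+ 2 = normc x ^+ 2 * normc y ^+ 2.
Proof. by rewrite ComplexField.Normc.normcM exprMn. Qed.

Lemma normcJ_normc x : normc x^* = normc x.
Proof. by case: x => a b /=; rewrite sqrrN. Qed.

Lemma mulcJ x : x * x^* = (normc x ^+ 2)%:C.
Proof. by apply: complexP; rewrite !reimE ?normc2E/=; lra. Qed.

Lemma normc2_eq0 x : normc x ^+ 2 = 0 -> x = 0.
Proof. by move/eqP; rewrite sqrf_eq0 => /eqP/ComplexField.Normc.eq0_normc. Qed.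

Lemma normc2D_le x y : normc (x + y) ^+ 2 <= 2 * (normc x ^+ 2 + normc y ^+ 2).
Proof.
rewrite !normc2E !reimE.
have := sqr_ge0 (Re x - Re y); have := sqr_ge0 (Im x - Im y); nra.
Qed.

Lemma abs_ReM_le x y : `|Re (x * y)| <= (normc x ^+ 2 + normc y ^+ 2) / 2.
Proof.
rewrite !normc2E !reimE ler_norml.
have := sqr_ge0 (Re x - Re y); have := sqr_ge0 (Im x - Im y).
have := sqr_ge0 (Re x + Re y); have := sqr_ge0 (Im x + Im y); nra.
Qed.

Lemma abs_ImM_le x y : `|Im (x * y)| <= (normc x ^+ 2 + normc y ^+ 2) / 2.
Proof.
rewrite !normc2E !reimE ler_norml.
have := sqr_ge0 (Re x - Im y); have := sqr_ge0 (Im x - Re y).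
have := sqr_ge0 (Re x + Im y); have := sqr_ge0 (Im x + Re y); nra.
Qed.

Lemma abs_Re_le x : `|Re x| <= normc x.
Proof.
rewrite -ler_sqr ?nnegrE ?normc_ge0// real_normK ?num_real// normc2E.
by rewrite lerDl sqr_ge0.
Qed.

Lemma abs_Im_le x : `|Im x| <= normc x.
Proof.
rewrite -ler_sqr ?nnegrE ?normc_ge0// real_normK ?num_real// normc2E.
by rewrite lerDr sqr_ge0.
Qed.

Lemma mulcJ1 x : normc x = 1 -> x * x^* = 1.
Proof. by rewrite mulcJ => ->; rewrite expr1n. Qed.

End complex_numbers.

Section complex_measurable.
Context d (T : measurableType d) (R : realType).
Implicit Types f g : T -> R[i].

Lemma cmeasurable_cst (c : R[i]) : cmeasurable (fun _ : T => c).
Proof. by split; exact: measurable_cst. Qed.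

Lemma cmeasurableD f g : cmeasurable f -> cmeasurable g ->
  cmeasurable (fun x => f x + g x).
Proof.
move=> [f1 f2] [g1 g2]; split; under eq_fun do rewrite reimE;
  exact: measurable_funD.
Qed.

Lemma cmeasurableN f : cmeasurable f -> cmeasurable (fun x => - f x).
Proof.
move=> [f1 f2]; split; under eq_fun do rewrite reimE; exact: measurable_funN.
Qed.

Lemma cmeasurableB f g : cmeasurable f -> cmeasurable g ->
  cmeasurable (fun x => f x - g x).
Proof. by move=> mf mg; apply: cmeasurableD => //; exact: cmeasurableN. Qed.

Lemma cmeasurableM f g : cmeasurable f -> cmeasurable g ->
  cmeasurable (fun x => f x * g x).
Proof.
move=> [f1 f2] [g1 g2]; split; under eq_fun do rewrite reimE.
- by apply: measurable_funB; exact: measurable_funM.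
- by apply: measurable_funD; exact: measurable_funM.
Qed.

Lemma cmeasurableZ (c : R[i]) f : cmeasurable f -> cmeasurable (fun x => c * f x).
Proof. by move=> mf; apply: cmeasurableM => //; exact: cmeasurable_cst. Qed.

Lemma cmeasurableJ f : cmeasurable f -> cmeasurable (fun x => (f x)^*).
Proof.
move=> [f1 f2]; split; under eq_fun do rewrite reimE; first exact: f1.
exact: measurable_funN.
Qed.

Lemma cmeasurable_real (f : T -> R) :
  measurable_fun setT f -> cmeasurable (fun x => (f x)%:C).
Proof. by move=> mf; split => //=; exact: measurable_cst. Qed.

Lemma measurable_normc2 f : cmeasurable f ->
  measurable_fun setT (fun x => normc (f x) ^+ 2).
Proof.
move=> [f1 f2]; under eq_fun do rewrite normc2E.
by apply: measurable_funD; exact: measurable_funX.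
Qed.

Lemma measurable_normc f : cmeasurable f -> measurable_fun setT (fun x => normc (f x)).
Proof.
move=> mf; have -> : (fun x => normc (f x)) = (fun x => Num.sqrt (normc (f x) ^+ 2)).
  by apply/funext => x /=; rewrite sqrtr_sqr ger0_norm// normc_ge0.
apply: measurableT_comp (measurable_normc2 mf).
exact: continuous_measurable_fun (@sqrt_continuous R).
Qed.

Lemma emeasurable_normc2 f : cmeasurable f ->
  measurable_fun setT (fun x => (normc (f x) ^+ 2)%:E).
Proof. by move=> mf; apply/measurable_EFinP; exact: measurable_normc2. Qed.

End complex_measurable.

Lemma cmeasurable_comp d1 d2 (T1 : measurableType d1) (T2 : measurableType d2)
    (R : realType) (f : T2 -> R[i]) (g : T1 -> T2) :
  cmeasurable f -> measurable_fun setT g -> cmeasurable (fun x => f (g x)).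
Proof.
move=> [f1 f2] mg; split.
- exact: (measurableT_comp f1 mg).
- exact: (measurableT_comp f2 mg).
Qed.

(** * Complex square-integrable functions *)

Section L2_theory.
Context d (T : measurableType d) (R : realType).
Variable mu : {measure set T -> \bar R}.
Implicit Types f g h : T -> R[i].

Definition cintegrable f :=
  mu.-integrable setT (fun x => (Re (f x))%:E) /\
  mu.-integrable setT (fun x => (Im (f x))%:E).

Lemma normL2_sq_ge0 f : (0 <= normL2_sq mu f)%E.
Proof. by apply: integral_ge0 => x _; rewrite lee_fin normc2_ge0. Qed.

Lemma ae_le_normL2_sq f g : cmeasurable f -> cmeasurable g ->
  {ae mu, forall x, normc (f x) ^+ 2 <= normc (g x) ^+ 2} ->
  (normL2_sq mu f <= normL2_sq mu g)%E.
Proof.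
move=> mf mg fg; apply: ae_ge0_le_integral => //.
- by move=> x _; rewrite lee_fin normc2_ge0.
- exact: emeasurable_normc2.
- by move=> x _; rewrite lee_fin normc2_ge0.
- exact: emeasurable_normc2.
- by apply: filterS fg => x + _; rewrite lee_fin.
Qed.

Lemma ae_normL2_sq f g : cmeasurable f -> cmeasurable g ->
  {ae mu, forall x, f x = g x} -> normL2_sq mu f = normL2_sq mu g.
Proof.
move=> mf mg fg; apply/eqP; rewrite eq_le; apply/andP; split;
  by apply: ae_le_normL2_sq => //; apply: filterS fg => x ->.
Qed.

Lemma normL2_sqZ c f : cmeasurable f ->
  (normL2_sq mu (fun x => c * f x)%R = (normc c ^+ 2)%:E * normL2_sq mu f)%E.
Proof.
move=> mf; rewrite /normL2_sq -ge0_integralZl_EFin//.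
- by apply: eq_integral => x _; rewrite normc2M EFinM.
- by move=> x _; rewrite lee_fin normc2_ge0.
- exact: emeasurable_normc2.
- exact: normc2_ge0.
Qed.

Lemma normL2_sqN f : normL2_sq mu (fun x => - f x) = normL2_sq mu f.
Proof. by apply: eq_integral => x _; rewrite !normc2E !reimE !sqrrN. Qed.

Lemma normL2_sq_sym f g :
  normL2_sq mu (fun x => f x - g x) = normL2_sq mu (fun x => g x - f x).
Proof. by rewrite -normL2_sqN; under eq_fun do rewrite opprB. Qed.

(** Integrated form of [normc2D_le]. The factor 2 stands in for Minkowski's inequality: it avoids
    square roots of extended reals, holds without finiteness assumptions, and is harmless in
    approximation arguments. *)
Lemma normL2_sqD f g : cmeasurable f -> cmeasurable g ->
  (normL2_sq mu (fun x => f x + g x)%R <=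
   2%:E * (normL2_sq mu f + normL2_sq mu g))%E.
Proof.
move=> mf mg; rewrite /normL2_sq -ge0_integralD//; last 4 first.
- by move=> x _; rewrite lee_fin normc2_ge0.
- exact: emeasurable_normc2.
- by move=> x _; rewrite lee_fin normc2_ge0.
- exact: emeasurable_normc2.
rewrite -ge0_integralZl_EFin//; last 2 first.
- by move=> x _; rewrite adde_ge0// lee_fin normc2_ge0.
- by apply: emeasurable_funD; exact: emeasurable_normc2.
apply: ge0_le_integral => //.
- by move=> x _; rewrite lee_fin normc2_ge0.
- by apply: emeasurable_normc2; exact: cmeasurableD.
- apply: emeasurable_funM => //.
  by apply: emeasurable_funD; exact: emeasurable_normc2.
- by move=> x _; rewrite -EFinD -EFinM lee_fin normc2D_le.
Qed.

Lemma normL2_sq_trans f g h : cmeasurable f -> cmeasurable g -> cmeasurable h ->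
  (normL2_sq mu (fun x => f x - h x)%R <=
   2%:E * (normL2_sq mu (fun x => f x - g x)%R +
           normL2_sq mu (fun x => g x - h x)%R))%E.
Proof.
move=> mf mg mh; rewrite (_ : (fun x => f x - h x) =
  fun x => (f x - g x) + (g x - h x)); last by apply/funext => x; ring.
by apply: normL2_sqD; exact: cmeasurableB.
Qed.

Lemma normL2_sq_eq0 f : cmeasurable f -> normL2_sq mu f = 0%E ->
  {ae mu, forall x, f x = 0}.
Proof.
move=> mf f0.
have /ae_eq_integral_abs h0 : (\int[mu]_x `|(normc (f x) ^+ 2)%:E| = 0)%E.
  rewrite -[RHS]f0; apply: eq_integral => x _.
  by rewrite gee0_abs// lee_fin normc2_ge0.
apply: filterS (h0 measurableT (emeasurable_normc2 mf)) => x /(_ I)/eqP.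
by rewrite eqe => /eqP/normc2_eq0.
Qed.

Lemma ae_eq_of_normL2_sq f g : cmeasurable f -> cmeasurable g ->
  (forall e : R, 0 < e -> (normL2_sq mu (fun x => f x - g x)%R <= e%:E)%E) ->
  {ae mu, forall x, f x = g x}.
Proof.
move=> mf mg fg0; have : normL2_sq mu (fun x => f x - g x) = 0%E.
  by apply/eqP; rewrite eq_le normL2_sq_ge0 andbT; apply/lee_addgt0Pr => e e0;
    rewrite add0e fg0.
move/normL2_sq_eq0 => /(_ (cmeasurableB mf mg)).
by apply: filterS => x /eqP; rewrite subr_eq0 => /eqP.
Qed.

Lemma L2_measurable f : L2 mu f -> cmeasurable f. Proof. by case. Qed.

Lemma L2_fin_num f : L2 mu f -> normL2_sq mu f \is a fin_num.
Proof. by move=> [_ foo]; rewrite ge0_fin_numE// normL2_sq_ge0. Qed.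

Lemma L2D f g : L2 mu f -> L2 mu g -> L2 mu (fun x => f x + g x).
Proof.
move=> [mf foo] [mg goo]; split; first exact: cmeasurableD.
apply: le_lt_trans (normL2_sqD mf mg) _.
by rewrite lte_mul_pinfty// lte_add_pinfty.
Qed.

Lemma L2Z c f : L2 mu f -> L2 mu (fun x => c * f x).
Proof.
move=> [mf foo]; split; first exact: cmeasurableZ.
by rewrite normL2_sqZ// lte_mul_pinfty// lee_fin normc2_ge0.
Qed.

Lemma L2N f : L2 mu f -> L2 mu (fun x => - f x).
Proof. by move=> [mf foo]; split; [exact: cmeasurableN|rewrite normL2_sqN]. Qed.

Lemma L2B f g : L2 mu f -> L2 mu g -> L2 mu (fun x => f x - g x).
Proof. by move=> Lf Lg; apply: L2D => //; exact: L2N. Qed.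

Lemma L20 : L2 mu (fun=> 0).
Proof.
split; first exact: cmeasurable_cst.
rewrite /normL2_sq; under eq_integral do rewrite ComplexField.Normc.normc0 expr0n.
by rewrite integral0.
Qed.

Lemma L2_sum (I : Type) (s : seq I) (F : I -> T -> R[i]) :
  (forall i, L2 mu (F i)) -> L2 mu (fun x => \sum_(i <- s) F i x).
Proof.
move=> mF; elim: s => [|i s ih].
  by under [X in L2 _ X]eq_fun do rewrite big_nil; exact: L20.
by under [X in L2 _ X]eq_fun do rewrite big_cons; exact: L2D.
Qed.

Lemma L2_ae_bounded f g (c : R) : L2 mu f -> cmeasurable g ->
  {ae mu, forall x, normc (g x) ^+ 2 <= c * normc (f x) ^+ 2} ->
  0 <= c -> L2 mu g /\ (normL2_sq mu g <= c%:E * normL2_sq mu f)%E.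
Proof.
move=> [mf foo] mg gf c0.
have le : (normL2_sq mu g <= c%:E * normL2_sq mu f)%E.
  have -> : (c%:E * normL2_sq mu f)%E =
      normL2_sq mu (fun x => (Num.sqrt c)%:C * f x).
    by rewrite normL2_sqZ// normc2_real sqr_sqrtr.
  apply: ae_le_normL2_sq => //; first exact: cmeasurableZ.
  by apply: filterS gf => x; rewrite normc2M normc2_real sqr_sqrtr.
by split => //; split => //; apply: le_lt_trans le _; rewrite lte_mul_pinfty.
Qed.

Lemma L2_bounded f g (c : R) : L2 mu f -> cmeasurable g -> 0 <= c ->
  (forall x, normc (g x) ^+ 2 <= c * normc (f x) ^+ 2) -> L2 mu g.
Proof. by move=> Lf mg c0 gf; have [] := L2_ae_bounded Lf mg (aeW _ gf) c0. Qed.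

Lemma cintegrable_measurable f : cintegrable f -> cmeasurable f.
Proof.
by move=> [/integrableP[f1 _] /integrableP[f2 _]]; split; exact/measurable_EFinP.
Qed.

Lemma cintegralD f g : cintegrable f -> cintegrable g ->
  cintegral mu (fun x => f x + g x) = cintegral mu f + cintegral mu g.
Proof.
move=> [f1 f2] [g1 g2]; apply: complexP; rewrite !reimE/=;
  by under eq_Rintegral do rewrite reimE; rewrite RintegralD.
Qed.

Lemma cintegralZ c f : cintegrable f ->
  cintegral mu (fun x => c * f x) = c * cintegral mu f.
Proof.
move=> [f1 f2]; apply: complexP; rewrite !reimE/=;
  under eq_Rintegral do rewrite reimE.
- by rewrite RintegralB ?RintegralZl// /comp; under eq_fun do rewrite EFinM;
    exact: integrableZl.
- by rewrite RintegralD ?RintegralZl// /comp; under eq_fun do rewrite EFinM;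
    exact: integrableZl.
Qed.

Lemma cintegralJ f : cintegrable f ->
  cintegral mu (fun x => (f x)^*) = (cintegral mu f)^*.
Proof.
move=> [f1 f2]; apply: complexP; rewrite !reimE/=.
  by under eq_Rintegral do rewrite reimE.
under eq_Rintegral do rewrite reimE -mulN1r.
by rewrite RintegralZl// mulN1r.
Qed.

Lemma cintegral0 : cintegral mu (fun=> 0) = 0.
Proof. by apply: complexP => /=; rewrite Rintegral_cst// mul0r. Qed.

Lemma ae_cintegral f g : cmeasurable f -> cmeasurable g ->
  {ae mu, forall x, f x = g x} -> cintegral mu f = cintegral mu g.
Proof.
move=> [f1 f2] [g1 g2] fg; apply: complexP => /=; rewrite /Rintegral; congr fine;
  apply: ae_eq_integral => //; try exact/measurable_EFinP;
  by apply: filterS fg => x /= ->.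
Qed.


(** Real and imaginary parts of the product are dominated by half the sum of the two squared moduli,
    which is integrable. *)
Lemma L2_mulJ f g : L2 mu f -> L2 mu g -> cintegrable (fun x => f x * (g x)^*).
Proof.
move=> [mf foo] [mg goo].
have h : mu.-integrable setT
    (fun x => ((normc (f x) ^+ 2 + normc (g x) ^+ 2) / 2)%:E).
  under eq_fun do rewrite mulrC EFinM EFinD.
  apply: integrableZl => //; apply: integrableD => //; apply/integrableP; split;
    try exact: emeasurable_normc2.
  - apply: le_lt_trans foo; apply: ge0_le_integral => //.
    + by apply: measurableT_comp => //; exact: emeasurable_normc2.
    + exact: emeasurable_normc2.
    + by move=> x _; rewrite lee_fin ger0_norm// normc2_ge0.
  - apply: le_lt_trans goo; apply: ge0_le_integral => //.
    + by apply: measurableT_comp => //; exact: emeasurable_normc2.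
    + exact: emeasurable_normc2.
    + by move=> x _; rewrite lee_fin ger0_norm// normc2_ge0.
have [p1 p2] := cmeasurableM mf (cmeasurableJ mg).
split; apply: le_integrable h => //; try exact/measurable_EFinP;
  move=> x _ /=; rewrite lee_fin -(normcJ_normc (g x));
  apply: le_trans (ler_norm _).
- exact: abs_ReM_le.
- exact: abs_ImM_le.
Qed.

Definition norm2 f : R := fine (normL2_sq mu f).

Lemma norm2E f : L2 mu f -> normL2_sq mu f = (norm2 f)%:E.
Proof. by move=> Lf; rewrite fineK// L2_fin_num. Qed.

Lemma norm2_ge0 f : 0 <= norm2 f.
Proof. by rewrite fine_ge0// normL2_sq_ge0. Qed.

Lemma inner_self f : inner mu f f = (norm2 f)%:C.
Proof.
apply: complexP => /=.
- by rewrite /norm2; congr fine; apply: eq_integral => x _; rewrite mulcJ.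
- rewrite /Rintegral (eq_integral (cst 0%E)) ?integral0// => x _.
  by rewrite mulcJ.
Qed.

Lemma innerDl f g h : L2 mu f -> L2 mu g -> L2 mu h ->
  inner mu (fun x => f x + g x) h = inner mu f h + inner mu g h.
Proof.
move=> Lf Lg Lh; rewrite /inner -cintegralD; try exact: L2_mulJ.
by congr cintegral; apply/funext => x; rewrite mulrDl.
Qed.

Lemma innerZl c f h : L2 mu f -> L2 mu h ->
  inner mu (fun x => c * f x) h = c * inner mu f h.
Proof.
move=> Lf Lh; rewrite /inner -cintegralZ; try exact: L2_mulJ.
by congr cintegral; apply/funext => x; rewrite mulrA.
Qed.

Lemma innerC f h : L2 mu f -> L2 mu h -> inner mu h f = (inner mu f h)^*.
Proof.
move=> Lf Lh; rewrite /inner -cintegralJ; try exact: L2_mulJ.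
by congr cintegral; apply/funext => x; apply: complexP; rewrite !reimE; ring.
Qed.

Lemma innerNl f h : L2 mu f -> L2 mu h ->
  inner mu (fun x => - f x) h = - inner mu f h.
Proof.
move=> Lf Lh; rewrite (_ : (fun x => - f x) = (fun x => -1 * f x)).
  by rewrite innerZl// mulN1r.
by apply/funext => x; rewrite mulN1r.
Qed.

Lemma innerBl f g h : L2 mu f -> L2 mu g -> L2 mu h ->
  inner mu (fun x => f x - g x) h = inner mu f h - inner mu g h.
Proof. by move=> Lf Lg Lh; rewrite innerDl ?innerNl//; exact: L2N. Qed.

Lemma ae_inner f f' h h' : L2 mu f -> L2 mu f' -> L2 mu h -> L2 mu h' ->
  {ae mu, forall x, f x = f' x} -> {ae mu, forall x, h x = h' x} ->
  inner mu f h = inner mu f' h'.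
Proof.
move=> [mf _] [mf' _] [mh _] [mh' _] ff hh; apply: ae_cintegral.
- by apply: cmeasurableM => //; exact: cmeasurableJ.
- by apply: cmeasurableM => //; exact: cmeasurableJ.
- by apply: filterS2 ff hh => x -> ->.
Qed.

Lemma norm2D f g : L2 mu f -> L2 mu g ->
  norm2 (fun x => f x + g x) = norm2 f + norm2 g + 2 * Re (inner mu f g).
Proof.
move=> Lf Lg; have Lfg := L2D Lf Lg.
have := inner_self (fun x => f x + g x).
rewrite innerDl// (innerC Lfg Lf) (innerC Lfg Lg) !innerDl//.
rewrite (innerC Lf Lg) !inner_self => /(congr1 (@Re R)); rewrite !reimE/= => <-; ring.
Qed.

Lemma norm2Z c f : L2 mu f -> norm2 (fun x => c * f x) = normc c ^+ 2 * norm2 f.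
Proof.
move=> Lf; rewrite /norm2 normL2_sqZ//; last exact: L2_measurable.
by rewrite fineM// L2_fin_num.
Qed.

Lemma norm2_eq0 f : L2 mu f -> norm2 f = 0 -> {ae mu, forall x, f x = 0}.
Proof.
by move=> Lf f0; apply: normL2_sq_eq0; [case: Lf|rewrite norm2E// f0].
Qed.

Lemma cauchy_schwarz f g : L2 mu f -> L2 mu g ->
  normc (inner mu f g) ^+ 2 <= norm2 f * norm2 g.
Proof.
move=> Lf Lg; have [g0|g0] := eqVneq (norm2 g) 0.
  have h := norm2_eq0 Lg g0.
  rewrite g0 mulr0 (ae_inner Lf Lf Lg L20 (aeW _ (fun=> erefl)) h).
  rewrite (_ : inner mu f (fun=> 0) = 0) ?ComplexField.Normc.normc0 ?expr0n//.
  rewrite -[RHS]cintegral0; congr cintegral; apply/funext => x.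
  by apply: complexP; rewrite !reimE/=; ring.
have gt0 : 0 < norm2 g by rewrite lt_neqAle eq_sym g0 norm2_ge0.
set z := inner mu f g; set b := norm2 g in gt0 g0 *.
(* The vector [f - (z / b) g] is the component of [f] orthogonal to [g]; expanding its squared norm
   and multiplying by [b] gives the inequality. *)
have := norm2_ge0 (fun x => f x + (- (z * (b^-1)%:C)) * g x).
rewrite norm2D//; last exact: L2Z.
rewrite norm2Z// (innerC (L2Z _ Lg) Lf) innerZl// (innerC Lf Lg) -/z -/b.
rewrite !normc2E !reimE/= !(mulr0, subr0, addr0, oppr0, add0r).
rewrite -(ler_pM2r gt0) mul0r.
set a := norm2 f; set x := Re z; set y := Im z => h.
have -> : x ^+ 2 + y ^+ 2 = a * b - (a + ((- (x * b^-1)) ^+ 2 +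
    (- (y * b^-1)) ^+ 2) * b + 2 * (- (x * b^-1) * x - (- (y * b^-1)) * - y)) * b.
  by field.
by rewrite gerBl; exact: h.
Qed.

End L2_theory.

(** * Functions on a product, viewed fibre by fibre over the first factor *)

Section mixed_L2.
Context dD dQ (D : measurableType dD) (Q : measurableType dQ) (R : realType).
Variable nu : probability D R.
Variable muQ : {sigma_finite_measure set Q -> \bar R}.
Local Notation X := (D * Q)%type.
Local Notation nuQ := (nu \x muQ : {measure set X -> \bar R})%E.
Implicit Types F G H : X -> R[i].

(** The product measure of a set is the integral of the measures of its sections, so almost every
    section of a null set is null. *)
Lemma ae_prod (P : X -> Prop) : {ae nuQ, forall p, P p} ->
  {ae nu, forall a, {ae muQ, forall c, P (a, c)}}.
Proof.
move=> [N [mN N0 PN]].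
have mx := measurable_fun_xsection muQ mN.
have /ae_eq_integral_abs h : (\int[nu]_a `|muQ (xsection N a)| = 0)%E.
  by rewrite -[RHS]N0; apply: eq_integral => a _; rewrite gee0_abs.
apply: filterS (h measurableT mx) => a /(_ I) /= Na.
exists (xsection N a); split => //; first exact: measurable_xsection.
by move=> c Pc; rewrite /xsection/= inE; exact: PN.
Qed.

Lemma cmeasurable_section F a : cmeasurable F -> cmeasurable (fun c => F (a, c)).
Proof. by move=> mF; apply: (cmeasurable_comp mF); exact: pair1_measurable. Qed.

Lemma cmeasurable_fst (m : D -> R[i]) :
  cmeasurable m -> cmeasurable (fun p : X => m p.1).
Proof. by move=> mm; apply: (cmeasurable_comp mm); exact: measurable_fst. Qed.

Lemma cmeasurable_fstM (m : D -> R[i]) F :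
  cmeasurable m -> cmeasurable F -> cmeasurable (fun p : X => m p.1 * F p).
Proof. by move=> mm mF; apply: cmeasurableM => //; exact: cmeasurable_fst. Qed.

(** For [F = Z phi] the real value of this is the bracket of [phi] with itself. It is kept extended
    real because only almost every section of [F] is square integrable. *)
Definition weight F a : \bar R := normL2_sq muQ (fun c => F (a, c)).

Definition mixed_inner F G a : R[i] :=
  inner muQ (fun c => F (a, c)) (fun c => G (a, c)).

Lemma weight_ge0 F a : (0 <= weight F a)%E.
Proof. exact: normL2_sq_ge0. Qed.

Lemma measurable_weight F : cmeasurable F -> measurable_fun setT (weight F).
Proof.
move=> mF; apply: (measurable_fun_fubini_tonelli_F
  (fun p => (normc (F p) ^+ 2)%:E)); first exact: emeasurable_normc2.
by move=> p; rewrite lee_fin normc2_ge0.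
Qed.

Lemma normL2_sq_weight F : cmeasurable F ->
  (normL2_sq nuQ F = \int[nu]_a weight F a)%E.
Proof.
move=> mF; apply: (fubini_tonelli1 (fun p => (normc (F p) ^+ 2)%:E)).
  exact: emeasurable_normc2.
by move=> p; rewrite lee_fin normc2_ge0.
Qed.

Lemma normL2_sq_fstM (m : D -> R[i]) F : cmeasurable m -> cmeasurable F ->
  (normL2_sq nuQ (fun p => m p.1 * F p)%R =
   \int[nu]_a ((normc (m a) ^+ 2)%:E * weight F a))%E.
Proof.
move=> mm mF; rewrite normL2_sq_weight; last exact: cmeasurable_fstM.
apply: eq_integral => a _; rewrite /weight/= normL2_sqZ//.
exact: cmeasurable_section.
Qed.

Lemma L2_section F : L2 nuQ F ->
  {ae nu, forall a, L2 muQ (fun c => F (a, c))}.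
Proof.
move=> [mF]; rewrite normL2_sq_weight// => foo.
have : nu.-integrable setT (weight F).
  apply/integrableP; split; first exact: measurable_weight.
  by under eq_integral do rewrite gee0_abs ?weight_ge0//.
move/integrable_ae => /(_ measurableT); apply: filterS => a /(_ I) wa.
split; first exact: cmeasurable_section.
by rewrite ltey_eq wa.
Qed.

(** The inner integral is truncated to a real number by [fine]; this changes the usual Fubini
    integrand only on the null set where it is infinite. *)
Lemma Rintegral_fubini (f : X -> R) :
  nuQ.-integrable setT (fun p => (f p)%:E) ->
  nu.-integrable setT (fun a => (\int[muQ]_c f (a, c))%:E) /\
  (\int[nu]_a \int[muQ]_c f (a, c) = \int[nuQ]_p f p).
Proof.
move=> if_; have h := integrable_fubini_F if_; have mh := measurable_fubini_F if_.
have ae : ae_eq nu setT (fubini_F muQ (fun p => (f p)%:E))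
    (fun a => (\int[muQ]_c f (a, c))%:E).
  have := integrable_ae measurableT h; apply: filterS => a /(_ I) fa _.
  by rewrite /Rintegral fineK.
have mf : measurable_fun setT (fun a => (\int[muQ]_c f (a, c))%:E).
  by apply/measurable_EFinP; apply: measurableT_comp mh.
split.
- apply/integrableP; split => //; have /integrableP[_] := h.
  apply: le_lt_trans; rewrite le_eqVlt; apply/orP; left; apply/eqP.
  apply: ae_eq_integral => //; try exact: measurableT_comp.
  by apply: filterS ae => a /= + _ => ->.
- rewrite {3}/Rintegral -(integral12_prod_meas1 if_) {1}/Rintegral; congr fine.
  by apply/esym/ae_eq_integral.
Qed.

Lemma cintegral_fubini H : cintegrable nuQ H ->
  cintegrable nu (fun a => cintegral muQ (fun c => H (a, c))) /\
  cintegral nu (fun a => cintegral muQ (fun c => H (a, c))) = cintegral nuQ H.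
Proof.
move=> [H1 H2]; have [i1 e1] := Rintegral_fubini H1.
have [i2 e2] := Rintegral_fubini H2.
by split; [split|apply: complexP].
Qed.

Lemma mixed_inner_integrable F G : L2 nuQ F -> L2 nuQ G ->
  cintegrable nu (mixed_inner F G) /\
  cintegral nu (mixed_inner F G) = inner nuQ F G.
Proof. by move=> LF LG; apply: cintegral_fubini; exact: L2_mulJ. Qed.

Lemma mixed_inner_measurable F G : L2 nuQ F -> L2 nuQ G ->
  cmeasurable (mixed_inner F G).
Proof.
by move=> LF LG; have [+ _] := mixed_inner_integrable LF LG;
  exact: cintegrable_measurable.
Qed.

Lemma mixed_inner_self F a : mixed_inner F F a = (fine (weight F a))%:C.
Proof. exact: inner_self. Qed.

Lemma mixed_cauchy_schwarz F G : L2 nuQ F -> L2 nuQ G ->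
  {ae nu, forall a, normc (mixed_inner F G a) ^+ 2 <=
    fine (weight F a) * fine (weight G a)}.
Proof.
move=> LF LG; apply: filterS2 (L2_section LF) (L2_section LG) => a Fa Ga.
exact: cauchy_schwarz.
Qed.

Lemma L2_fstM (m : D -> R[i]) F (K : R) : cmeasurable m ->
  (forall a, normc (m a) <= K) -> L2 nuQ F -> L2 nuQ (fun p => m p.1 * F p).
Proof.
move=> mm mK LF; apply: (L2_bounded (c := K ^+ 2) LF).
- by apply: cmeasurable_fstM => //; case: LF.
- exact: sqr_ge0.
- move=> p; rewrite normc2M ler_wpM2r ?normc2_ge0//.
  rewrite ler_sqr ?nnegrE ?normc_ge0//.
  by apply: le_trans (mK p.1); exact: normc_ge0.
Qed.

Lemma mixed_innerZl (m : D -> R[i]) F G : L2 nuQ F -> L2 nuQ G ->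
  {ae nu, forall a,
    mixed_inner (fun p => m p.1 * F p) G a = m a * mixed_inner F G a}.
Proof.
move=> LF LG; apply: filterS2 (L2_section LF) (L2_section LG) => a Fa Ga.
exact: (innerZl (m a) Fa Ga).
Qed.

Lemma mixed_innerC F G : L2 nuQ F -> L2 nuQ G ->
  {ae nu, forall a, mixed_inner G F a = (mixed_inner F G a)^*}.
Proof.
move=> LF LG; apply: filterS2 (L2_section LF) (L2_section LG) => a Fa Ga.
exact: innerC.
Qed.

Lemma inner_fstM (m : D -> R[i]) (K : R) F G : cmeasurable m ->
  (forall a, normc (m a) <= K) -> L2 nuQ F -> L2 nuQ G ->
  inner nuQ (fun p => m p.1 * F p) G =
  cintegral nu (fun a => m a * mixed_inner F G a).
Proof.
move=> mm mK LF LG; have LmF := L2_fstM mm mK LF.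
rewrite -(mixed_inner_integrable LmF LG).2; apply: ae_cintegral.
- exact: mixed_inner_measurable.
- by apply: cmeasurableM => //; exact: mixed_inner_measurable.
- exact: mixed_innerZl.
Qed.

(* [weight F <= B] expresses that multiplication by F maps L^2(D) into        *)
(* L^2(D x Q), with norm at most the square root of B.                        *)
Definition bounded_weight B F := {ae nu, forall a, (weight F a <= B%:E)%E}.

Lemma normL2_sq_fstM_le B (m : D -> R[i]) F :
  cmeasurable m -> cmeasurable F -> bounded_weight B F -> 0 <= B ->
  (normL2_sq nuQ (fun p => m p.1 * F p)%R <= B%:E * normL2_sq nu m)%E.
Proof.
move=> mm mF FB B0; rewrite normL2_sq_fstM// /normL2_sq -ge0_integralZl_EFin//.
- apply: ae_ge0_le_integral => //.
  + by move=> a _; rewrite mule_ge0 ?weight_ge0// lee_fin normc2_ge0.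
  + apply: emeasurable_funM; first exact: emeasurable_normc2.
    exact: measurable_weight.
  + by move=> a _; rewrite -EFinM lee_fin mulr_ge0// normc2_ge0.
  + by apply: emeasurable_funM => //; exact: emeasurable_normc2.
  + apply: filterS FB => a Fa _; rewrite muleC; apply: lee_wpmul2r => //.
    by rewrite lee_fin normc2_ge0.
- by move=> a _; rewrite lee_fin normc2_ge0.
- exact: emeasurable_normc2.
Qed.

Lemma L2_fstM_weight B (m : D -> R[i]) F :
  L2 nu m -> cmeasurable F -> bounded_weight B F -> 0 <= B ->
  L2 nuQ (fun p => m p.1 * F p).
Proof.
move=> [mm moo] mF FB B0; split; first exact: cmeasurable_fstM.
by apply: le_lt_trans (normL2_sq_fstM_le mm mF FB B0) _; rewrite lte_mul_pinfty.
Qed.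

(** Cauchy-Schwarz in each fibre bounds the squared bracket by [B] times the weight of [F], and the
    integral of that weight is the squared norm of [F]. *)
Lemma mixed_inner_L2 B F G : L2 nuQ F -> L2 nuQ G -> bounded_weight B G ->
  0 <= B -> L2 nu (mixed_inner F G) /\
  (normL2_sq nu (mixed_inner F G) <= B%:E * normL2_sq nuQ F)%E.
Proof.
move=> LF LG GB B0; have mFG := mixed_inner_measurable LF LG.
have h : (normL2_sq nu (mixed_inner F G) <= B%:E * normL2_sq nuQ F)%E.
  have [mF _] := LF.
  rewrite (normL2_sq_weight mF) -ge0_integralZl_EFin//; last 2 first.
  - by move=> a _; exact: weight_ge0.
  - exact: measurable_weight.
  apply: ae_ge0_le_integral => //.
  - by move=> a _; rewrite lee_fin normc2_ge0.
  - exact: emeasurable_normc2.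
  - by move=> a _; rewrite mule_ge0// weight_ge0.
  - by apply: emeasurable_funM => //; exact: measurable_weight.
  - apply: filterS3 (L2_section LF) (mixed_cauchy_schwarz LF LG) GB => a Fa + Ga _.
    rewrite -lee_fin => /le_trans; apply.
    have wF : weight F a \is a fin_num by exact: L2_fin_num.
    rewrite mulrC EFinM (fineK wF); apply: lee_wpmul2r; first exact: weight_ge0.
    rewrite fineK// ge0_fin_numE ?weight_ge0//.
    by rewrite (le_lt_trans Ga)// ltry.
split => //; split => //; apply: le_lt_trans h _.
by rewrite lte_mul_pinfty//; case: LF.
Qed.

Lemma weight_eq0 F : cmeasurable F -> {ae nu, forall a, weight F a = 0%E} ->
  {ae nuQ, forall p, F p = 0}.
Proof.
move=> mF w0; apply: normL2_sq_eq0 => //; rewrite normL2_sq_weight//.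
rewrite (ae_eq_integral (cst 0%E)) ?integral0//; first exact: measurable_weight.
by apply: filterS w0 => a.
Qed.

(** Moving [m] to the other argument as its conjugate and applying Fubini. With [m = chi k],
    coefficients along modulations of [G] become Fourier coefficients of a bracket. *)
Lemma inner_fstMr (m : D -> R[i]) (K : R) F G : cmeasurable m ->
  (forall a, normc (m a) <= K) -> L2 nuQ F -> L2 nuQ G ->
  inner nuQ F (fun p => m p.1 * G p) = inner nu (mixed_inner F G) m.
Proof.
move=> mm mK LF LG.
have -> : inner nuQ F (fun p => m p.1 * G p) =
    inner nuQ (fun p => (m p.1)^* * F p) G.
  by congr cintegral; apply/funext => p; apply: complexP; rewrite !reimE; ring.
rewrite (@inner_fstM (fun a => (m a)^*) K)//; last 2 first.
- exact: cmeasurableJ.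
- by move=> a; rewrite normcJ_normc.
by congr cintegral; apply/funext => a; rewrite mulrC.
Qed.

Lemma cmeasurable_snd (u : Q -> R[i]) :
  cmeasurable u -> cmeasurable (fun p : X => u p.2).
Proof. by move=> mu; apply: (cmeasurable_comp mu); exact: measurable_snd. Qed.

Definition tensor (m : D -> R[i]) (u : Q -> R[i]) : X -> R[i] :=
  fun p => m p.1 * u p.2.

Lemma cmeasurable_tensor m u :
  cmeasurable m -> cmeasurable u -> cmeasurable (tensor m u).
Proof.
by move=> mm mu; apply: cmeasurable_fstM => //; exact: cmeasurable_snd.
Qed.

Lemma normL2_sq_tensor m u : cmeasurable m -> L2 muQ u ->
  normL2_sq nuQ (tensor m u) = (normL2_sq nu m * normL2_sq muQ u)%E.
Proof.
move=> mm Lu; rewrite normL2_sq_fstM//; last by apply: cmeasurable_snd; case: Lu.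
rewrite muleC (norm2E Lu) -ge0_integralZl_EFin//.
- by apply: eq_integral => a _; rewrite /weight -/(normL2_sq muQ u) (norm2E Lu) muleC.
- by move=> a _; rewrite lee_fin normc2_ge0.
- exact: emeasurable_normc2.
- exact: norm2_ge0.
Qed.

Lemma L2_tensor m u : L2 nu m -> L2 muQ u -> L2 nuQ (tensor m u).
Proof.
move=> Lm Lu; split; first by apply: cmeasurable_tensor; [case: Lm|case: Lu].
by rewrite normL2_sq_tensor//; [rewrite (norm2E Lm) (norm2E Lu) ltry|case: Lm].
Qed.

Lemma inner_tensor m n u v : L2 nu m -> L2 nu n -> L2 muQ u -> L2 muQ v ->
  inner nuQ (tensor m u) (tensor n v) = inner nu m n * inner muQ u v.
Proof.
move=> Lm Ln Lu Lv.
rewrite -(mixed_inner_integrable (L2_tensor Lm Lu) (L2_tensor Ln Lv)).2.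
rewrite mulrC -cintegralZ; last exact: L2_mulJ.
congr cintegral; apply/funext => a; rewrite /mixed_inner/tensor/=.
rewrite (innerZl (m a) Lu (L2Z (n a) Lv)) (innerC (L2Z (n a) Lv) Lu).
rewrite (innerZl (n a) Lv Lu) (innerC Lu Lv).
by apply: complexP; rewrite !reimE; ring.
Qed.

End mixed_L2.

(** * Linear spans and their closures in the square norm *)

Section span_closure.
Context d (T : measurableType d) (R : realType) (mu : {measure set T -> \bar R}).
Context (I : choiceType).
Implicit Types (e : I -> T -> R[i]) (f g : T -> R[i]) (V W : set (T -> R[i])).

Definition linear_set V :=
  V (fun=> 0) /\ forall (a : R[i]) f g, V f -> V g -> V (fun x => a * f x + g x).

Lemma linear_sum V (J : Type) (s : seq J) (F : J -> T -> R[i]) :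
  linear_set V -> (forall j, V (F j)) -> V (fun x => \sum_(j <- s) F j x).
Proof.
move=> [V0 VD] VF; elim: s => [|j s ih].
  by under eq_fun do rewrite big_nil.
under eq_fun do rewrite big_cons.
under eq_fun do rewrite -[X in X + _]mul1r.
exact: VD.
Qed.

Lemma linear_setZ V (a : R[i]) f : linear_set V -> V f -> V (fun x => a * f x).
Proof.
move=> [V0 VD] Vf; rewrite (_ : (fun x => _) = fun x => a * f x + 0).
  exact: VD.
by apply/funext => x; rewrite addr0.
Qed.

Lemma span_gen e k : Defs.span e (e k).
Proof.
exists [fset k]%fset, (fun=> 1); apply/funext => x.
by rewrite big_seq_fset1 mul1r.
Qed.

Lemma span_linear e : linear_set (Defs.span e).
Proof.
split=> [|a f g [F [c ->]] [F' [c' ->]]].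
  by exists fset0, (fun=> 0); apply/funext => x; rewrite big_seq_fset0.
exists (F `|` F')%fset, (fun k => a * (if k \in F then c k else 0) +
  (if k \in F' then c' k else 0)).
apply/funext => x; under [RHS]eq_bigr do rewrite mulrDl -mulrA.
rewrite big_split/= -mulr_sumr; congr (a * _ + _).
- transitivity (\sum_(k <- F) (if k \in F then c k else 0) * e k x).
    by apply: eq_big_seq => k kF; rewrite kF.
  apply: big_fset_incl; first exact: fsubsetUl.
  by move=> k _ /negbTE ->; rewrite mul0r.
- transitivity (\sum_(k <- F') (if k \in F' then c' k else 0) * e k x).
    by apply: eq_big_seq => k kF; rewrite kF.
  apply: big_fset_incl; first exact: fsubsetUr.
  by move=> k _ /negbTE ->; rewrite mul0r.
Qed.

Lemma span_L2 e f : (forall k, L2 mu (e k)) -> Defs.span e f -> L2 mu f.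
Proof.
by move=> Le [F [c ->]]; apply: (@L2_sum _ _ _ _ _ _ (fun k x => c k * e k x)) => k;
  exact: L2Z.
Qed.

Lemma closureL2_L2 V f : closureL2 mu V f -> L2 mu f. Proof. by case. Qed.

Lemma closureL2_refl V f : L2 mu f -> V f -> closureL2 mu V f.
Proof.
move=> Lf Vf; split => // e e0; exists f => //.
rewrite /normL2_sq; under eq_integral do
  rewrite subrr ComplexField.Normc.normc0 expr0n.
by rewrite integral0 lte_fin.
Qed.

Lemma closureL2_linear V : (forall f, V f -> L2 mu f) -> linear_set V ->
  linear_set (closureL2 mu V).
Proof.
move=> VL [V0 VD]; split; first by apply: closureL2_refl => //; exact: VL.
move=> a f g [Lf fV] [Lg gV]; split; first exact: (L2D (L2Z _ Lf) Lg).
(* The summand 1 keeps [K] positive when [a = 0]. The tolerances [eps / (4 K)] and [eps / 4] absorb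
   the factor [normc a ^+ 2] and the factor 2 of [normL2_sqD]. *)
move=> eps e0; pose K : R := normc a ^+ 2 + 1.
have K0 : 0 < K by rewrite ltr_wpDl// normc2_ge0.
have [f' Vf' ff'] := fV _ (divr_gt0 e0 (mulr_gt0 (ltr0Sn R 3) K0)).
have [g' Vg' gg'] := gV _ (divr_gt0 e0 (ltr0Sn R 3)).
exists (fun x => a * f' x + g' x); first exact: VD.
have -> : (fun x => a * f x + g x - (a * f' x + g' x)) =
    (fun x => a * (f x - f' x) + (g x - g' x)) by apply/funext => x; ring.
have [mf _] := Lf; have [mg _] := Lg.
have [mf' _] := VL _ Vf'; have [mg' _] := VL _ Vg'.
have mff := cmeasurableB mf mf'; have mgg := cmeasurableB mg mg'.
apply: le_lt_trans (normL2_sqD mu (cmeasurableZ a mff) mgg) _.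
rewrite normL2_sqZ//.
have Lff := L2B Lf (VL _ Vf'); have Lgg := L2B Lg (VL _ Vg').
move: ff' gg'; rewrite (norm2E Lff) (norm2E Lgg) -(EFinM (normc a ^+ 2)) -EFinD -EFinM !lte_fin.
set u := norm2 _ _; set v := norm2 _ _ => ff' gg'.
have u0 : 0 <= u by exact: norm2_ge0.
have : normc a ^+ 2 * u <= K * u by rewrite ler_wpM2r// lerDl.
have : K * u < eps / 4.
  move: ff'; rewrite -(ltr_pM2l K0) => /lt_le_trans; apply.
  by rewrite le_eqVlt; apply/orP; left; apply/eqP; field; exact: lt0r_neq0.
lra.
Qed.

Lemma closureL2_closed V f : (forall f, V f -> L2 mu f) -> L2 mu f ->
  (forall eps : R, 0 < eps -> exists2 g, closureL2 mu V g &
     (normL2_sq mu (fun x => f x - g x)%R < eps%:E)%E) ->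
  closureL2 mu V f.
Proof.
move=> VL Lf fV; split => // eps e0.
have e4 : 0 < eps / 4 by rewrite divr_gt0.
have [g [Lg gV] fg] := fV _ e4; have [h Vh gh] := gV _ e4.
exists h => //; have Lh := VL _ Vh.
apply: le_lt_trans (normL2_sq_trans mu Lf.1 Lg.1 Lh.1) _.
move: fg gh; rewrite (norm2E (L2B Lf Lg)) (norm2E (L2B Lg Lh)).
rewrite -EFinD -EFinM !lte_fin; lra.
Qed.

Lemma closureL2_sub V W : (forall f, V f -> L2 mu f) ->
  (forall f, W f -> closureL2 mu V f) -> closureL2 mu W `<=` closureL2 mu V.
Proof.
move=> VL WV f [Lf fW]; apply: closureL2_closed => // eps e0.
by have [g /WV Vg fg] := fW _ e0; exists g.
Qed.

End span_closure.

Lemma normc_real (R : realType) (r : R) : normc r%:C = `|r|.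
Proof. by rewrite /= expr0n addr0 sqrtr_sqr. Qed.

Lemma cvg0_lt (R : realType) (T : Type) (F : set_system T) (f : T -> \bar R)
    (e : R) : f @ F --> 0%E -> 0 < e -> \forall x \near F, (f x < e%:E)%E.
Proof.
move=> f0 e0; apply: (f0 [set y | (y < e%:E)%E]); apply: open_nbhs_nbhs.
by split; [exact: open_ereal_lt_ereal|rewrite /= lte_fin].
Qed.

Lemma dominated_cvg0 d (T : measurableType d) (R : realType)
    (mu : {measure set T -> \bar R}) (f_ : nat -> T -> \bar R) (g : T -> \bar R) :
  (forall n, measurable_fun setT (f_ n)) -> mu.-integrable setT g ->
  (forall n x, 0 <= f_ n x <= g x)%E ->
  {ae mu, forall x, f_ n x @[n --> \oo] --> 0%E} ->
  (\int[mu]_x f_ n x)%E @[n --> \oo] --> 0%E.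
Proof.
move=> mf ig fg f0.
have f0' : {ae mu, forall x, setT x -> f_ n x @[n --> \oo] --> cst 0%E x}.
  by apply: filterS f0.
have fg' : {ae mu, forall x n, setT x -> (`|f_ n x| <= g x)%E}.
  by apply: aeW => x n _; have /andP[? ?] := fg n x; rewrite gee0_abs.
have [_ _] := dominated_convergence measurableT mf (measurable_cst _) f0' ig fg'.
by rewrite integral0.
Qed.

(** * Modulations and multipliers *)

Section finite_partial_sums.
Context (R : realType) (I : choiceType).
Implicit Types (a : I -> \bar R) (A : {fset I}).

Lemma fset_le_esum a A : (forall k, 0 <= a k)%E ->
  (\sum_(k <- A) a k <= \esum_(k in [set: I]) a k)%E.
Proof.
move=> a0; apply: esum_ge; exists [set` A].
  by split => //; exact: finite_fset.
by rewrite fsbig_finite//= set_fsetK.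
Qed.

Lemma esum_gt_fset a (x : \bar R) : (x < \esum_(k in [set: I]) a k)%E ->
  exists A, (x < \sum_(k <- A) a k)%E.
Proof.
move=> /ereal_sup_gt[_ [F [finF _] <-] xF]; exists (fset_set F).
by rewrite -fsbig_finite.
Qed.

Lemma fset_subset_sum_le (f : I -> R) A B : (A `<=` B)%fset ->
  (forall k, 0 <= f k) -> \sum_(k <- A) f k <= \sum_(k <- B) f k.
Proof.
move=> AB f0.
have -> : \sum_(k <- A) f k = \sum_(k <- B) (if k \in A then f k else 0).
  transitivity (\sum_(k <- A) (if k \in A then f k else 0)).
    by apply: eq_big_seq => k ->.
  by apply: big_fset_incl => // k _ /negbTE ->.
by apply: ler_sum => k _; case: ifP.
Qed.

End finite_partial_sums.

Section clamp.
Context (R : realType).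
Implicit Types t u : R.

(* The iteration [q <- q + (t ^ 2 - q ^ 2) / 2] converges to [|t|] on [-1, 1]. *)
Fixpoint abs_approx (t : R) n : R :=
  if n is n'.+1 then abs_approx t n' + (t ^+ 2 - abs_approx t n' ^+ 2) / 2 else 0.

(** With [x = |t|] and [q] the current iterate, the next error is [(x - q) (1 - (x + q) / 2)]. This
    is nonnegative since [q <= x <= 1], and at most [(x - q) (1 - x / 2)] since [q >= 0]. *)
Lemma abs_approx_bound t n : `|t| <= 1 -> 0 <= abs_approx t n <= `|t| /\
  `|t| - abs_approx t n <= `|t| * (1 - `|t| / 2) ^+ n.
Proof.
move=> t1.
elim: n => [|n]; first by rewrite /= lexx normr_ge0 subr0 expr0 mulr1.
rewrite [abs_approx t n.+1]/= -(real_normK (num_real t)) [(1 - _) ^+ n.+1]exprS.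
have := normr_ge0 t; move: t1; set x : R := `|t|; set q := abs_approx t n => x1 x0 [/andP[q0 qx] h].
have p0 : 0 <= (1 - x / 2) ^+ n by rewrite exprn_ge0//; lra.
have h' : (1 - x / 2) * (x - q) <= (1 - x / 2) * (x * (1 - x / 2) ^+ n).
  by rewrite ler_wpM2l//; lra.
have e0 : 0 <= (x - q) * q by rewrite mulr_ge0// subr_ge0.
have e1 : 0 <= (x - q) * (2 - x - q) by rewrite mulr_ge0//; lra.
split; first by apply/andP; split; nra.
by rewrite mulrCA; apply: le_trans h'; nra.
Qed.

Lemma abs_approx_cvg t : `|t| <= 1 -> abs_approx t n @[n --> \oo] --> `|t|.
Proof.
move=> t1.
have h0 : `|t| * (1 - `|t| / 2) ^+ n @[n --> \oo] --> 0.
  have [->|t0] := eqVneq t 0.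
    by rewrite normr0; under eq_fun do rewrite mul0r; exact: cvg_cst.
  rewrite -[X in _ --> X](mulr0 `|t|); apply: cvgMr; apply: cvg_expr.
  have : 0 < `|t| by rewrite normr_gt0.
  by move=> ?; rewrite ger0_norm; lra.
apply: (squeeze_cvgr (f := fun n => `|t| - `|t| * (1 - `|t| / 2) ^+ n)
  (h := fun=> `|t|)).
- apply: nearW => n; have [/andP[_ q] h] := abs_approx_bound n t1.
  by rewrite q andbT; lra.
- by rewrite -[X in _ --> X](subr0 `|t|); apply: cvgB => //; exact: cvg_cst.
- exact: cvg_cst.
Qed.

(** The truncation of [t] to [[-1, 1]], written with absolute values so that [multiplier_abs]
    applies to it. *)
Definition clamp (t : R) : R := (`|t + 1| - `|t - 1|) / 2.

Lemma clampE t : `|t| <= 1 -> clamp t = t.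
Proof.
rewrite ler_norml /clamp => /andP[t1 t2].
by rewrite ger0_norm ?ler0_norm; lra.
Qed.

Lemma clamp_le t : `|clamp t| <= 1.
Proof.
rewrite /clamp normrM [X in _ * X]ger0_norm// ler_pdivrMr// mul1r.
by apply: le_trans (ler_dist_dist _ _) _; rewrite opprB addrC addrA subrK ger0_norm.
Qed.

Lemma clamp_lipschitz t u : `|clamp t - clamp u| <= `|t - u|.
Proof.
have := ler_dist_dist (t + 1) (u + 1); have := ler_dist_dist (t - 1) (u - 1).
rewrite (_ : t - 1 - (u - 1) = t - u); last by ring.
rewrite (_ : t + 1 - (u + 1) = t - u); last by ring.
rewrite !ler_norml /clamp => /andP[? ?] /andP[? ?]; lra.
Qed.

End clamp.

(** * Unimodular functions with Parseval's identity, an abstract form of the characters *)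

Section characters.
Context dD dQ (D : measurableType dD) (Q : measurableType dQ) (R : realType).
Variable nu : probability D R.
Variable muQ : {sigma_finite_measure set Q -> \bar R}.
Local Notation X := (D * Q)%type.
Local Notation nuQ := (nu \x muQ : {measure set X -> \bar R})%E.
Context (I : choiceType) (chi : I -> D -> R[i]).
Hypothesis chi_measurable : forall k, cmeasurable (chi k).
Hypothesis normc_chi : forall k a, normc (chi k a) = 1.
Hypothesis chiM : forall j k, exists l, forall a, chi j a * chi k a = chi l a.
Hypothesis chiJ : forall k, exists l, forall a, (chi k a)^* = chi l a.
Hypothesis chi1 : exists k, forall a, chi k a = 1.
Hypothesis parseval :
  forall m, L2 nu m -> coef_sq nu chi m = normL2_sq nu m.
Implicit Types F G H : X -> R[i].

Lemma normL2_sq_chi k : normL2_sq nu (chi k) = 1%E.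
Proof.
rewrite /normL2_sq; under eq_integral do rewrite normc_chi expr1n.
by rewrite integral_cst//= mul1e probability_setT.
Qed.

Lemma L2_chi k : L2 nu (chi k).
Proof. by split=> //; rewrite normL2_sq_chi ltry. Qed.

Lemma inner_chi_self k : inner nu (chi k) (chi k) = 1.
Proof. by rewrite inner_self /norm2 normL2_sq_chi. Qed.

(** In Parseval's identity for [chi j] the term of index [j] already equals the total squared norm
    1, so the term of index [k] must vanish. *)
Lemma chi_orthogonal j k : j != k -> inner nu (chi j) (chi k) = 0.
Proof.
move=> jk; have : ((1 + normc (inner nu (chi j) (chi k)) ^+ 2)%:E <= 1%:E)%E.
  rewrite -[leRHS](normL2_sq_chi j) -parseval; last exact: L2_chi.
  apply: le_trans (@fset_le_esum _ _ _ [fset j; k]%fset _).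
    rewrite big_fsetU1 ?in_fset1// big_seq_fset1 inner_chi_self.
    by rewrite ComplexField.Normc.normc1 expr1n.
  by move=> l; rewrite lee_fin normc2_ge0.
rewrite lee_fin gerDl => h; apply: normc2_eq0; apply/eqP.
by rewrite eq_le h normc2_ge0.
Qed.

Lemma inner_suml (s : seq I) (c : I -> R[i]) (f : I -> D -> R[i]) g :
  (forall k, L2 nu (f k)) -> L2 nu g ->
  inner nu (fun a => \sum_(k <- s) c k * f k a) g =
  \sum_(k <- s) c k * inner nu (f k) g.
Proof.
move=> Lf Lg; elim: s => [|k s ih].
  rewrite big_nil -[RHS](cintegral0 nu); congr cintegral; apply/funext => a.
  by rewrite big_nil mul0r.
rewrite big_cons -ih -innerZl// -innerDl//; last 2 first.
- exact: L2Z.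
- by apply: (@L2_sum _ _ _ _ _ _ (fun k x => c k * f k x)) => j; exact: L2Z.
by congr cintegral; apply/funext => a; rewrite big_cons.
Qed.

Definition fourier_sum (A : {fset I}) (m : D -> R[i]) (a : D) : R[i] :=
  \sum_(k <- A) inner nu m (chi k) * chi k a.

Lemma L2_fourier_sum A m : L2 nu (fourier_sum A m).
Proof.
apply: (@L2_sum _ _ _ _ _ _ (fun k a => inner nu m (chi k) * chi k a)) => k.
by apply: L2Z; exact: L2_chi.
Qed.

(** Pythagoras: by orthonormality the Fourier sum has the same inner product with itself as with
    [m]. *)
Lemma norm2_fourier_sum A m : L2 nu m ->
  norm2 nu (fun a => m a - fourier_sum A m a) =
  norm2 nu m - \sum_(k <- A) normc (inner nu m (chi k)) ^+ 2.
Proof.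
move=> Lm; have LS := L2_fourier_sum A m.
have SJ g : L2 nu g -> inner nu (fourier_sum A m) g =
    \sum_(k <- A) inner nu m (chi k) * inner nu (chi k) g.
  by move=> Lg; apply: inner_suml => //; exact: L2_chi.
have Schi j : j \in A -> inner nu (fourier_sum A m) (chi j) = inner nu m (chi j).
  move=> jA; rewrite SJ; last exact: L2_chi.
  rewrite (big_fsetD1 j)//= inner_chi_self mulr1 big1_seq ?addr0// => k /andP[_].
  by rewrite in_fsetD1 => /andP[kj _]; rewrite chi_orthogonal// mulr0.
have SS : inner nu (fourier_sum A m) (fourier_sum A m) =
    (\sum_(k <- A) normc (inner nu m (chi k)) ^+ 2)%:C.
  rewrite SJ// rmorph_sum/=; apply: eq_big_seq => k kA.
  by rewrite (innerC LS (L2_chi k)) Schi// mulcJ.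
have Sm : inner nu (fourier_sum A m) m =
    (\sum_(k <- A) normc (inner nu m (chi k)) ^+ 2)%:C.
  rewrite SJ// rmorph_sum/=; apply: eq_bigr => k _.
  by rewrite (innerC Lm (L2_chi k)) mulcJ.
rewrite norm2D//; last exact: L2N.
rewrite (innerC (L2N LS) Lm) innerNl// Sm.
have -> : norm2 nu (fun a => - fourier_sum A m a) =
    \sum_(k <- A) normc (inner nu m (chi k)) ^+ 2.
  move: SS; rewrite inner_self => -[]; rewrite /norm2 normL2_sqN => ->//.
by rewrite !reimE/=; ring.
Qed.

(** Parseval's identity supplies a finite set whose coefficients account for all of the squared norm
    but [e]; enlarging the set only decreases the error. *)
Lemma fourier_approx m (e : R) : L2 nu m -> 0 < e ->
  exists A, forall B, (A `<=` B)%fset ->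
    (normL2_sq nu (fun a => m a - fourier_sum B m a)%R < e%:E)%E.
Proof.
move=> Lm e0; have := parseval Lm; rewrite (norm2E Lm) => hm.
have [|A hA] := @esum_gt_fset _ _
    (fun k => (normc (inner nu m (chi k)) ^+ 2)%:E) (norm2 nu m - e)%:E.
  by rewrite -/(coef_sq nu chi m) hm lte_fin; lra.
exists A => B AB; rewrite norm2E; last exact: (L2B Lm (L2_fourier_sum B m)).
rewrite norm2_fourier_sum// lte_fin ltrBlDr -ltrBlDl -lte_fin.
apply: lt_le_trans hA _; rewrite sumEFin lee_fin.
by apply: fset_subset_sum_le => // k; exact: normc2_ge0.
Qed.

Definition modulates G : I -> X -> R[i] := fun k p => chi k p.1 * G p.

(** The image of the translation-invariant space generated by [g] when [G] represents [Z g]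
    ([zak_rep_space]). *)
Definition modulation_space G : set (X -> R[i]) :=
  closureL2 nuQ (Defs.span (modulates G)).

Lemma L2_modulates G k : L2 nuQ G -> L2 nuQ (modulates G k).
Proof. by apply: (@L2_fstM _ _ _ _ _ _ _ _ _ 1) => // a; rewrite normc_chi. Qed.

Lemma L2_modulates_span G F : L2 nuQ G -> Defs.span (modulates G) F -> L2 nuQ F.
Proof. by move=> LG; apply: span_L2 => k; exact: L2_modulates. Qed.

Lemma normL2_sq_modulates G k : cmeasurable G ->
  normL2_sq nuQ (modulates G k) = normL2_sq nuQ G.
Proof.
by move=> mG; apply: eq_integral => p _; rewrite normc2M normc_chi expr1n mul1r.
Qed.

Lemma modulation_space_L2 G F : modulation_space G F -> L2 nuQ F.
Proof. by case. Qed.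

Lemma modulation_space_linear G :
  L2 nuQ G -> linear_set (modulation_space G).
Proof.
move=> LG; apply: closureL2_linear; last exact: span_linear.
by move=> F; exact: L2_modulates_span.
Qed.

Lemma modulation_space_gen G k : L2 nuQ G -> modulation_space G (modulates G k).
Proof.
by move=> LG; apply: closureL2_refl; [exact: L2_modulates|exact: span_gen].
Qed.

Lemma modulation_space_refl G : L2 nuQ G -> modulation_space G G.
Proof.
move=> LG; have [k k1] := chi1; have := modulation_space_gen k LG.
by rewrite (_ : modulates G k = G)//; apply/funext => p; rewrite /modulates k1 mul1r.
Qed.

(** Modulation is isometric and, by [chiM], sends each generator to another one, so it preserves the
    span and its closure. *)
Lemma modulation_space_modulates G F k : L2 nuQ G -> modulation_space G F ->
  modulation_space G (modulates F k).
Proof.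
move=> LG [LF FG]; apply: closureL2_closed; first by
  move=> ?; exact: L2_modulates_span.
  exact: L2_modulates.
move=> e e0; have [F' F'G FF'] := FG _ e0; exists (modulates F' k).
  have LF' := L2_modulates_span LG F'G.
  apply: closureL2_refl; first exact: L2_modulates.
  case: F'G => A [c ->].
  have -> : modulates (fun x => \sum_(k0 <- A) c k0 * modulates G k0 x) k =
      fun x => \sum_(k0 <- A) c k0 * (chi k x.1 * modulates G k0 x).
    apply/funext => p; rewrite /modulates mulr_sumr; apply: eq_bigr => j _.
    by rewrite mulrCA.
  apply: linear_sum; first exact: span_linear.
  move=> j; apply: linear_setZ; first exact: span_linear.
  have [l hl] := chiM k j.
  rewrite (_ : (fun x => _) = modulates G l); first exact: span_gen.
  by apply/funext => p; rewrite /modulates mulrA hl.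
have LF' := L2_modulates_span LG F'G.
rewrite (_ : (fun x => _) = modulates (fun x => F x - F' x) k).
  by rewrite normL2_sq_modulates//; case: (L2B LF LF').
by apply/funext => p; rewrite /modulates mulrBr.
Qed.

Lemma modulation_space_trans F G H : L2 nuQ H ->
  modulation_space H G -> modulation_space G F -> modulation_space H F.
Proof.
move=> LH GH; apply: closureL2_sub.
  by move=> ?; exact: L2_modulates_span.
move=> _ [A [c ->]]; apply: linear_sum; first exact: modulation_space_linear.
move=> k; apply: linear_setZ; first exact: modulation_space_linear.
exact: modulation_space_modulates.
Qed.

(** All [G] are quantified over at once so that multipliers compose: [multiplierM] applies the
    property of [m] to the product of [m'] and [G]. *)
Definition multiplier (m : D -> R[i]) :=
  cmeasurable m /\ (exists K, forall a, normc (m a) <= K) /\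
  forall G, L2 nuQ G -> modulation_space G (fun p => m p.1 * G p).

Lemma multiplier_chi k : multiplier (chi k).
Proof.
split => //; split; first by exists 1 => a; rewrite normc_chi.
by move=> G; exact: modulation_space_gen.
Qed.

Lemma multiplierD m m' : multiplier m -> multiplier m' ->
  multiplier (fun a => m a + m' a).
Proof.
move=> [mm [[K mK] mG]] [mm' [[K' mK'] mG']]; split; first exact: cmeasurableD.
split.
  by exists (K + K') => a; apply: le_trans (le_normcD _ _) _; exact: lerD.
move=> G LG; have [_ VD] := modulation_space_linear LG.
rewrite (_ : (fun p => _) = fun p => 1 * (m p.1 * G p) + m' p.1 * G p).
  by apply: VD; [exact: mG|exact: mG'].
by apply/funext => p; rewrite mul1r mulrDl.
Qed.

Lemma multiplierZ c m : multiplier m -> multiplier (fun a => c * m a).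
Proof.
move=> [mm [[K mK] mG]]; split; first exact: cmeasurableZ.
split.
  exists (normc c * K) => a.
  by rewrite ComplexField.Normc.normcM ler_wpM2l// normc_ge0.
move=> G LG; rewrite (_ : (fun p => _) = fun p => c * (m p.1 * G p)).
  by apply: linear_setZ; [exact: modulation_space_linear|exact: mG].
by apply/funext => p; rewrite mulrA.
Qed.

Lemma multiplierM m m' : multiplier m -> multiplier m' ->
  multiplier (fun a => m a * m' a).
Proof.
move=> [mm [[K mK] mG]] [mm' [[K' mK'] mG']]; split; first exact: cmeasurableM.
split.
  exists (K * K') => a.
  by rewrite ComplexField.Normc.normcM ler_pM// normc_ge0.
move=> G LG; rewrite (_ : (fun p => _) = fun p => m p.1 * (m' p.1 * G p)).
  apply: (modulation_space_trans LG (mG' _ LG)); apply: mG.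
  exact: modulation_space_L2 (mG' _ LG).
by apply/funext => p; rewrite mulrA.
Qed.

Lemma multiplier_cst c : multiplier (fun=> c).
Proof.
have [k k1] := chi1; have := multiplierZ c (multiplier_chi k).
by under eq_fun do rewrite k1 mulr1.
Qed.

Lemma multiplier_realD (t u : D -> R) : multiplier (fun a => (t a)%:C) ->
  multiplier (fun a => (u a)%:C) -> multiplier (fun a => (t a + u a)%:C).
Proof. by move=> mt mu; under eq_fun do rewrite rmorphD; exact: multiplierD. Qed.

Lemma multiplier_realZ (r : R) (t : D -> R) : multiplier (fun a => (t a)%:C) ->
  multiplier (fun a => (r * t a)%:C).
Proof. by move=> mt; under eq_fun do rewrite rmorphM; exact: multiplierZ. Qed.

Lemma multiplier_realM (t u : D -> R) : multiplier (fun a => (t a)%:C) ->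
  multiplier (fun a => (u a)%:C) -> multiplier (fun a => (t a * u a)%:C).
Proof. by move=> mt mu; under eq_fun do rewrite rmorphM; exact: multiplierM. Qed.

Lemma multiplier_Re_sum (A : {fset I}) (c : I -> R[i]) :
  multiplier (fun a => (Re (\sum_(k <- A) c k * chi k a))%:C).
Proof.
have step k : multiplier (fun a => (Re (c k * chi k a))%:C).
  have [l hl] := chiJ k.
  rewrite (_ : (fun a => _) =
    (fun a => 2^-1%:C * (c k * chi k a + (c k)^* * chi l a))).
    by apply/multiplierZ/multiplierD; apply: multiplierZ; exact: multiplier_chi.
  apply/funext => a; rewrite -hl; apply: complexP; rewrite !reimE/= ?reimE/=; lra.
elim: (enum_fset A) => [|k s ih].
  by under eq_fun do rewrite big_nil/=; exact: multiplier_cst.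
by under eq_fun do rewrite big_cons reimE; exact: multiplier_realD.
Qed.

Lemma normL2_sq_fstM_cvg0 (t : nat -> D -> R) (K : R) G : L2 nuQ G ->
  (forall n, measurable_fun setT (t n)) -> (forall n a, `|t n a| <= K) ->
  (forall a, t n a @[n --> \oo] --> 0) ->
  normL2_sq nuQ (fun p => (t n p.1)%:C * G p) @[n --> \oo] --> 0%E.
Proof.
move=> LG mt tK t0; have [mG Goo] := LG.
have iG : nuQ.-integrable setT (fun p => (K ^+ 2 * normc (G p) ^+ 2)%:E).
  under eq_fun do rewrite EFinM; apply: integrableZl => //.
  apply/integrableP; split; first exact: emeasurable_normc2.
  by under eq_integral do rewrite gee0_abs ?lee_fin ?normc2_ge0//.
have mf n : measurable_fun setT (fun p : X => (normc ((t n p.1)%:C * G p) ^+ 2)%:E).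
  have mc := cmeasurable_fstM (cmeasurable_real (mt n)) mG.
  exact: (emeasurable_normc2 mc).
apply: (dominated_cvg0 mf iG).
- move=> n p; rewrite !lee_fin normc2_ge0 normc2M normc2_real/=.
  rewrite ler_wpM2r ?normc2_ge0// -real_normK ?num_real//.
  by rewrite ler_sqr ?nnegrE ?(le_trans _ (tK n p.1)).
- apply: aeW => p /=; apply: cvg_EFin; first exact: nearW.
  have h : t n p.1 * t n p.1 * normc (G p) ^+ 2 @[n --> \oo] --> 0.
    rewrite -[X in _ --> X](mul0r (normc (G p) ^+ 2)); apply: cvgMl.
    by rewrite -[X in _ --> X](mul0r 0); apply: cvgM; exact: t0.
  apply: cvg_trans h; apply: near_eq_cvg; apply: nearW => n.
  by rewrite /= normc2M normc2_real expr2.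
Qed.

(** Dominated convergence with majorant [(2 K)^2 |G|^2] makes the products [t n G] converge in norm
    to [u G], and the modulation space is closed. *)
Lemma multiplier_limit (t : nat -> D -> R) (u : D -> R) (K : R) :
  (forall n, multiplier (fun a => (t n a)%:C)) -> (forall n a, `|t n a| <= K) ->
  (forall a, t n a @[n --> \oo] --> u a) -> multiplier (fun a => (u a)%:C).
Proof.
move=> mt tK tu.
have mt_ n : measurable_fun setT (t n) by have [[]] := mt n.
have mu : measurable_fun setT u.
  by apply: (measurable_fun_cvg mt_) => a _; exact: tu.
have uK a : `|u a| <= K.
  have h : `|t n a| @[n --> \oo] --> `|u a| by apply: cvg_norm; exact: tu.
  by apply: (cvgr_to_le h); exact: nearW.
split; first exact: cmeasurable_real.
split; first by exists K => a; rewrite normc_real.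
move=> G LG; apply: closureL2_closed.
- by move=> ?; exact: L2_modulates_span.
- apply: (L2_fstM (K := K) (cmeasurable_real mu)) => // a.
  by rewrite normc_real.
move=> e e0.
have := @normL2_sq_fstM_cvg0 (fun n a => u a - t n a) (K + K) G LG.
have m1 n : measurable_fun setT (fun a => u a - t n a) by exact: measurable_funB.
have m2 n a : `|u a - t n a| <= K + K.
  by apply: le_trans (ler_normB _ _) _; exact: lerD.
have m3 a : u a - t n a @[n --> \oo] --> 0.
  by rewrite -(subrr (u a)); apply: cvgB; [exact: cvg_cst|exact: tu].
move=> /(_ m1 m2 m3) h; have [n _ /(_ _ (leqnn n)) hn] := cvg0_lt h e0.
exists (fun p => (t n p.1)%:C * G p); first by have [_ [_ mG]] := mt n; exact: mG.
by under eq_fun do rewrite -mulrBl -rmorphB.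
Qed.

(** After rescaling into [[-1, 1]], the absolute value is a bounded pointwise limit of the
    polynomials [abs_approx], and multipliers form an algebra. *)
Lemma multiplier_abs (t : D -> R) :
  multiplier (fun a => (t a)%:C) -> multiplier (fun a => `|t a|%:C).
Proof.
move=> mt; have [_ [[K0 tK0] _]] := mt.
pose K : R := `|K0| + 1; have K1 : 0 < K by rewrite ltr_wpDl.
have tK a : `|K^-1 * t a| <= 1.
  rewrite normrM normfV (gtr0_norm K1) ler_pdivrMl// mulr1.
  by rewrite -normc_real (le_trans (tK0 a))// (le_trans (ler_norm _))// lerDl.
have h : multiplier (fun a => `|K^-1 * t a|%:C).
  apply: (@multiplier_limit (fun n a => abs_approx (K^-1 * t a) n) _ 1).
  - elim=> [|n ih]; first exact: (multiplier_cst 0).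
    apply: multiplier_realD => //=.
    have hq : multiplier (fun a => ((K^-1 * t a) ^+ 2 -
        abs_approx (K^-1 * t a) n ^+ 2)%:C).
      under eq_fun do rewrite -mulN1r; apply: multiplier_realD.
        by under eq_fun do rewrite expr2; apply: multiplier_realM;
          exact: multiplier_realZ.
      apply: multiplier_realZ; under eq_fun do rewrite expr2.
      exact: multiplier_realM.
    by under eq_fun do rewrite mulrC; exact: multiplier_realZ.
  - move=> n a; have [/andP[q0 q1] _] := abs_approx_bound n (tK a).
    by rewrite ger0_norm// (le_trans q1).
  - by move=> a; exact: abs_approx_cvg.
rewrite (_ : (fun a => _) = fun a => (K * `|K^-1 * t a|)%:C).
  exact: multiplier_realZ.
apply/funext => a; rewrite normrM ger0_norm ?invr_ge0 ?ltW// mulrA divff ?mul1r//.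
exact: lt0r_neq0.
Qed.

Lemma multiplier_clamp (t : D -> R) :
  multiplier (fun a => (t a)%:C) -> multiplier (fun a => (clamp (t a))%:C).
Proof.
move=> mt; rewrite (_ : (fun a => _) =
  fun a => (2^-1 * (`|t a + 1| + -1 * `|t a + -1|))%:C); last first.
  by apply/funext => a; rewrite /clamp mulN1r mulrC.
apply/multiplier_realZ/multiplier_realD; last apply: multiplier_realZ.
- apply/multiplier_abs/multiplier_realD => //; exact: multiplier_cst.
- apply/multiplier_abs/multiplier_realD => //; exact: multiplier_cst.
Qed.

(** The weight is integrable, hence a.e. finite, so its part above level [N] tends to 0 pointwise
    a.e. while staying dominated by the weight. *)
Lemma weight_tail G (e : R) : L2 nuQ G -> 0 < e -> exists N : nat,
  (\int[nu]_a (if (N%:R%:E < weight muQ G a)%E then weight muQ G a else 0) < e%:E)%E.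
Proof.
move=> [mG Goo] e0; have mw := measurable_weight muQ mG.
have w0 := weight_ge0 muQ G.
rewrite (normL2_sq_weight nu muQ mG) in Goo.
have iw : nu.-integrable setT (weight muQ G).
  by apply/integrableP; split => //; under eq_integral do rewrite gee0_abs ?w0//.
have mf N : measurable_fun setT (fun a =>
    if (N%:R%:E < weight muQ G a)%E then weight muQ G a else 0%E).
  by apply: measurable_fun_ifT => //; exact: measurable_fun_lte.
have h : (\int[nu]_a (if (N%:R%:E < weight muQ G a)%E then weight muQ G a else 0))%E
    @[N --> \oo] --> 0%E.
  apply: (dominated_cvg0 mf iw).
    by move=> n a; case: ifP; rewrite ?w0 lexx.
  have := integrable_ae measurableT iw; apply: filterS => a /(_ Logic.I) wa.
  apply: cvg_near_cst; near=> N; rewrite ifF//; apply/negbTE; rewrite -leNgt.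
  rewrite -(fineK wa) lee_fin; apply: le_trans (ler_norm _) _.
  by near: N; exact: nbhs_infty_ger.
by have [N _ /(_ _ (leqnn N)) hN] := cvg0_lt h e0; exists N.
Unshelve. all: by end_near.
Qed.


(** Approximate [t] in [L2 nu] by a trigonometric polynomial and truncate its real part to
    [[-1, 1]]. The truncation is still a multiplier and is no further from [t], because [clamp] is
    1-Lipschitz and fixes [t]. As the weight of [G] may be unbounded, the error is split at a level
    [N]: below it the [L2 nu] error controls the integral, above it the bound 4 on the squared
    difference meets the small tail of the weight. *)
Lemma multiplier_unit_ball (t : D -> R) : measurable_fun setT t ->
  (forall a, `|t a| <= 1) -> multiplier (fun a => (t a)%:C).
Proof.
move=> mt t1; have mtc := cmeasurable_real mt.
split => //; split; first by exists 1 => a; rewrite normc_real.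
move=> G LG; have [mG _] := LG.
apply: closureL2_closed.
- by move=> ?; exact: L2_modulates_span.
- by apply: (L2_fstM (K := 1) mtc) => // a; rewrite normc_real.
(* The tail is multiplied by 4 and the polynomial error by at most [N + 1], so the tolerances
   [e / 8] and [e / 2 / (N + 1)] each contribute less than [e / 2]. *)
move=> e e0; have e8 : 0 < e / 8 by rewrite divr_gt0.
have [N hN] := weight_tail LG e8.
have d0 : 0 < e / 2 / N.+1%:R by rewrite !divr_gt0.
have Lt : L2 nu (fun a => (t a)%:C).
  apply: (L2_bounded (f := fun=> 1) (c := 1)) => //.
    by split; [exact: cmeasurable_cst|
      rewrite /normL2_sq ComplexField.Normc.normc1 expr1n integral_cst//=
        mul1e probability_setT ltry].
  move=> a; rewrite normc_real ComplexField.Normc.normc1 expr1n mulr1.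
  by rewrite expr_le1.
have [A /(_ A (fsubset_refl _)) hA] := fourier_approx Lt d0.
pose u a := clamp (Re (fourier_sum A (fun a => (t a)%:C) a)).
have mu : multiplier (fun a => (u a)%:C).
  by apply: multiplier_clamp; exact: multiplier_Re_sum.
exists (fun p => (u p.1)%:C * G p); first by have [_ [_]] := mu; exact.
have [muc _] := mu.
have mtu : cmeasurable (fun a => (t a)%:C - (u a)%:C) by exact: cmeasurableB.
have mts : cmeasurable (fun a => (t a)%:C - fourier_sum A (fun a => (t a)%:C) a).
  by apply: cmeasurableB => //; case: (L2_fourier_sum A (fun a => (t a)%:C)).
rewrite (_ : (fun p => _) = (fun p => ((t p.1)%:C - (u p.1)%:C) * G p)); last first.
  by apply/funext => p; rewrite mulrBl.
rewrite (normL2_sq_fstM nu muQ mtu mG).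
have mw := measurable_weight muQ mG; have w0 := weight_ge0 muQ G.
pose tail a := (if (N%:R%:E < weight muQ G a)%E then weight muQ G a else 0)%E.
have mtail : measurable_fun setT tail.
  by apply: measurable_fun_ifT => //; exact: measurable_fun_lte.
have tail0 a : (0 <= tail a)%E by rewrite /tail; case: ifP.
have mts2 : measurable_fun setT (fun a => (N.+1%:R%:E *
    (normc ((t a)%:C - fourier_sum A (fun a => (t a)%:C) a) ^+ 2)%:E)%E).
  by apply: emeasurable_funM => //; exact: emeasurable_normc2.
have ts0 a : (0 <= (N.+1%:R%:E *
    (normc ((t a)%:C - fourier_sum A (fun a => (t a)%:C) a) ^+ 2)%:E))%E.
  by rewrite -EFinM lee_fin mulr_ge0// normc2_ge0.
apply: (@le_lt_trans _ _ (\int[nu]_a (N.+1%:R%:E *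
    (normc ((t a)%:C - fourier_sum A (fun a => (t a)%:C) a) ^+ 2)%:E +
    4%:E * tail a))%E).
  apply: ge0_le_integral => //.
  - by move=> a _; rewrite mule_ge0// lee_fin normc2_ge0.
  - by apply: emeasurable_funM => //; exact: emeasurable_normc2.
  - by apply: emeasurable_funD => //; exact: emeasurable_funM.
  - move=> a _; rewrite -rmorphB normc2_real.
    have u1 : `|u a| <= 1 by exact: clamp_le.
    have tu : (t a - u a) ^+ 2 <=
        normc ((t a)%:C - fourier_sum A (fun a => (t a)%:C) a) ^+ 2.
      rewrite -real_normK ?num_real// ler_sqr ?nnegrE ?normc_ge0//.
      rewrite -{1}(clampE (t1 a)); apply: le_trans (clamp_lipschitz _ _) _.
      by apply: le_trans (abs_Re_le _); rewrite !reimE.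
    have tu4 : (t a - u a) ^+ 2 <= 4.
      move: (t1 a) u1; rewrite !ler_norml => /andP[? ?] /andP[? ?]; nra.
    rewrite /tail; case: ifPn => [_|].
      apply: (@le_trans _ _ (4%:E * weight muQ G a)%E).
        by apply: lee_wpmul2r => //; rewrite lee_fin.
      by rewrite leeDr.
    rewrite -leNgt mule0 adde0 => wN; rewrite muleC.
    apply: lee_pmul => //; first by rewrite lee_fin sqr_ge0.
    by apply: (le_trans wN); rewrite lee_fin ler_nat.
rewrite ge0_integralD//; last 2 first.
- by move=> a _; rewrite mule_ge0.
- exact: emeasurable_funM.
rewrite !ge0_integralZl_EFin//; last 2 first.
- by move=> a _; rewrite lee_fin normc2_ge0.
- exact: emeasurable_normc2.
have -> : e%:E = ((e / 2)%:E + (e / 2)%:E)%E by rewrite -EFinD -splitr.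
apply: lteD.
- by rewrite muleC -lte_pdivlMr.
- rewrite muleC -lte_pdivlMr//; apply: lt_le_trans hN _.
  by rewrite lee_fin; lra.
Qed.

(** Real and imaginary parts are rescaled into the unit ball; [L] exceeds the bound and is positive
    whatever the sign of [K]. *)
Lemma multiplier_bounded (m : D -> R[i]) (K : R) : cmeasurable m ->
  (forall a, normc (m a) <= K) -> multiplier m.
Proof.
move=> [mr mi] mK; pose L : R := `|K| + 1.
have L0 : 0 < L by rewrite ltr_wpDl.
have scale (t : D -> R) : measurable_fun setT t ->
    (forall a, `|t a| <= normc (m a)) -> multiplier (fun a => (t a)%:C).
  move=> mt tm; rewrite (_ : (fun a => _) = (fun a => (L * (L^-1 * t a))%:C)).
    apply: multiplier_realZ; apply: multiplier_unit_ball.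
      exact: measurable_funM.
    move=> a; rewrite normrM normfV (gtr0_norm L0) ler_pdivrMl// mulr1.
    apply: (le_trans (tm a)); apply: (le_trans (mK a)).
    by apply: le_trans (ler_norm _) _; rewrite lerDl.
  by apply/funext => a; rewrite mulrA divff ?mul1r// lt0r_neq0.
rewrite (_ : m = fun a => (Re (m a))%:C + 'i * (Im (m a))%:C).
  apply: multiplierD; first by apply: scale => // a; exact: abs_Re_le.
  by apply: multiplierZ; apply: scale => // a; exact: abs_Im_le.
by apply/funext => a; exact: complexE.
Qed.

Lemma ae_fst (P : D -> Prop) :
  {ae nu, forall a, P a} -> {ae nuQ, forall p, P p.1}.
Proof.
move=> [N [mN N0 NP]]; exists (N `*` setT); split.
- exact: measurableX.
- have -> : nuQ (N `*` setT) = (nu N * muQ setT)%E by exact: product_measure1E.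
  by rewrite N0 mul0e.
- by move=> p Pp; split => //; apply: NP.
Qed.

Lemma mixed_innerBl F F' G : L2 nuQ F -> L2 nuQ F' -> L2 nuQ G ->
  {ae nu, forall a, mixed_inner muQ (fun p => F p - F' p) G a =
    mixed_inner muQ F G a - mixed_inner muQ F' G a}.
Proof.
move=> LF LF' LG.
apply: filterS3 (L2_section LF) (L2_section LF') (L2_section LG) => a Fa Fa' Ga.
exact: (innerBl Fa Fa' Ga).
Qed.

Lemma inner_modulates F G k : L2 nuQ F -> L2 nuQ G ->
  inner nuQ F (modulates G k) = inner nu (mixed_inner muQ F G) (chi k).
Proof. by move=> LF LG; apply: (inner_fstMr (K := 1)) => // a; rewrite normc_chi. Qed.

(** By [inner_modulates] the coefficients are the Fourier coefficients of the bracket, so Parseval's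
    identity sums their squares. *)
Lemma coef_sq_modulates F G : L2 nuQ F -> L2 nuQ G ->
  L2 nu (mixed_inner muQ F G) ->
  coef_sq nuQ (modulates G) F = normL2_sq nu (mixed_inner muQ F G).
Proof.
move=> LF LG LFG; rewrite -parseval//; apply: eq_esum => k _.
by rewrite inner_modulates.
Qed.

Lemma ae_all_nat (P : nat -> D -> Prop) :
  (forall n, {ae nu, forall a, P n a}) -> {ae nu, forall a n, P n a}.
Proof. by move=> /ae_foralln. Qed.

(* The test function is G restricted to [B < weight G <= N]: its mixed inner  *)
(* product with G is bounded, so Parseval applies to it.                      *)
Lemma bounded_weight_of_coef_sq B G : L2 nuQ G -> 0 < B ->
  (forall F, modulation_space G F ->
     (coef_sq nuQ (modulates G) F <= B%:E * normL2_sq nuQ F)%E) ->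
  bounded_weight nu muQ B G.
Proof.
move=> LG B0 hB; have [mG _] := LG; have mw := measurable_weight muQ mG.
have w0 := weight_ge0 muQ G; pose w := weight muQ G.
pose t (N : nat) a : R := if ((B%:E < w a) && (w a <= N%:R%:E))%E then 1 else 0.
have tN (N : nat) : {ae nu, forall a, t N a = 0}.
  have mt : measurable_fun setT (t N).
    apply: measurable_fun_ifT => //; apply: measurable_and.
      exact: measurable_fun_lte.
    exact: measurable_fun_lee.
  have t01 a : normc (t N a)%:C <= 1.
    by rewrite normc_real /t; case: ifP => _; rewrite ?normr1 ?normr0.
  have [_ [_ /(_ G LG) tG]] := multiplier_bounded (cmeasurable_real mt) t01.
  have LtG := modulation_space_L2 tG.
  (* [p] is the bracket of the test function with [G]. It is either 0 or a value of the weight in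
     the range from [B] (excluded) to [N], so [B p <= p^2] and [p] is bounded. *)
  pose p a := t N a * fine (w a).
  have mp : measurable_fun setT p.
    by apply: measurable_funM => //; exact: measurableT_comp.
  have p0 a : 0 <= p a.
    rewrite /p /t; case: ifP => _; rewrite ?mul0r// mul1r.
    by apply: fine_ge0; exact: w0.
  have pB a : B * p a <= p a ^+ 2.
    rewrite /p /t; case: ifPn => [/andP[Bw wN]|_]; last by rewrite !mul0r mulr0 expr0n.
    have wf : w a \is a fin_num.
      by rewrite ge0_fin_numE; [exact: le_lt_trans wN (ltry _)|exact: w0].
    move: Bw; rewrite -(fineK wf) lte_fin !mul1r/= expr2 => Bw.
    by rewrite ler_pM2r ?ltW// (lt_trans B0).
  have pN a : p a <= N%:R.
    rewrite /p /t; case: ifPn => [/andP[Bw wN]|_]; last by rewrite mul0r.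
    have wf : w a \is a fin_num.
      by rewrite ge0_fin_numE; [exact: le_lt_trans wN (ltry _)|exact: w0].
    by rewrite mul1r -lee_fin fineK.
  have cst1 : L2 nu (fun=> 1).
    split; first exact: cmeasurable_cst.
    by rewrite /normL2_sq ComplexField.Normc.normc1 expr1n integral_cst//=
      mul1e probability_setT ltry.
  have pE : {ae nu, forall a, mixed_inner muQ (fun q => (t N q.1)%:C * G q) G a =
      (p a)%:C}.
    apply: filterS (mixed_innerZl (fun a => (t N a)%:C) LG LG) => a ->.
    by rewrite mixed_inner_self -rmorphM.
  have mm := mixed_inner_measurable LtG LG.
  have Lp : L2 nu (fun a => (p a)%:C).
    apply: (L2_bounded (c := N%:R ^+ 2) cst1 (cmeasurable_real mp)).
      exact: sqr_ge0.
    move=> a; rewrite ComplexField.Normc.normc1 expr1n mulr1 normc2_real.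
    by rewrite ler_sqr ?nnegrE.
  have Lm : L2 nu (mixed_inner muQ (fun q => (t N q.1)%:C * G q) G).
    have [] // := L2_ae_bounded Lp mm (c := 1) _ ler01.
    by apply: filterS pE => a ->; rewrite mul1r.
  (* As [t N] takes the values 0 and 1, the squared norm of the test function is the integral of
     [p], and its coefficients sum to the integral of [p^2]. *)
  have p2B : (\int[nu]_a (p a ^+ 2)%:E <= B%:E * \int[nu]_a (p a)%:E)%E.
    have := hB _ tG; rewrite coef_sq_modulates//.
    rewrite (ae_normL2_sq mm (cmeasurable_real mp) pE).
    rewrite (normL2_sq_fstM nu muQ (cmeasurable_real mt) mG) /normL2_sq.
    under eq_integral do rewrite normc2_real.
    have -> : (\int[nu]_a ((normc (t N a)%:C ^+ 2)%:E * weight muQ G a) =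
        \int[nu]_a (p a)%:E)%E; last by [].
    apply: eq_integral => a _.
    rewrite normc2_real /p /t; case: ifPn => [/andP[Bw wN]|_]; last first.
      by rewrite expr0n mul0e mul0r.
    rewrite expr1n mul1e mul1r fineK// ge0_fin_numE; last exact: w0.
    exact: le_lt_trans wN (ltry _).
  (* [g] is nonnegative with integral at most 0, hence 0 a.e.; but where [t N] is 1 it equals
     [(w - B) w > 0]. *)
  pose g a := p a ^+ 2 - B * p a.
  have g0 a : 0 <= g a by rewrite subr_ge0.
  have mg : measurable_fun setT g.
    by apply: measurable_funB; [exact: measurable_funX|exact: measurable_funM].
  have ip : (\int[nu]_a (p a)%:E)%E \is a fin_num.
    rewrite ge0_fin_numE; last by apply: integral_ge0 => a _; rewrite lee_fin.
    apply: (@le_lt_trans _ _ (\int[nu]_a (N%:R%:E))%E).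
      apply: ge0_le_integral => //.
      - by move=> a _; rewrite lee_fin.
      - exact/measurable_EFinP.
      - by move=> a _; rewrite lee_fin.
    by rewrite integral_cst//= probability_setT mule1 ltry.
  have g_le0 : (\int[nu]_a (g a)%:E <= 0)%E.
    rewrite -(leeD2rE (x := B%:E * \int[nu]_a (p a)%:E)) ?fin_numM// add0e.
    apply: le_trans p2B; rewrite -ge0_integralZl_EFin//; last 3 first.
    - by move=> a _; rewrite lee_fin.
    - exact/measurable_EFinP.
    - exact: ltW.
    rewrite -ge0_integralD//.
    - rewrite le_eqVlt; apply/orP; left; apply/eqP; apply: eq_integral => a _.
      by rewrite -EFinM -EFinD /g subrK.
    - by move=> a _; rewrite lee_fin.
    - exact/measurable_EFinP.
    - by move=> a _; rewrite -EFinM lee_fin mulr_ge0// ltW.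
    - by apply: emeasurable_funM => //; exact/measurable_EFinP.
  have /ae_eq_integral_abs h : (\int[nu]_a `|(g a)%:E| = 0)%E.
    apply/eqP; rewrite eq_le integral_ge0// andbT; apply: le_trans g_le0.
    by under eq_integral do rewrite gee0_abs ?lee_fin//.
  apply: filterS (h measurableT (proj2 (measurable_EFinP _ _) mg)) => a /(_ Logic.I)/= /eqP.
  rewrite eqe /g /p /t; case: ifPn => [/andP[Bw wN]|//].
  have wf : w a \is a fin_num.
    by rewrite ge0_fin_numE; [exact: le_lt_trans wN (ltry _)|exact: w0].
  move: Bw; rewrite -(fineK wf) lte_fin !mul1r/= expr2 -mulrBl => Bw.
  rewrite mulf_eq0 subr_eq0 => /orP[] /eqP; lra.
apply: filterS2 (ae_all_nat tN) (L2_section LG) => a ta Ga.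
have wf : w a \is a fin_num by exact: L2_fin_num.
rewrite leNgt; apply/negP => Bw; pose N := Num.bound (fine (w a)).
have := ta N; rewrite /t Bw -(fineK wf) lee_fin.
have wa0 : 0 <= fine (w a) by apply: fine_ge0; exact: w0.
by rewrite (ltW (archi_boundP wa0)) => /eqP; rewrite oner_eq0.
Qed.

(** The finite sum is a Fourier sum of the bracket of [F] and [H], multiplied by [G]. Fourier sums
    converge in [L2 nu], and multiplication by [G] is bounded from there because the weight of [G]
    is. *)
Lemma mixed_synthesis B B' F G H (e : R) : L2 nuQ F -> L2 nuQ G -> L2 nuQ H ->
  0 <= B -> 0 <= B' -> bounded_weight nu muQ B G -> bounded_weight nu muQ B' H ->
  0 < e -> exists A : {fset I}, forall C, (A `<=` C)%fset ->
  (normL2_sq nuQ (fun p =>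
     (\sum_(k <- C) inner nuQ F (modulates H k) * modulates G k p) -
     mixed_inner muQ F H p.1 * G p)%R < e%:E)%E.
Proof.
move=> LF LG LH B0 B'0 GB HB e0.
have [Lm _] := mixed_inner_L2 LF LH HB B'0.
have e1 : 0 < e / (B + 1) by rewrite divr_gt0// ltr_wpDl.
have [A hA] := fourier_approx Lm e1; exists A => C /hA hC.
have -> : (fun p => (\sum_(k <- C) inner nuQ F (modulates H k) * modulates G k p) -
     mixed_inner muQ F H p.1 * G p) =
  (fun p => (fourier_sum C (mixed_inner muQ F H) p.1 - mixed_inner muQ F H p.1) * G p).
  apply/funext => p; rewrite mulrBl; congr (_ - _); rewrite mulr_suml.
  by apply: eq_bigr => k _; rewrite inner_modulates// /modulates mulrA.
have LS := L2_fourier_sum C (mixed_inner muQ F H).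
have [mG _] := LG.
apply: le_lt_trans (normL2_sq_fstM_le (L2B LS Lm).1 mG GB B0) _.
rewrite normL2_sq_sym; move: hC; rewrite (norm2E (L2B Lm LS)) -EFinM !lte_fin.
set x := norm2 _ _ => hx; have x0 : 0 <= x by exact: norm2_ge0.
have B1 : 0 < B + 1 by rewrite ltr_wpDl.
apply: (@le_lt_trans _ _ ((B + 1) * x)); first by rewrite ler_wpM2r// lerDl.
by rewrite mulrC -ltr_pdivlMr.
Qed.

Lemma L2_ae_fstM (m : D -> R[i]) F (K : R) : cmeasurable m ->
  {ae nu, forall a, normc (m a) ^+ 2 <= K} -> 0 <= K -> L2 nuQ F ->
  L2 nuQ (fun p => m p.1 * F p) /\
  (normL2_sq nuQ (fun p => m p.1 * F p)%R <= K%:E * normL2_sq nuQ F)%E.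
Proof.
move=> mm mK K0 [mF Foo].
have h : (normL2_sq nuQ (fun p => m p.1 * F p)%R <= K%:E * normL2_sq nuQ F)%E.
  rewrite (normL2_sq_fstM nu muQ mm mF) (normL2_sq_weight nu muQ mF).
  rewrite -ge0_integralZl_EFin//; last 2 first.
  - by move=> a _; exact: weight_ge0.
  - exact: measurable_weight.
  apply: ae_ge0_le_integral => //.
  - by move=> a _; rewrite mule_ge0 ?weight_ge0// lee_fin normc2_ge0.
  - apply: emeasurable_funM; first exact: emeasurable_normc2.
    exact: measurable_weight.
  - by move=> a _; rewrite mule_ge0// weight_ge0.
  - by apply: emeasurable_funM => //; exact: measurable_weight.
  - apply: filterS mK => a mK _; apply: lee_wpmul2r; first exact: weight_ge0.
    by rewrite lee_fin.
split=> //; split; first exact: cmeasurable_fstM.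
by apply: le_lt_trans h _; rewrite lte_mul_pinfty.
Qed.

(* Both sides are bounded in F and commute with modulations. *)
Lemma mixed_inner_identity B B' K (m : D -> R[i]) F G T1 T2 :
  L2 nuQ G -> L2 nuQ T1 -> L2 nuQ T2 -> 0 <= B -> 0 <= B' -> 0 <= K ->
  bounded_weight nu muQ B T1 -> bounded_weight nu muQ B' T2 ->
  cmeasurable m -> {ae nu, forall a, normc (m a) ^+ 2 <= K} ->
  {ae nuQ, forall p, m p.1 * G p = mixed_inner muQ G T1 p.1 * T2 p} ->
  modulation_space G F ->
  {ae nuQ, forall p, m p.1 * F p = mixed_inner muQ F T1 p.1 * T2 p}.
Proof.
move=> LG L1 L2_ B0 B'0 K0 T1B T2B mm mK hG [LF FG].
have mT2 := L2_measurable L2_.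
have LmF H : L2 nuQ H -> L2 nuQ (fun p => m p.1 * H p) /\
  (normL2_sq nuQ (fun p => m p.1 * H p)%R <= K%:E * normL2_sq nuQ H)%E.
  exact: L2_ae_fstM.
have LiF H : L2 nuQ H -> L2 nuQ (fun p => mixed_inner muQ H T1 p.1 * T2 p) /\
  (normL2_sq nuQ (fun p => mixed_inner muQ H T1 p.1 * T2 p)%R <=
   (B' * B)%:E * normL2_sq nuQ H)%E.
  move=> LH; have [Li iB] := mixed_inner_L2 LH L1 T1B B0.
  split; first exact: (L2_fstM_weight Li mT2 T2B B'0).
  apply: le_trans (normL2_sq_fstM_le Li.1 mT2 T2B B'0) _.
  by rewrite EFinM -muleA; apply: lee_wpmul2l.
apply: ae_eq_of_normL2_sq; first by case: (LmF _ LF) => -[].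
  by case: (LiF _ LF) => -[].
(* Both sides are bounded operators, with squared norms at most [K] and [B' B]; [2 M] bounds twice
   their sum and is positive. *)
move=> e e0; pose M := K + B' * B + 1.
have M0 : 0 < M by rewrite ltr_wpDl// addr_ge0// mulr_ge0.
have e1 : 0 < e / (2 * M) by rewrite divr_gt0// mulr_gt0.
have [F' F'G FF'] := FG _ e1; have LF' := L2_modulates_span LG F'G.
have hF' : {ae nuQ, forall p, m p.1 * F' p = mixed_inner muQ F' T1 p.1 * T2 p}.
  case: F'G => A [c F'E].
  pose s a := \sum_(k <- A) c k * chi k a.
  have F's : F' = fun p => s p.1 * G p.
    (* An element of the span is a trigonometric polynomial [s] times [G], and [s] factors out of
       both sides. *)
    rewrite F'E; apply/funext => p; rewrite /s mulr_suml.
    by apply: eq_bigr => k _; rewrite /modulates mulrA.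
  have := mixed_innerZl s LG L1; rewrite -F's => /ae_fst hs.
  apply: filterS2 hG hs => p hp hs; rewrite hs {1}F's.
  by rewrite mulrCA hp mulrA.
have LFF := L2B LF LF'.
have [LmFF hmFF] := LmF _ LFF; have [LiFF hiFF] := LiF _ LFF.
rewrite (@ae_normL2_sq _ _ _ _ _ (fun p => m p.1 * (F p - F' p) -
    mixed_inner muQ (fun q => F q - F' q) T1 p.1 * T2 p)); last 3 first.
- by apply: cmeasurableB; [case: (LmF _ LF) => -[]|case: (LiF _ LF) => -[]].
- by apply: cmeasurableB; [case: LmFF|case: LiFF].
- have /ae_fst hB := mixed_innerBl LF LF' L1.
  by apply: filterS2 hF' hB => p hp ->; rewrite mulrBr hp; ring.
apply: (@le_trans _ _ (2%:E * (K%:E * normL2_sq nuQ (fun p => F p - F' p)%R +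
    (B' * B)%:E * normL2_sq nuQ (fun p => F p - F' p)%R))%E).
  apply: le_trans (normL2_sqD _ LmFF.1 (cmeasurableN LiFF.1)) _.
  rewrite normL2_sqN; apply: lee_wpmul2l; first by rewrite lee_fin.
  exact: leeD.
move: FF'; rewrite (norm2E LFF) -(EFinM K) -(EFinM (B' * B)) -EFinD -EFinM.
rewrite lte_fin lee_fin ltr_pdivlMr; last by rewrite mulr_gt0.
set x := norm2 _ _; have x0 : 0 <= x by exact: norm2_ge0.
by rewrite /M => h; nra.
Qed.

(** Both conditions amount to the vanishing of the integral over [a] of [|m|^2] times the weight of
    [F]. *)
Lemma fstM_eq0 (m : D -> R[i]) F : cmeasurable m -> L2 nuQ F ->
  {ae nuQ, forall p, m p.1 * F p = 0} <->
  {ae nu, forall a, m a = 0 \/ mixed_inner muQ F F a = 0}.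
Proof.
move=> mm LF; have [mF _] := LF; have mmF := cmeasurable_fstM mm mF.
split=> [mF0|h].
- have := ae_normL2_sq mmF (@cmeasurable_cst _ _ _ 0) mF0.
  have -> : normL2_sq nuQ (fun=> 0) = 0%E.
    by rewrite /normL2_sq ComplexField.Normc.normc0 expr0n integral0.
  rewrite (normL2_sq_fstM nu muQ mm mF) => h0.
  have mh : measurable_fun setT
      (fun a => ((normc (m a) ^+ 2)%:E * weight muQ F a)%E).
    apply: emeasurable_funM; first exact: emeasurable_normc2.
    exact: measurable_weight.
  have ge0 a : (0 <= (normc (m a) ^+ 2)%:E * weight muQ F a)%E.
    by rewrite mule_ge0 ?weight_ge0// lee_fin normc2_ge0.
  have /ae_eq_integral_abs h :
      (\int[nu]_a `|(normc (m a) ^+ 2)%:E * weight muQ F a| = 0)%E.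
    by under eq_integral do rewrite gee0_abs ?ge0//.
  apply: filterS (h measurableT mh) => a /(_ Logic.I)/= /eqP.
  rewrite mule_eq0 eqe => /orP[/eqP/normc2_eq0 ->|/eqP wa]; first by left.
  by right; rewrite mixed_inner_self wa.
- apply: weight_eq0 => //; apply: filterS2 (L2_section LF) h => a Fa h.
  rewrite /weight/= normL2_sqZ; last by case: Fa.
  rewrite (norm2E Fa); case: h => [->|].
    by rewrite ComplexField.Normc.normc0 expr0n mul0e.
  by rewrite mixed_inner_self => -[]; rewrite /norm2 /weight => ->; rewrite mule0.
Qed.

(** The reconstruction clause of [subspace_dual] seen through the Zak transform, with net
    convergence spelled out; the Bessel clauses are carried separately as bounded weights. *)
Definition modulation_dual (F H : X -> R[i]) :=
  forall G, modulation_space F G -> forall e : R, 0 < e ->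
    exists A : {fset I}, forall C, (A `<=` C)%fset ->
      (normL2_sq nuQ (fun p =>
        (\sum_(k <- C) inner nuQ G (modulates H k) * modulates F k p) - G p)%R
        < e%:E)%E.

Section dual_pair.
Context (F H : X -> R[i]) (B B' : R).
Hypothesis (LF : L2 nuQ F) (LH : L2 nuQ H) (B0 : 0 <= B) (B'0 : 0 <= B').
Hypothesis (FB : bounded_weight nu muQ B F) (HB : bounded_weight nu muQ B' H).

(** The identity for the generator [F] extends to all [G] of its modulation space by
    [mixed_inner_identity] with [m = 1]; the expansion of [G] then converges to the bracket of [G]
    and [H] times [F], which is [G]. *)
Lemma modulation_dual_of_identity :
  {ae nuQ, forall p, F p = mixed_inner muQ F H p.1 * F p} -> modulation_dual F H.
Proof.
move=> hF G GF e e0; have LG := modulation_space_L2 GF.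
have := @mixed_inner_identity B' B 1 (fun=> 1) G F H F LF LH LF B'0 B0 ler01 HB FB.
move=> /(_ (@cmeasurable_cst _ _ _ 1) _ _ GF)/wrap[||hG].
- by apply: aeW => a; rewrite ComplexField.Normc.normc1 expr1n.
- by apply: filterS hF => p <-; rewrite mul1r.
have [A hA] := mixed_synthesis LG LF LH B0 B'0 FB HB e0.
exists A => C /hA; apply: le_lt_trans; rewrite le_eqVlt; apply/orP; left.
have LS : L2 nuQ (fun p => \sum_(k <- C) inner nuQ G (modulates H k) * modulates F k p).
  apply: (@L2_sum _ _ _ _ _ _ (fun k p => inner nuQ G (modulates H k) * modulates F k p)).
  by move=> k; apply: L2Z; exact: L2_modulates.
have [Li _] := mixed_inner_L2 LG LH HB B'0.
have LiF := L2_fstM_weight Li LF.1 FB B0.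
apply/eqP/ae_normL2_sq.
- exact: (L2B LS LG).1.
- exact: (L2B LS LiF).1.
- by apply: filterS hG => p hp; rewrite -hp mul1r.
Qed.

(** The expansion of [F] itself converges both to [F], by duality, and to the bracket times [F], by
    [mixed_synthesis]; the two limits are compared along a common finite index set. *)
Lemma modulation_dual_identity :
  modulation_dual F H -> {ae nuQ, forall p, F p = mixed_inner muQ F H p.1 * F p}.
Proof.
move=> FH; have [Li _] := mixed_inner_L2 LF LH HB B'0.
have LiF := L2_fstM_weight Li LF.1 FB B0.
apply: ae_eq_of_normL2_sq; [exact: LF.1|exact: LiF.1|move=> e e0].
have e4 : 0 < e / 4 by rewrite divr_gt0.
have [A hA] := FH _ (modulation_space_refl LF) _ e4.
have [A' hA'] := mixed_synthesis LF LF LH B0 B'0 FB HB e4.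
pose C := (A `|` A')%fset.
pose S (p : X) : R[i] := \sum_(k <- C) inner nuQ F (modulates H k) * modulates F k p.
have {}hA : (normL2_sq nuQ (fun p => S p - F p)%R < (e / 4)%:E)%E.
  exact: hA (fsubsetUl _ _).
have {}hA' : (normL2_sq nuQ
    (fun p => S p - mixed_inner muQ F H p.1 * F p)%R < (e / 4)%:E)%E.
  exact: hA' (fsubsetUr _ _).
have LS : L2 nuQ S.
  apply: (@L2_sum _ _ _ _ _ _ (fun k p => inner nuQ F (modulates H k) * modulates F k p)).
  by move=> k; apply: L2Z; exact: L2_modulates.
apply: le_trans (normL2_sq_trans nuQ LF.1 LS.1 LiF.1) _.
move: hA hA'; rewrite normL2_sq_sym (norm2E (L2B LF LS)) (norm2E (L2B LS LiF)).
rewrite -EFinD -EFinM !lte_fin lee_fin; lra.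
Qed.

(* [F = <F, H> F] says that <F, H> = 1 wherever F does not vanish. *)
Lemma identityP : {ae nuQ, forall p, F p = mixed_inner muQ F H p.1 * F p} <->
  {ae nu, forall a, mixed_inner muQ F F a != 0 -> mixed_inner muQ F H a = 1}.
Proof.
have mi := mixed_inner_measurable LF LH.
have mm : cmeasurable (fun a => mixed_inner muQ F H a - 1).
  by apply: cmeasurableB => //; exact: cmeasurable_cst.
have [h1 h2] := fstM_eq0 mm LF; split=> [h|h].
- have {}/h1 : {ae nuQ, forall p, (mixed_inner muQ F H p.1 - 1) * F p = 0}.
    by apply: filterS h => p hp; rewrite mulrBl mul1r -hp subrr.
  by apply: filterS => a [/eqP|->]; [rewrite subr_eq0 => /eqP|rewrite eqxx].
- have {}/h2 : {ae nu, forall a, mixed_inner muQ F H a - 1 = 0 \/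
      mixed_inner muQ F F a = 0}.
    apply: filterS h => a; have [->|_ /(_ isT) ->] := eqVneq (mixed_inner muQ F F a) 0.
      by right.
    by left; rewrite subrr.
  by apply: filterS => p /eqP; rewrite mulrBl mul1r subr_eq0 => /eqP.
Qed.

End dual_pair.

Lemma bounded_weight_fstM (m : D -> R[i]) B K F : cmeasurable F -> 0 <= B ->
  {ae nu, forall a, normc (m a) ^+ 2 <= K} -> bounded_weight nu muQ B F ->
  bounded_weight nu muQ (K * B) (fun p => m p.1 * F p).
Proof.
move=> mF B0 mK FB; apply: filterS2 mK FB => a mK FB.
rewrite /weight/= normL2_sqZ; last exact: cmeasurable_section.
rewrite (EFinM K); apply: lee_pmul => //; first by rewrite lee_fin normc2_ge0.
exact: weight_ge0.
Qed.

Section dual_existence.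
Context (F G : X -> R[i]) (B B' C : R).
Hypothesis (LF : L2 nuQ F) (LG : L2 nuQ G) (B0 : 0 <= B) (B'0 : 0 <= B').
Hypothesis (FB : bounded_weight nu muQ B F) (GB : bounded_weight nu muQ B' G).
Local Notation br := (mixed_inner muQ).
Local Notation supp K := [set a | br K K a != 0].
Hypothesis C0 : 0 < C.
Hypothesis CFG : {ae nu, forall a, supp F a -> C <= normc (br F G a)}.

(** Fibrewise Cauchy-Schwarz: a bracket of modulus at least [C > 0] forces the weight of [G] to be
    nonzero. *)
Lemma supp_subset : {ae nu, forall a, supp F a -> supp G a}.
Proof.
apply: filterS2 (mixed_cauchy_schwarz LF LG) CFG => a CS h /h Ca.
apply/eqP; rewrite mixed_inner_self => -[wG]; move: CS; rewrite wG mulr0.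
have : 0 < normc (br F G a) ^+ 2 by rewrite exprn_gt0// (lt_le_trans C0).
by move=> /lt_le_trans h' /h'; rewrite ltxx.
Qed.

(** The bracket of [F] and [m G] is the conjugate of [m] times the bracket of [F] and [G], so
    [identityP] applies. [multiplier_bounded] keeps [m G] in the space generated by [G]. *)
Lemma dual_of_multiplier (m : D -> R[i]) (K : R) : cmeasurable m ->
  (forall a, normc (m a) <= K) ->
  {ae nu, forall a, supp F a -> (m a)^* * br F G a = 1} ->
  let H := fun p : X => m p.1 * G p in
  [/\ modulation_space G H, bounded_weight nu muQ (K ^+ 2 * B') H &
      modulation_dual F H].
Proof.
move=> mm mK hm H; have [_ [_ /(_ G LG) mG]] := multiplier_bounded mm mK.
have LH := modulation_space_L2 mG.
have K0 : 0 <= K ^+ 2 by exact: sqr_ge0.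
have HB : bounded_weight nu muQ (K ^+ 2 * B') H.
  apply: bounded_weight_fstM => //; first by case: LG.
  apply: aeW => a; rewrite ler_sqr ?nnegrE ?normc_ge0//.
  by apply: le_trans (mK a); exact: normc_ge0.
split=> //; have KB0 : 0 <= K ^+ 2 * B' by rewrite mulr_ge0.
apply: (modulation_dual_of_identity LF LH B0 KB0 FB HB).
apply/identityP => //.
have h1 := mixed_innerC LH LF; have h2 := mixed_innerZl m LG LF.
have h3 := mixed_innerC LF LG.
apply: filterS2 (filterI h1 h2) (filterI h3 hm) => a [-> ->] [-> hm'] Fa.
by rewrite -(hm' Fa); apply: complexP; rewrite !reimE; ring.
Qed.

(** The identity [[G, F] H = [H, F] G] is trivial for [H = G] and extends to the space generated by
    [G] by [mixed_inner_identity]. Duality makes [[H, F] = 1] on the support of [F]. *)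
Lemma dual_formula H B'' : 0 <= B'' -> bounded_weight nu muQ B'' H ->
  modulation_space G H -> modulation_dual F H ->
  {ae nuQ, forall p, supp F p.1 -> (br F G p.1)^* * H p = G p}.
Proof.
move=> B''0 HB GH FH; have LH := modulation_space_L2 GH.
have /identityP := modulation_dual_identity LF LH B0 B''0 FB HB FH.
move=> /(_ LF LH)/ae_fst h1.
have mGF := mixed_inner_measurable LG LF.
have bGF : {ae nu, forall a, normc (br G F a) ^+ 2 <= B' * B}.
  apply: filterS3 (mixed_cauchy_schwarz LG LF) FB GB => a h Fa Ga.
  have fin K b : (weight muQ K a <= b%:E)%E -> fine (weight muQ K a) <= b.
    move=> h'; rewrite -lee_fin fineK// ge0_fin_numE ?weight_ge0//.
    exact: le_lt_trans h' (ltry _).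
  apply: (le_trans h); apply: ler_pM; rewrite ?fine_ge0 ?weight_ge0//.
    exact: fin.
  exact: fin.
have BB0 : 0 <= B' * B by rewrite mulr_ge0.
have h2 : {ae nuQ, forall p, br G F p.1 * H p = br H F p.1 * G p}.
  apply: (mixed_inner_identity LG LF LG B0 B'0 BB0 FB GB mGF bGF _ GH).
  exact: aeW.
have /ae_fst h3 := mixed_innerC LF LG.
have /ae_fst h4 := mixed_innerC LF LH.
apply: filterS2 (filterI h1 h2) (filterI h3 h4) => p [h1' h2'] [h3' h4'] Fp.
by rewrite -h3' h2' h4' h1'// rmorph1 mul1r.
Qed.

Lemma dual_unique H1 H2 B1 B2 : {ae nu, forall a, supp F a <-> supp G a} ->
  0 <= B1 -> 0 <= B2 -> bounded_weight nu muQ B1 H1 -> bounded_weight nu muQ B2 H2 ->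
  modulation_space G H1 -> modulation_space G H2 ->
  modulation_dual F H1 -> modulation_dual F H2 ->
  {ae nuQ, forall p, H1 p = H2 p}.
Proof.
move=> FG B10 B20 H1B H2B GH1 GH2 FH1 FH2.
have h1 := dual_formula B10 H1B GH1 FH1.
have h2 := dual_formula B20 H2B GH2 FH2.
(* The indicator of the complement of the support of [G]. It kills [G], hence the whole space
   generated by [G]: this is [mixed_inner_identity] with right-hand side 0. On the support itself
   [dual_formula] determines both duals, as the bracket is nonzero there. *)
pose m a : R[i] := if br G G a == 0 then 1 else 0.
have mm : cmeasurable m.
  have mw := measurable_weight muQ LG.1.
  rewrite (_ : m = fun a => (if fine (weight muQ G a) == 0 then 1 else 0 : R)%:C).
    apply: cmeasurable_real; apply: measurable_fun_ifT => //.
    by apply: measurable_fun_eqr => //; exact: measurableT_comp.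
  by apply/funext => a; rewrite /m mixed_inner_self; rewrite (inj_eq (@complexI R)); case: ifP.
have off H : modulation_space G H -> {ae nuQ, forall p, m p.1 * H p = 0}.
  move=> GH; have := @mixed_inner_identity B 0 1 m H G F (fun=> 0) LG LF (L20 nuQ).
  move=> /(_ B0 (lexx 0) ler01 FB _ mm _ _ GH)/wrap[|||h].
  - apply: aeW => a; rewrite /weight /normL2_sq.
    by under eq_integral do rewrite ComplexField.Normc.normc0 expr0n; rewrite integral0.
  - apply: aeW => a; rewrite /m; case: ifP => _.
      by rewrite ComplexField.Normc.normc1 expr1n.
    by rewrite ComplexField.Normc.normc0 expr0n.
  - have [_ hh] := fstM_eq0 mm LG; have {}/hh : {ae nu, forall a, m a = 0 \/ br G G a = 0}.
      by apply: aeW => a; rewrite /m; case: eqP => [->|_]; [right|left].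
    by apply: filterS => p ->; rewrite mulr0.
  - by apply: filterS h => p ->; rewrite mulr0.
have /ae_fst FG' := FG; have /ae_fst CFG' := CFG.
have h5 : {ae nuQ, forall p, m p.1 * H1 p = 0 /\ m p.1 * H2 p = 0}.
  by apply: filterS2 (off _ GH1) (off _ GH2).
have h6 : {ae nuQ, forall p, (supp F p.1 <-> supp G p.1) /\
    (supp F p.1 -> C <= normc (br F G p.1))} by exact: filterS2 FG' CFG'.
apply: filterS2 (filterI h1 h2) (filterI h5 h6) => p [{}h1 {}h2] [[z1 z2] [FG1 CF]].
have [/FG1.2 Fp|] := boolP (br G G p.1 != 0).
  have z0 : (br F G p.1)^* != 0.
    rewrite conjC_eq0; apply/eqP => z0; have := CF Fp.
    by rewrite z0 ComplexField.Normc.normc0 leNgt C0.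
  by apply: (mulfI z0); rewrite h1// h2.
by rewrite negbK => p0; move: z1 z2; rewrite /m p0 !mul1r => -> ->.
Qed.

(** The test on [C] makes the bound [1 / C] hold at every point, while the lower bound on the
    bracket is only known almost everywhere. *)
Definition inverse_symbol a : R[i] :=
  if (br F F a != 0) && (C <= normc (br F G a)) then ((br F G a)^*)^-1 else 0.

Lemma inverse_symbolE : {ae nu, forall a, supp F a ->
  (inverse_symbol a)^* * br F G a = 1}.
Proof.
apply: filterS CFG => a CF Fa; rewrite /inverse_symbol Fa CF//=.
have z0 : br F G a != 0.
  apply/eqP => z0; have := CF Fa.
  by rewrite z0 ComplexField.Normc.normc0 leNgt C0.
by rewrite fmorphV/= conjCK mulVf.
Qed.

Lemma normc_inverse_symbol a : normc (inverse_symbol a) <= C^-1.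
Proof.
rewrite /inverse_symbol; case: ifPn => [/andP[_ Ca]|_]; last first.
  by rewrite ComplexField.Normc.normc0 invr_ge0 ltW.
rewrite ComplexField.Normc.normcV normcJ_normc lef_pV2// posrE//.
exact: lt_le_trans Ca.
Qed.

Lemma measurable_inverse_symbol : cmeasurable inverse_symbol.
Proof.
have [mr mi] := mixed_inner_measurable LF LG.
have mw := measurable_weight muQ LF.1.
pose b a := (fine (weight muQ F a) != 0) && (C <= normc (br F G a)).
have mb : measurable_fun setT b.
  apply: measurable_and; last first.
    apply: measurable_fun_ler => //; apply: measurable_normc.
    exact: (mixed_inner_measurable LF LG).
  apply: measurable_neg; apply: measurable_fun_eqr => //.
  exact: measurableT_comp.
(* Measurability comes from writing the inverse of the conjugate of [z] as [|z|^(-2) z], with a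
   measurable real power. *)
have mn : measurable_fun setT (fun a => (normc (br F G a) ^+ 2) `^ (-1)).
  apply: (measurableT_comp (@measurable_powR R (-1))).
  by apply: measurable_normc2; exact: (mixed_inner_measurable LF LG).
have E : inverse_symbol = fun a => if b a then
    ((normc (br F G a) ^+ 2) `^ (-1))%:C * br F G a else 0.
  apply/funext => a; rewrite /inverse_symbol /b mixed_inner_self.
  rewrite -[X in _%:C != X]/(0%:C) (inj_eq (@complexI R)); case: ifPn => // /andP[_ Ca].
  rewrite powR_inv1 ?normc2_ge0//.
  have z0 : br F G a != 0.
    apply/eqP => z0; move: Ca; by rewrite z0 ComplexField.Normc.normc0 leNgt C0.
  apply: (mulfI (x := (br F G a)^*)); first by rewrite conjC_eq0.
  rewrite mulfV ?conjC_eq0// mulrCA (mulrC (br F G a)^*) mulcJ -rmorphM mulVf//.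
  by apply: contra z0 => /eqP/normc2_eq0/eqP.
rewrite E; split.
- rewrite (_ : (fun a => _) = fun a => if b a then
    (normc (br F G a) ^+ 2) `^ (-1) * Re (br F G a) else 0).
    by apply: measurable_fun_ifT => //; exact: measurable_funM.
  by apply/funext => a; case: ifP => // _; rewrite reimE/= mul0r subr0.
- rewrite (_ : (fun a => _) = fun a => if b a then
    (normc (br F G a) ^+ 2) `^ (-1) * Im (br F G a) else 0).
    by apply: measurable_fun_ifT => //; exact: measurable_funM.
  by apply/funext => a; case: ifP => // _; rewrite reimE/= mul0r addr0.
Qed.

End dual_existence.

End characters.

(** * Countable index sets: sums, measurability, null sets *)

Lemma countable_injection (I : choiceType) :
  countable [set: I] -> exists f : I -> nat, injective f.
Proof.
by move=> /countable_injP[f fi]; exists f => x y; apply: fi; rewrite inE.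
Qed.

Section countable_esum.
Context (R : realType) (I : choiceType).
Hypothesis countI : countable [set: I].

(** [g] inverts an injection of [I] into the natural numbers and is [None] off its range, where the
    term defaults to 0; this covers finite [I]. The enumeration does not depend on [a], so one
    series represents a whole family of functions in [measurable_esum]. *)
Lemma esum_eseries : exists g : nat -> option I, forall a : I -> \bar R,
  (forall i, 0 <= a i)%E ->
  (\esum_(i in [set: I]) a i = \sum_(n <oo) oapp a 0 (g n))%E.
Proof.
have [f injf] := countable_injection countI.
pose g n := if pselect (exists i, f i = n) is left h then Some (projT1 (cid h))
  else None.
have gf i : g (f i) = Some i.
  rewrite /g; case: pselect => [h|[]]; last by exists i.
  by case: cid => j /= /injf ->.
exists g => a a0; have ga0 n : (0 <= oapp a 0 (g n))%E by case: (g n).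
rewrite nneseries_esumT//.
transitivity (\esum_(n in f @` setT) oapp a 0%E (g n)).
  rewrite esum_image; last by move=> x y _ _; exact: injf.
  by apply: eq_esum => i _; rewrite gf.
rewrite esum_mkcond; apply: eq_esum => n _; case: ifPn => // /negP.
rewrite inE => nf; rewrite /g; case: pselect => // h; exfalso.
by apply: nf; case: h => i <-; exists i.
Qed.

Lemma measurable_esum d (T : measurableType d) (F : I -> T -> \bar R) :
  (forall i, measurable_fun setT (F i)) -> (forall i x, 0 <= F i x)%E ->
  measurable_fun setT (fun x => \esum_(i in [set: I]) F i x)%E.
Proof.
move=> mF F0; have [g hg] := esum_eseries.
rewrite (_ : (fun x => _) = fun x => (\sum_(n <oo) oapp (fun i => F i x) 0 (g n))%E).
  apply: ge0_emeasurable_sum => n; first by move=> x _ _ /=; case: (g n) => /=.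
  by move=> _; case: (g n) => [i|] /=; [exact: mF|exact: measurable_cst].
by apply/funext => x; apply: hg.
Qed.

Lemma ae_countable d (T : measurableType d) (mu : {measure set T -> \bar R})
    (P : I -> T -> Prop) :
  (forall i, {ae mu, forall x, P i x}) -> {ae mu, forall x i, P i x}.
Proof.
move=> hP; have [f injf] := countable_injection countI.
pose P' n x := forall i, f i = n -> P i x.
have /ae_foralln : forall n, {ae mu, forall x, P' n x}.
  move=> n; have [[i <-]|h] := pselect (exists i, f i = n).
    by apply: filterS (hP i) => x Px j /injf ->.
  by apply: aeW => x i fi; exfalso; apply: h; exists i.
by apply: filterS => x hx i; exact: (hx (f i)).
Qed.

End countable_esum.

(** * Borel measurability and characters of the subgroup *)

Section borel_measurability.

Lemma open_borel (T : ptopologicalType) (U : set T) :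
  open U -> measurable (U : set (borel T)).
Proof. by move=> oU; exact: sub_sigma_algebra. Qed.

Lemma continuous_borel (T T' : ptopologicalType) (f : T -> T') :
  continuous f -> measurable_fun setT (f : borel T -> borel T').
Proof.
move=> /continuousP cf; apply: (@measurability _ _ (borel T) (borel T') setT f (@open T')) => //.
by move=> _ [U oU <-]; rewrite setTI; apply: open_borel; exact: cf.
Qed.

Lemma continuous_borel_real (R : realType) (T : ptopologicalType) (f : T -> R) :
  continuous f -> measurable_fun setT (f : borel T -> R).
Proof.
move=> /continuousP cf; apply: (measurability _ (RGenOInfty.measurableE R)).
move=> _ [_ [x ->] <-]; rewrite setTI; apply: open_borel; apply: cf.
exact: interval_open.
Qed.

End borel_measurability.

Section complex_topology.
Context (R : realType).

Lemma dist_continuous (h : R[i]^o -> R) :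
  (forall x y, `|h x - h y| <= normc (x - y)) -> continuous h.
Proof.
move=> hh x A /nbhs_ballP[e /= e0 hA]; apply/nbhs_ballP; exists e%:C => /=.
  by rewrite -[0]/(0%:C) ltcR.
move=> y; rewrite /ball/= normr_normc ltcR => xy; apply: hA.
by rewrite /ball/=; apply: le_lt_trans xy.
Qed.

Lemma Re_continuous : continuous (fun z : R[i]^o => Re z).
Proof. by apply: dist_continuous => x y; rewrite -ReN -ReD; exact: abs_Re_le. Qed.

Lemma Im_continuous : continuous (fun z : R[i]^o => Im z).
Proof. by apply: dist_continuous => x y; rewrite -ImN -ImD; exact: abs_Im_le. Qed.

End complex_topology.

Section dual_characters.
Context (R : realType) (G : groupType) (Gam : subgroup G).

(** The inverse matches the kernel of the Zak series: reindexing that series turns translation by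
    [k] into this factor. *)
Definition modulation (k : Gam) (a : borel (dual R Gam)) : R[i] :=
  (a : dual R Gam) (k^-1)%g.

Lemma character_continuous (k : Gam) :
  continuous (fun a : dual R Gam => (a k : R[i]^o)).
Proof.
have h1 : continuous (@character R G Gam : dual R Gam -> {ptws Gam -> R[i]^o}).
  exact: initial_continuous.
move=> a; exact: (@continuous_comp _ _ _
  (@character R G Gam : dual R Gam -> {ptws Gam -> R[i]^o}) (fun f => f k) a
  (h1 a) (@proj_continuous _ (fun=> R[i]^o) k _)).
Qed.

Lemma modulation_measurable k : cmeasurable (modulation k).
Proof.
split; apply: continuous_borel_real => a.
- exact: (continuous_comp (@character_continuous _ a) (@Re_continuous R _)).
- exact: (continuous_comp (@character_continuous _ a) (@Im_continuous R _)).
Qed.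

Lemma normc_modulation k a : normc (modulation k a) = 1.
Proof.
by have := normr_character a (k^-1)%g; rewrite normr_normc => /complexI.
Qed.

Lemma character1 (a : dual R Gam) : a 1%g = 1.
Proof.
by apply: (mulfI (character_neq0 a 1%g)); rewrite -characterM mulg1 mulr1.
Qed.

Lemma characterV (a : dual R Gam) k : a (k^-1)%g = (a k)^*.
Proof.
apply: (mulfI (character_neq0 a k)); rewrite -characterM mulgV character1.
by rewrite mulcJ1//; have := normr_character a k; rewrite normr_normc => /complexI.
Qed.

Lemma modulationM j k a : modulation j a * modulation k a = modulation (k * j)%g a.
Proof. by rewrite /modulation invgM characterM. Qed.

Lemma modulationJ k a : (modulation k a)^* = modulation (k^-1)%g a.
Proof. by rewrite /modulation -characterV. Qed.

Lemma modulation1 a : modulation 1%g a = 1.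
Proof. by rewrite /modulation invg1 character1. Qed.

End dual_characters.

Section discrete_subgroups.
Context (G : topGroupType) (Gam : subgroup G).

(** Each point of the subgroup has a basic open neighbourhood containing no other point of it, which
    gives an injection into a countable base. *)
Lemma countable_discrete : @second_countable G -> discrete_subgroup Gam ->
  countable [set: Gam].
Proof.
move=> [B cB [Bo Bb]] disc.
have hx (x : Gam) : exists U : set G, B U /\ U (\val x) /\
    forall y : Gam, U (\val y) -> y = x.
  have [U oU Ux] := disc x.
  have Uxx : U (\val x) by have : [set x] x by []; rewrite -Ux.
  have [V [BV Vx] VU] := Bb _ _ (open_nbhs_nbhs (conj oU Uxx)).
  exists V; split => //; split => // y /VU Uy.
  by have : (\val @^-1` U) y by []; rewrite Ux.
pose f x := projT1 (cid (hx x)).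
have fP x : B (f x) /\ f x (\val x) /\ forall y : Gam, f x (\val y) -> y = x.
  by rewrite /f; case: cid.
have injf x y : f x = f y -> x = y.
  by move=> fxy; have [_ [_]] := fP y; apply; rewrite -fxy; have [_ []] := fP x.
have /countable_injP[g gi] := cB.
apply/countable_injP; exists (g \o f) => x y _ _ /= gfxy; apply: injf.
by apply: gi => //; rewrite inE; [have [] := fP x|have [] := fP y].
Qed.

End discrete_subgroups.

Lemma conjr_complex (R : realType) (r : R) : (r%:C)^* = r%:C.
Proof. by apply: complexP; rewrite reimE/= ?oppr0. Qed.

(** * Testing against indicators of sets of finite measure *)

Section AE_uniqueness.
Context d (T : measurableType d) (R : realType).
Variable mu : {sigma_finite_measure set T -> \bar R}.

Lemma ae_eq_of_integrals (f g : T -> R) :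
  measurable_fun setT f -> measurable_fun setT g ->
  (forall E, measurable E -> (mu E < +oo)%E -> mu.-integrable E (EFin \o f)) ->
  (forall E, measurable E -> (mu E < +oo)%E ->
     (\int[mu]_(x in E) (f x)%:E = \int[mu]_(x in E) (g x)%:E)%E) ->
  {ae mu, forall x, f x = g x}.
Proof.
move=> mf mg if_ fg; have [F FT Fb] := sigma_finiteT mu.
have /ae_foralln : forall n, {ae mu, forall x, F n x -> f x = g x}.
  move=> n; have [mFn Fnoo] := Fb n.
  have : ae_eq mu (F n) (EFin \o f) (EFin \o g).
    apply: integral_ae_eq => //; first exact: if_.
      by apply/measurable_EFinP; exact: measurable_funTS.
    move=> E EF mE; apply: fg => //.
    by apply: le_lt_trans Fnoo; apply: le_measure; rewrite ?inE.
  by apply: filterS => x h /h/= [].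
apply: filterS => x h.
by have : setT x by []; rewrite FT => -[n _ /h].
Qed.

Definition cindic (E : set T) : T -> R[i] := fun x => (\1_E x)%:C.

Lemma cmeasurable_cindic E : measurable E -> cmeasurable (cindic E).
Proof. by move=> mE; apply: cmeasurable_real; exact: measurable_indic. Qed.

Lemma normL2_sq_cindic E : measurable E -> normL2_sq mu (cindic E) = mu E.
Proof.
move=> mE; rewrite /normL2_sq (eq_integral (fun x => (\1_E x)%:E)) => [|x _].
  by rewrite integral_indic// setIT.
by rewrite /cindic normc2_real indicE; case: (_ \in _); rewrite ?expr1n ?expr0n.
Qed.

Lemma L2_cindic E : measurable E -> (mu E < +oo)%E -> L2 mu (cindic E).
Proof.
by move=> mE Eoo; split; [exact: cmeasurable_cindic|rewrite normL2_sq_cindic].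
Qed.

Lemma ae_eq_of_inner_cindic (f g : T -> R[i]) : L2 mu f -> L2 mu g ->
  (forall E, measurable E -> (mu E < +oo)%E ->
     inner mu f (cindic E) = inner mu g (cindic E)) ->
  {ae mu, forall x, f x = g x}.
Proof.
move=> Lf Lg fg.
have reE (h : T -> R[i]) E x :
    (Re (h x * (cindic E x)^*))%:E = ((fun x => (Re (h x))%:E) \_ E) x.
  rewrite patchE /cindic conjr_complex indicE reimE/=.
  by case: ifPn => _; rewrite ?mulr1 ?mulr0 subr0.
have imE (h : T -> R[i]) E x :
    (Im (h x * (cindic E x)^*))%:E = ((fun x => (Im (h x))%:E) \_ E) x.
  rewrite patchE /cindic conjr_complex indicE reimE/=.
  by case: ifPn => _; rewrite ?mulr1 ?mulr0 add0r.
have iRI (h : T -> R[i]) E : L2 mu h -> measurable E -> (mu E < +oo)%E ->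
    mu.-integrable E (fun x => (Re (h x))%:E) /\
    mu.-integrable E (fun x => (Im (h x))%:E).
  move=> Lh mE Eoo; have [i1 i2] := L2_mulJ Lh (L2_cindic mE Eoo).
  split; apply/(integrable_mkcond _ mE).
  - by apply: eq_integrable i1 => // x _; exact: reE.
  - by apply: eq_integrable i2 => // x _; exact: imE.
have eRI (h : T -> R[i]) E : L2 mu h -> measurable E -> (mu E < +oo)%E ->
   ((\int[mu]_(x in E) (Re (h x))%:E = (Re (inner mu h (cindic E)))%:E)%E
   /\ (\int[mu]_(x in E) (Im (h x))%:E = (Im (inner mu h (cindic E)))%:E)%E).
  move=> Lh mE Eoo; have [i1 i2] := iRI h E Lh mE Eoo.
  rewrite -(fineK (integrable_fin_num mE i1)) -(fineK (integrable_fin_num mE i2)).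
  by split; congr EFin => /=; rewrite /Rintegral [in LHS]integral_mkcond; congr fine;
    apply: eq_integral => x _; rewrite ?reE ?imE.
have [[f1 f2] _] := Lf; have [[g1 g2] _] := Lg.
have r : {ae mu, forall x, Re (f x) = Re (g x)}.
  apply: ae_eq_of_integrals => // E mE Eoo; first by case: (iRI f E Lf mE Eoo).
  by rewrite (eRI f E Lf mE Eoo).1 (eRI g E Lg mE Eoo).1 fg.
have i : {ae mu, forall x, Im (f x) = Im (g x)}.
  apply: ae_eq_of_integrals => // E mE Eoo; first by case: (iRI f E Lf mE Eoo).
  by rewrite (eRI f E Lf mE Eoo).2 (eRI g E Lg mE Eoo).2 fg.
by apply: filterS2 r i => x; exact: complexP.
Qed.

End AE_uniqueness.

(** * The Zak transform and translations *)

Section coset_geometry.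
Context (G : topGroupType) (Gam : subgroup G).
Hypothesis G_hausdorff : hausdorff_space G.
Hypothesis G_second_countable : @second_countable G.
Context (Xi : right_cosets Gam -> G) (Xi_section : borel_section Xi).
Local Notation pi := (\pi_(right_cosets Gam)%qT : G -> right_cosets Gam).

Lemma translation_measurable (y : G) :
  measurable_fun setT ((fun x => y * x)%g : borel G -> borel G).
Proof.
apply: (@continuous_borel G G) => x.
apply: (@continuous_comp _ _ _ (fun x : G => (y, x)) (fun p : G * G => (p.1 * p.2)%g)).
  by apply: cvg_pair; [exact: cvg_cst|exact: cvg_id].
exact: mulg_continuous.
Qed.

Lemma coset_measurable : measurable_fun setT (pi : borel G -> borel (right_cosets Gam)).
Proof. by apply: continuous_borel; exact: pi_continuous. Qed.

Lemma pi_mul (h : Gam) (x : G) : pi (\val h * x)%g = pi x.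
Proof.
apply/eqmodP; rewrite /= /coset_rel mulgK.
exact: (valP h).
Qed.

Lemma pi_mul_section (h : Gam) c : pi (\val h * Xi c)%g = c.
Proof. by rewrite pi_mul; exact: Xi_section.2. Qed.

(** In a Hausdorff space two points are equal iff they lie in the same basic open sets, so a
    countable base gives a countable intersection of measurable sets. *)
Lemma borel_diagonal (f g : borel G -> borel G) :
  measurable_fun setT f -> measurable_fun setT g ->
  measurable [set x | f x = g x].
Proof.
move=> mf mg; have [B cB [Bo Bb]] := G_second_countable.
have -> : [set x | f x = g x] =
    \bigcap_(U in B) ((f @^-1` U `&` g @^-1` U) `|` (f @^-1` (~` U) `&` g @^-1` (~` U))).
  apply/seteqP; split=> [x /= fg U BU|x /= h].
    by rewrite /preimage/= fg; have [Ug|Ug] := pselect (U (g x)); [left|right].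
  apply: G_hausdorff => V W /(Bb _)[U [BU Uf] UV] nW.
  have [[_ Ug]|[nUf _]] := h U BU; last by [].
  by exists (g x); split; [exact: UV|exact: nbhs_singleton].
rewrite -[X in measurable X]setCK setC_bigcap; apply: measurableC.
rewrite bigcup_set_type; apply: countable_bigcupT_measurable.
  have /countable_injP[e ei] := cB.
  apply/countable_injP; exists (e \o val) => x y _ _ /= exy; apply: val_inj.
  by apply: ei => //; [exact: valP x|exact: valP y].
move=> U; have mU : measurable (\val U : set (borel G)).
  by apply: open_borel; apply: Bo; have := valP U; rewrite inE.
apply: measurableC; apply: measurableU; apply: measurableI;
  rewrite -[X in measurable X]setTI; do ?[exact: mf|exact: mg];
  [apply: mf => //|apply: mg => //]; exact: measurableC.
Qed.

Lemma section_point_measurable (h : Gam) :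
  measurable_fun setT ((fun c => \val h * Xi c)%g :
     borel (right_cosets Gam) -> borel G).
Proof.
exact: (measurableT_comp (translation_measurable (\val h)) Xi_section.1).
Qed.

Lemma section_point_inj (h k : Gam) c : (\val h * Xi c = \val k * Xi c)%g -> h = k.
Proof. by move=> /mulIg/val_inj. Qed.

End coset_geometry.

Lemma esum_single (R : realType) (I : choiceType) (a : I -> \bar R) i :
  (0 <= a i)%E -> (forall j, j <> i -> a j = 0%E) ->
  (\esum_(j in [set: I]) a j = a i)%E.
Proof.
move=> ai aj; rewrite -[RHS](esum_set1 (t := i))// [RHS]esum_mkcond.
by apply: eq_esum => j _; case: ifPn => // /negP; rewrite inE => /aj.
Qed.

#[local] Existing Instance totally_filter.

Section zak_modulation.
Context (R : realType) (G : topGroupType) (mu : {measure set (borel G) -> \bar R}).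
Context (Gam : subgroup G) (nu : probability (borel (dual R Gam)) R).
Context (Xi : right_cosets Gam -> G).
Context (muQ : {sigma_finite_measure set (borel (right_cosets Gam)) -> \bar R}).
Context (Z : (G -> R[i]) -> borel (dual R Gam) * borel (right_cosets Gam) -> R[i]).
Hypothesis G_hausdorff : hausdorff_space G.
Hypothesis G_second_countable : @second_countable G.
Hypothesis mu_haar : left_haar mu.
Hypothesis Gam_discrete : discrete_subgroup Gam.
Hypothesis Xi_section : borel_section Xi.
Hypothesis muQ_weil : weil_formula mu Xi muQ.
Hypothesis Z_zak : zak_transform mu nu muQ Xi Z.

Local Notation D := (borel (dual R Gam)).
Local Notation Q := (borel (right_cosets Gam)).
Local Notation nuQ := (nu \x muQ : {measure set (D * Q) -> \bar R})%E.
Local Notation pi := (\pi_(right_cosets Gam)%qT : G -> right_cosets Gam).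
Local Notation chi := (@modulation R G Gam).
Implicit Types (f g : G -> R[i]) (h k : Gam) (E : set Q).

Let countGam : countable [set: Gam] := countable_discrete G_second_countable Gam_discrete.

Let mchi k : cmeasurable (chi k) := @modulation_measurable R G Gam k.

Definition slice f h (c : Q) : R[i] := f (\val h * Xi c)%g.

Lemma slice_measurable f h :
  cmeasurable (f : borel G -> R[i]) -> cmeasurable (slice f h).
Proof.
by move=> mf; exact: (cmeasurable_comp mf (section_point_measurable Xi_section h)).
Qed.

Lemma normL2_sq_slices f : cmeasurable (f : borel G -> R[i]) ->
  normL2_sq mu f =
  (\int[muQ]_c \esum_(h in [set: Gam]) (normc (slice f h c) ^+ 2)%:E)%E.
Proof.
move=> mf; apply: (muQ_weil (f := fun x => (normc (f x) ^+ 2)%:E)).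
  exact: emeasurable_normc2.
by move=> x; rewrite lee_fin normc2_ge0.
Qed.

Lemma measurable_slices f : cmeasurable (f : borel G -> R[i]) ->
  measurable_fun setT
    (fun c => \esum_(h in [set: Gam]) (normc (slice f h c) ^+ 2)%:E)%E.
Proof.
move=> mf; apply: (measurable_esum countGam) => h.
  by apply: emeasurable_normc2; exact: slice_measurable.
by move=> c; rewrite lee_fin normc2_ge0.
Qed.

Lemma translates_measurable f k : cmeasurable (f : borel G -> R[i]) ->
  cmeasurable (translates Gam f k : borel G -> R[i]).
Proof. by move=> mf; exact: (cmeasurable_comp mf (translation_measurable _)). Qed.

Lemma slice_translates f k h c :
  slice (translates Gam f k) h c = slice f (k^-1 * h)%g c.
Proof. by rewrite /slice /translates mulgA. Qed.

(** Through Weil's formula: translating by [k] permutes the slices, which leaves the sum over the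
    subgroup unchanged. *)
Lemma L2_translates f k : L2 mu f -> L2 mu (translates Gam f k).
Proof.
move=> [mf foo]; have mtf := translates_measurable k mf; split => //.
apply: le_lt_trans foo; rewrite !normL2_sq_slices// le_eqVlt; apply/orP; left.
apply/eqP/eq_integral => c _.
rewrite [RHS](@reindex_esum R Gam Gam setT setT (fun h : Gam => (k^-1 * h)%g)).
  by apply: eq_esum => h _; rewrite slice_translates.
split => [|x y _ _ /mulgI//|y _] //.
by exists (k * y)%g => //; rewrite mulKg.
Qed.

Lemma L2_slice f h : L2 mu f -> L2 muQ (slice f h).
Proof.
move=> [mf foo]; split; first exact: slice_measurable.
apply: le_lt_trans foo; rewrite normL2_sq_slices//; apply: ge0_le_integral => //.
- by move=> c _; rewrite lee_fin normc2_ge0.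
- by apply: emeasurable_normc2; exact: slice_measurable.
- exact: measurable_slices.
- move=> c _; have := @fset_le_esum R _
    (fun h => (normc (slice f h c) ^+ 2)%:E) [fset h]%fset.
  rewrite big_seq_fset1; apply => l; by rewrite lee_fin normc2_ge0.
Qed.

(** The set of points [h Xi(c)] with [c] in [E], described by an equation so that [borel_diagonal]
    gives its measurability. *)
Definition fiber h E : set G :=
  [set x | x = (\val h * Xi (pi x))%g /\ E (pi x)].

Lemma fiber_measurable h E : measurable E -> measurable (fiber h E : set (borel G)).
Proof.
move=> mE; apply: measurableI.
  apply: (borel_diagonal G_hausdorff G_second_countable); first exact: measurable_id.
  exact: (measurableT_comp (section_point_measurable Xi_section h)
    (@coset_measurable G Gam)).
by rewrite -[X in measurable X]setTI; exact: coset_measurable.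
Qed.

Lemma fiber_section h k E c : fiber h E (\val k * Xi c)%g <-> k = h /\ E c.
Proof.
rewrite /fiber/= (pi_mul_section Xi_section); split=> -[].
  by move=> /section_point_inj.
by move=> ->.
Qed.

(** A function with a single nonzero slice: its Zak series has one term and can be evaluated
    explicitly ([zak_atom]). *)
Definition atom h E x : R[i] := (\1_(fiber h E) x)%:C.

Lemma atom_measurable h E : measurable E -> cmeasurable (atom h E : borel G -> R[i]).
Proof.
by move=> mE; apply: cmeasurable_real; apply: measurable_indic; exact: fiber_measurable.
Qed.

Lemma slice_atom h k E c :
  slice (atom h E) k c = if k == h then (\1_E c)%:C else 0.
Proof.
rewrite /slice /atom !indicE; case: eqP => [->|kh].
  congr (_%:C); congr (_%:R); congr nat_of_bool; apply/idP/idP; rewrite !inE.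
    by move=> /fiber_section[].
  by move=> Ec; exact/fiber_section.
by rewrite memNset// => /fiber_section[].
Qed.

Lemma ge0_integral_fiber (f : G -> \bar R) h :
  measurable_fun setT (f : borel G -> \bar R) -> (forall x, 0 <= f x)%E ->
  (forall x, ~ fiber h setT x -> f x = 0%E) ->
  (\int[mu]_x f x = \int[muQ]_c f (\val h * Xi c)%g)%E.
Proof.
move=> mf f0 ff; rewrite muQ_weil//; apply: eq_integral => c _.
rewrite (esum_single (i := h))// => k kh; apply: ff.
by move=> /fiber_section[].
Qed.

Lemma integral_fiber (f : G -> \bar R) h :
  measurable_fun setT (f : borel G -> \bar R) ->
  (forall x, ~ fiber h setT x -> f x = 0%E) ->
  (\int[mu]_x f x = \int[muQ]_c f (\val h * Xi c)%g)%E.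
Proof.
move=> mf ff; rewrite [LHS]integralE [RHS]integralE; congr (_ - _)%E.
- rewrite (@ge0_integral_fiber (f^\+)%E h)//.
  + by apply: eq_integral => c _; rewrite !funeposE.
  + exact: measurable_funepos.
  + by move=> x /ff fx; rewrite funeposE fx maxxx.
- rewrite (@ge0_integral_fiber (f^\-)%E h)//.
  + by apply: eq_integral => c _; rewrite !funenegE.
  + exact: measurable_funeneg.
  + by move=> x /ff fx; rewrite funenegE fx oppe0 maxxx.
Qed.

Lemma inner_atom f h E : cmeasurable (f : borel G -> R[i]) -> measurable E ->
  inner mu f (atom h E) = inner muQ (slice f h) (cindic R E).
Proof.
move=> mf mE; have mfa : cmeasurable (fun x : borel G => f x * (atom h E x)^*).
  by apply: cmeasurableM => //; apply: cmeasurableJ; exact: atom_measurable.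
have a0 x : ~ fiber h setT x -> f x * (atom h E x)^* = 0.
  move=> nx; rewrite /atom indicE memNset; first by rewrite conjr_complex mulr0.
  by move=> [? _]; apply: nx.
have aE c : f (\val h * Xi c)%g * (atom h E (\val h * Xi c)%g)^* =
    slice f h c * (cindic R E c)^*.
  by have := slice_atom h h E c; rewrite {1}/slice eqxx => ->.
apply: complexP => /=; rewrite /Rintegral; congr fine.
- rewrite (@integral_fiber (fun x => (Re (f x * (atom h E x)^*))%:E) h).
  + by apply: eq_integral => c _; rewrite aE.
  + by apply/measurable_EFinP; case: mfa.
  + by move=> x /a0 ->.
- rewrite (@integral_fiber (fun x => (Im (f x * (atom h E x)^*))%:E) h).
  + by apply: eq_integral => c _; rewrite aE.
  + by apply/measurable_EFinP; case: mfa.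
  + by move=> x /a0 ->.
Qed.

Lemma atom_L1_L2 h E : measurable E -> (muQ E < +oo)%E ->
  L1 mu (atom h E) /\ L2 mu (atom h E).
Proof.
move=> mE Eoo; have ma := atom_measurable h mE.
have : (\int[mu]_x (\1_(fiber h E) x)%:E < +oo)%E.
  rewrite (@integral_fiber (fun x => (\1_(fiber h E) x)%:E) h).
  - rewrite (eq_integral (fun c => (\1_E c)%:E)); first by rewrite integral_indic// setIT.
    by move=> c _; have := slice_atom h h E c; rewrite /slice /atom eqxx => -[->].
  - by apply/measurable_EFinP; apply: measurable_indic; exact: fiber_measurable.
  - move=> x nx; rewrite indicE memNset//.
    by move=> [? _]; apply: nx.
move=> h1; split; split => //.
- by under eq_integral do rewrite /atom normc_real indicE normr_nat -indicE.
- rewrite /normL2_sq (eq_integral (fun x : borel G => (\1_(fiber h E) x)%:E)) => [//|x _].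
  by rewrite /atom normc2_real indicE; case: (_ \in _); rewrite ?expr1n ?expr0n.
Qed.

Definition product_atom h E : D * Q -> R[i] := tensor (chi h) (cindic R E).

(** The partial sums are constant as soon as the index set contains [h], and limits of the Zak
    series are unique. *)
Lemma zak_atom h E : measurable E -> (muQ E < +oo)%E ->
  {ae nuQ, forall p, Z (atom h E) p = product_atom h E p}.
Proof.
move=> mE Eoo; have [a1 a2] := atom_L1_L2 h mE Eoo.
have [_ _ _ _ /(_ _ a1 a2)] := Z_zak; apply: filterS => p Zp.
suff Zp' : zak_partial_sum Xi (atom h E) p @ totally --> (product_atom h E p : R[i]^o).
  exact: (@cvg_unique R[i]^o (@norm_hausdorff _ R[i]^o) _ _ _ _ Zp Zp').
move=> A /nbhs_singleton lA; exists [fset h]%fset => // B /= hB.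
rewrite /preimage/=; suff -> : zak_partial_sum Xi (atom h E) p B = product_atom h E p.
  exact: lA.
rewrite /zak_partial_sum.
rewrite (big_fsetD1 h)/=; last by apply: (fsubsetP hB); rewrite inE.
have := slice_atom h h E p.2; rewrite /slice eqxx => ->.
rewrite big1_seq ?addr0; first by rewrite mulrC.
move=> k /andP[_]; rewrite in_fsetD1 => /andP[kh _].
by have := slice_atom h k E p.2; rewrite /slice (negbTE kh) => ->; rewrite mul0r.
Qed.

Lemma zak_L2 f : L2 mu f -> L2 nuQ (Z f). Proof. by case: Z_zak => + _ _ _ _; apply. Qed.

Lemma zak_inner f g : L2 mu f -> L2 mu g -> inner nuQ (Z f) (Z g) = inner mu f g.
Proof. by case: Z_zak => _ _ + _ _; apply. Qed.

Lemma zak_norm f : L2 mu f -> normL2_sq nuQ (Z f) = normL2_sq mu f.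
Proof.
move=> Lf; rewrite (norm2E Lf) (norm2E (zak_L2 Lf)); congr EFin.
by have := zak_inner Lf Lf; rewrite !inner_self => /complexI.
Qed.

Lemma zak_eq0 f : L2 mu f -> (forall h, {ae muQ, forall c, slice f h c = 0}) ->
  normL2_sq mu f = 0%E.
Proof.
move=> [mf _] f0; rewrite normL2_sq_slices//.
rewrite (ae_eq_integral (cst 0%E)) ?integral0//; first exact: measurable_slices.
apply: filterS (ae_countable countGam f0) => c fc _ /=.
by rewrite esum1// => h _; rewrite fc ComplexField.Normc.normc0 expr0n.
Qed.

Lemma L2_modulation h : L2 nu (chi h).
Proof.
split => //; rewrite /normL2_sq; under eq_integral do rewrite normc_modulation expr1n.
by rewrite integral_cst//= mul1e probability_setT ltry.
Qed.

Lemma product_atom_L2 h E : measurable E -> (muQ E < +oo)%E ->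
  L2 nuQ (product_atom h E).
Proof.
by move=> mE Eoo; apply: L2_tensor; [exact: L2_modulation|exact: L2_cindic].
Qed.

Lemma zak_inner_atom f h E : L2 mu f -> measurable E -> (muQ E < +oo)%E ->
  inner nuQ (Z f) (product_atom h E) = inner muQ (slice f h) (cindic R E).
Proof.
move=> Lf mE Eoo; have [_ a2] := atom_L1_L2 h mE Eoo.
rewrite -inner_atom//; last by case: Lf.
rewrite -zak_inner//; apply: ae_inner.
- exact: zak_L2.
- exact: zak_L2.
- exact: product_atom_L2.
- exact: zak_L2.
- exact: aeW.
- by apply: filterS (zak_atom h mE Eoo) => p ->.
Qed.

(** By surjectivity [K] is [Z f]. The slices of [f] are then orthogonal to all indicators of finite
    measure, hence vanish, and countably many null slices give [f = 0] by Weil's formula. *)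
Lemma product_atom_total (K : D * Q -> R[i]) : L2 nuQ K ->
  (forall h E, measurable E -> (muQ E < +oo)%E ->
     inner nuQ K (product_atom h E) = 0) ->
  {ae nuQ, forall p, K p = 0}.
Proof.
move=> LK K0; have [_ _ _ /(_ _ LK)[f Lf ZfK] _] := Z_zak.
have f0 : normL2_sq mu f = 0%E.
  apply: zak_eq0 => // h; apply: (ae_eq_of_inner_cindic (L2_slice h Lf) (L20 muQ)).
  move=> E mE Eoo; rewrite -zak_inner_atom//.
  have La := product_atom_L2 h mE Eoo.
  rewrite (ae_inner (zak_L2 Lf) LK La La ZfK (aeW _ (fun=> erefl))) K0//.
  rewrite -[LHS](cintegral0 muQ); congr cintegral; apply/funext => c.
  by rewrite mul0r.
apply: normL2_sq_eq0; first by case: LK.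
rewrite -(ae_normL2_sq (zak_L2 Lf).1 LK.1 ZfK).
by rewrite zak_norm.
Qed.

(** Both sides have the same inner product with each product atom, namely that of the slice of [f]
    at [k^-1 h] with the indicator of [E]; [product_atom_total] concludes. *)
Lemma zak_translates f k : L2 mu f ->
  {ae nuQ, forall p, Z (translates Gam f k) p = chi k p.1 * Z f p}.
Proof.
move=> Lf; have Lt := L2_translates k Lf.
have chik1 a : normc (chi k a) <= 1 by rewrite normc_modulation.
have Lm : L2 nuQ (fun p => chi k p.1 * Z f p).
  by apply: (L2_fstM (mchi k) chik1); exact: zak_L2.
have LZ := zak_L2 Lt; have LZf := zak_L2 Lf.
suff : {ae nuQ, forall p, Z (translates Gam f k) p - chi k p.1 * Z f p = 0}.
  by apply: filterS => p /eqP; rewrite subr_eq0 => /eqP.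
apply: product_atom_total; first exact: L2B.
move=> h E mE Eoo; have La := product_atom_L2 h mE Eoo.
rewrite innerBl// zak_inner_atom//.
have -> : inner nuQ (fun p => chi k p.1 * Z f p) (product_atom h E) =
    inner nuQ (Z f) (product_atom (k^-1 * h)%g E).
  congr cintegral; apply/funext => p; rewrite /product_atom /tensor.
  have -> : chi (k^-1 * h)%g p.1 = (chi k p.1)^* * chi h p.1.
    by rewrite modulationJ mulrC modulationM.
  by apply: complexP; rewrite !reimE; ring.
rewrite zak_inner_atom//; apply/eqP; rewrite subr_eq0; apply/eqP.
by congr inner; apply/funext => c; rewrite slice_translates.
Qed.

(** If the coset space were null, Weil's formula would make the whole group null, against positivity
    of Haar measure on nonempty open sets. *)
Lemma muQ_setT_neq0 : muQ setT != 0%E.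
Proof.
apply/eqP => Q0; have [_ _ /(_ setT openT)] := mu_haar.
have <- : (\int[mu]_x 1 = mu setT)%E by rewrite integral_cst// mul1e.
rewrite (muQ_weil (f := fun=> 1%E))//.
have me : measurable_fun setT
    (fun _ : Q => \esum_(h in [set: Gam]) (1%E : \bar R))%E.
  exact: (measurable_esum countGam).
move=> /(_ _)/wrap[|]; first by exists point.
rewrite null_set_integral ?ltxx//.
Qed.

Lemma finite_positive_set : exists2 E : set Q, measurable E &
  (0 < muQ E < +oo)%E.
Proof.
have [F FT Fb] := sigma_finiteT muQ.
apply/not_exists2P => h; have := muQ_setT_neq0; apply/negP; rewrite negbK.
have F0 n : muQ (F n) = 0%E.
  have [mF Foo] := Fb n; have [//|] := h (F n).
  by rewrite Foo andbT lt0e measure_ge0 andbT => /negP; rewrite negbK => /eqP.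
rewrite FT eq_le measure_ge0 andbT.
have mF n : measurable (F n) by case: (Fb n).
apply: le_trans (measure_sigma_subadditive muQ mF (bigcupT_measurable _ mF) (@subset_refl _ _)) _.
by rewrite eseries0// => n _ _; exact: F0.
Qed.

(** Pull the tensor of [m] and the indicator of [E] back to some [f]: its slices are the Fourier
    coefficients of [m] times that indicator. Computing the squared norm of [f] by Weil's formula
    and by unitarity gives the two sides, each multiplied by the measure of [E], which is positive
    and finite. *)
Lemma zak_parseval (m : D -> R[i]) : L2 nu m -> coef_sq nu chi m = normL2_sq nu m.
Proof.
move=> Lm; have [E mE /andP[E0 Eoo]] := finite_positive_set.
have LE : L2 muQ (cindic R E) by exact: L2_cindic.
have LK := L2_tensor Lm LE.
have [_ _ _ /(_ _ LK)[f Lf ZfK] _] := Z_zak.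
have fE h : {ae muQ, forall c, slice f h c = inner nu m (chi h) * cindic R E c}.
  apply: (ae_eq_of_inner_cindic (L2_slice h Lf) (L2Z _ LE)) => E' mE' E'oo.
  rewrite -zak_inner_atom//; have La := product_atom_L2 h mE' E'oo.
  rewrite (ae_inner (zak_L2 Lf) LK La La ZfK (aeW _ (fun=> erefl))).
  have LE' : L2 muQ (cindic R E') by exact: L2_cindic.
  by rewrite innerZl// inner_tensor//; exact: L2_modulation.
have coef0 : (0 <= coef_sq nu chi m)%E.
  by apply: esum_ge0 => h _; rewrite lee_fin normc2_ge0.
have : normL2_sq mu f = (coef_sq nu chi m * muQ E)%E.
  rewrite normL2_sq_slices; last by case: Lf.
  rewrite (ae_eq_integral (fun c => coef_sq nu chi m * (\1_E c)%:E)%E)//.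
  - by rewrite ge0_integralZl// ?integral_indic ?setIT//;
      apply/measurable_EFinP; exact: measurable_indic.
  - by apply: measurable_slices; case: Lf.
  - apply: emeasurable_funM => //; apply/measurable_EFinP; exact: measurable_indic.
  - apply: filterS (ae_countable countGam fE) => c hc _.
    rewrite indicE; have [cE|cE] := boolP (c \in E).
      rewrite mule1; apply: eq_esum => h _.
      by rewrite hc (_ : cindic R E c = 1) ?mulr1// /cindic indicE cE.
    rewrite mule0 esum1// => h _.
    rewrite hc (_ : cindic R E c = 0) ?mulr0 ?ComplexField.Normc.normc0 ?expr0n//.
    by rewrite /cindic indicE (negbTE cE).
rewrite -zak_norm// (ae_normL2_sq (zak_L2 Lf).1 LK.1 ZfK) normL2_sq_tensor//; last by case: Lm.
rewrite normL2_sq_cindic// => h.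
have Efin : muQ E \is a fin_num by rewrite ge0_fin_numE.
apply/eqP; rewrite eq_le -(@lee_pmul2r _ (muQ E))// -h lexx/=.
by rewrite -(@lee_pmul2r _ (muQ E))// h lexx.
Qed.

Let nchi := @normc_modulation R G Gam.

Let chiM j k : exists l, forall a, chi j a * chi k a = chi l a.
Proof. by exists (k * j)%g => a; rewrite modulationM. Qed.

Let chiJ k : exists l, forall a, (chi k a)^* = chi l a.
Proof. by exists (k^-1)%g => a; rewrite modulationJ. Qed.

Let chi1 : exists k, forall a, chi k a = 1.
Proof. by exists 1%g => a; exact: modulation1. Qed.

(** * Transfer between functions on the group and their Zak transforms *)

Local Notation modulates := (modulates chi).
Implicit Types F H : D * Q -> R[i].

(** [Z] is linear and translation-covariant only up to null sets; this relation absorbs them, so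
    that the right-hand sides can be genuine sums and products. *)
Definition zak_rep f F := [/\ L2 mu f, L2 nuQ F & {ae nuQ, forall p, Z f p = F p}].

Lemma zak_rep_refl f : L2 mu f -> zak_rep f (Z f).
Proof. by move=> Lf; split => //; [exact: zak_L2|exact: aeW]. Qed.

Lemma zak_rep_surj F : L2 nuQ F -> exists f, zak_rep f F.
Proof. by move=> LF; have [_ _ _ /(_ _ LF)[f Lf fF] _] := Z_zak; exists f. Qed.

Lemma zak_rep_norm f F : zak_rep f F -> normL2_sq mu f = normL2_sq nuQ F.
Proof.
move=> [Lf LF fF]; rewrite -zak_norm//; apply: ae_normL2_sq fF; last by case: LF.
by case: (zak_L2 Lf).
Qed.

Lemma zak_rep_inner f F g H : zak_rep f F -> zak_rep g H ->
  inner mu f g = inner nuQ F H.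
Proof.
move=> [Lf LF fF] [Lg LH gH]; rewrite -zak_inner//.
by apply: ae_inner => //; exact: zak_L2.
Qed.

Lemma zak_rep_translates f F k : zak_rep f F ->
  zak_rep (translates Gam f k) (modulates F k).
Proof.
move=> [Lf LF fF]; split; [exact: L2_translates|exact: (L2_modulates mchi nchi)|].
by apply: filterS2 fF (zak_translates k Lf) => p Zfp ->; rewrite Zfp.
Qed.

Lemma zak_rep0 : zak_rep (fun=> 0) (fun=> 0).
Proof.
have [_ Zlin _ _ _] := Z_zak; split; [exact: L20|exact: L20|].
have := Zlin (- 1) _ _ (L20 mu) (L20 mu); apply: filterS => p.
by rewrite addr0 mulr0 mulN1r addNr.
Qed.

Lemma zak_rep_linear (a : R[i]) f F g H : zak_rep f F -> zak_rep g H ->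
  zak_rep (fun x => a * f x + g x) (fun p => a * F p + H p).
Proof.
move=> [Lf LF fF] [Lg LH gH]; have [_ Zlin _ _ _] := Z_zak.
split; [exact: (L2D (L2Z _ Lf) Lg)|exact: (L2D (L2Z _ LF) LH)|].
by apply: filterS3 (Zlin a _ _ Lf Lg) fF gH => p -> -> ->.
Qed.

Lemma zak_rep_sub f F g H : zak_rep f F -> zak_rep g H ->
  zak_rep (fun x => f x - g x) (fun p => F p - H p).
Proof.
move=> fF gH; have := zak_rep_linear (- 1) gH fF.
by under eq_fun do rewrite mulN1r addrC; under [X in zak_rep _ X]eq_fun do rewrite mulN1r addrC.
Qed.

Lemma zak_rep_sum (J : Type) (s : seq J) (c : J -> R[i])
    (f_ : J -> G -> R[i]) (F_ : J -> D * Q -> R[i]) :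
  (forall j, zak_rep (f_ j) (F_ j)) ->
  zak_rep (fun x => \sum_(j <- s) c j * f_ j x) (fun p => \sum_(j <- s) c j * F_ j p).
Proof.
move=> fF; elim: s => [|j s ih].
  under eq_fun do rewrite big_nil; under [X in zak_rep _ X]eq_fun do rewrite big_nil.
  exact: zak_rep0.
under eq_fun do rewrite big_cons; under [X in zak_rep _ X]eq_fun do rewrite big_cons.
exact: zak_rep_linear.
Qed.

Lemma zak_rep_eq f F g H : zak_rep f F -> zak_rep g H ->
  {ae nuQ, forall p, F p = H p} <-> {ae mu, forall x : borel G, f x = g x}.
Proof.
move=> fF gH; have fgN := zak_rep_norm (zak_rep_sub fF gH).
have [[mf _] [mF _] _] := fF; have [[mg _] [mH _] _] := gH.
have mfg := cmeasurableB mf mg; have mFH := cmeasurableB mF mH.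
split=> FH.
- have : {ae nuQ, forall p, F p - H p = 0} by apply: filterS FH => p ->; rewrite subrr.
  move=> /(ae_normL2_sq mFH (@cmeasurable_cst _ _ _ 0)); rewrite -fgN => fg0.
  have /(normL2_sq_eq0 mfg) : normL2_sq mu (fun x => f x - g x) = 0%E.
    rewrite [LHS]fg0 /normL2_sq ComplexField.Normc.normc0 expr0n; exact: integral0.
  by apply: filterS => x /eqP; rewrite subr_eq0 => /eqP.
- have : {ae mu, forall x : borel G, f x - g x = 0} by apply: filterS FH => p ->; rewrite subrr.
  move=> /(ae_normL2_sq mfg (@cmeasurable_cst _ _ _ 0)); rewrite fgN => fg0.
  have /(normL2_sq_eq0 mFH) : normL2_sq nuQ (fun x => F x - H x) = 0%E.
    rewrite [LHS]fg0 /normL2_sq ComplexField.Normc.normc0 expr0n; exact: integral0.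
  by apply: filterS => x /eqP; rewrite subr_eq0 => /eqP.
Qed.

Lemma zak_rep_space g H f F : zak_rep g H -> zak_rep f F ->
  span_translates Gam mu g f <-> modulation_space nu muQ chi H F.
Proof.
move=> gH fF; have gHk k := zak_rep_translates k gH.
have sums A (c : Gam -> R[i]) := zak_rep_sum A c gHk.
split=> -[_ near_span]; split; try by case: fF.
- move=> e e0; have [_ [A [c ->]] lt_e] := near_span e e0.
  exists (fun p => \sum_(k <- A) c k * modulates H k p); first by exists A, c.
  by rewrite -(zak_rep_norm (zak_rep_sub fF (sums A c))).
- move=> e e0; have [_ [A [c ->]] lt_e] := near_span e e0.
  exists (fun x => \sum_(k <- A) c k * translates Gam g k x); first by exists A, c.
  by rewrite (zak_rep_norm (zak_rep_sub fF (sums A c))).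
Qed.

Lemma zak_rep_coef g H f F : zak_rep g H -> zak_rep f F ->
  coef_sq mu (translates Gam g : Gam -> borel G -> R[i]) f = coef_sq nuQ (modulates H) F.
Proof.
move=> gH fF; apply: eq_esum => k _.
by rewrite (zak_rep_inner fF (zak_rep_translates k gH)).
Qed.

(** The frame inequality is known only on the space generated by [g], and the test functions of
    [bounded_weight_of_coef_sq] correspond to elements of that space. *)
Lemma frame_bounded_weight g H : zak_rep g H ->
  subspace_frame mu (span_translates Gam mu g) (translates Gam g) ->
  exists2 B, 0 <= B & bounded_weight nu muQ B H.
Proof.
move=> gH [A [B [A0 AB frame]]]; have [_ LH _] := gH.
have B0 : 0 < B by exact: lt_le_trans AB.
exists B; first exact: ltW.
apply: (bounded_weight_of_coef_sq mchi nchi chiM chiJ chi1 zak_parseval) => // F HF.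
have [f fF] := zak_rep_surj (closureL2_L2 HF).
have [_] := frame f ((zak_rep_space gH fF).2 HF).
by rewrite (zak_rep_coef gH fF) (zak_rep_norm fF).
Qed.

Lemma bessel_bounded_weight g H : zak_rep g H ->
  bessel mu (translates Gam g : Gam -> borel G -> R[i]) <->
  exists2 B, 0 <= B & bounded_weight nu muQ B H.
Proof.
move=> gH; have [_ LH _] := gH; split=> -[B B0 hB].
- exists B; first exact: ltW.
  apply: (bounded_weight_of_coef_sq mchi nchi chiM chiJ chi1 zak_parseval) => // F HF.
  have [f fF] := zak_rep_surj (closureL2_L2 HF).
  by have [Lf _ _] := fF; rewrite -(zak_rep_coef gH fF) -(zak_rep_norm fF) hB.
(* A Bessel bound has to be positive, whereas [B] may be 0. *)
- exists (B + 1) => [|f Lf]; first by rewrite ltr_wpDl.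
  have fF := zak_rep_refl Lf; have [_ LF _] := fF.
  rewrite (zak_rep_coef gH fF) (zak_rep_norm fF).
  have [LFH FHB] := mixed_inner_L2 LF LH hB B0.
  rewrite (coef_sq_modulates mchi nchi zak_parseval LF LH LFH).
  apply: le_trans FHB _; apply: lee_wpmul2r; first exact: normL2_sq_ge0.
  by rewrite lee_fin lerDl.
Qed.

Lemma zak_rep_dual f F (h : G -> R[i]) H : zak_rep f F -> zak_rep h H ->
  subspace_dual mu (span_translates Gam mu f) (translates Gam h) (translates Gam f) <->
  [/\ exists2 B, 0 <= B & bounded_weight nu muQ B H,
      exists2 B, 0 <= B & bounded_weight nu muQ B F &
      modulation_dual nu muQ chi F H].
Proof.
move=> fF hH; have fFk k := zak_rep_translates k fF.
have sums g K A : zak_rep g K ->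
    normL2_sq mu (fun x => (\sum_(k <- A) inner mu g (translates Gam h k) *
      translates Gam f k x) - g x) =
    normL2_sq nuQ (fun p => (\sum_(k <- A) inner nuQ K (modulates H k) *
      modulates F k p) - K p).
  move=> gK; rewrite (zak_rep_norm (zak_rep_sub (zak_rep_sum A _ fFk) gK)).
  congr normL2_sq; apply/funext => p; congr (_ - _); apply: eq_bigr => k _.
  by rewrite (zak_rep_inner gK (zak_rep_translates k hH)).
split=> -[/(bessel_bounded_weight hH) HB /(bessel_bounded_weight fF) FB dual]; split => //.
- move=> K FK e e0; have [g gK] := zak_rep_surj (closureL2_L2 FK).
  have := cvg0_lt (dual g ((zak_rep_space fF gK).2 FK)) e0.
  by move=> [A _ hA]; exists A => C AC; rewrite -(sums _ _ _ gK); exact: hA.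
- move=> g fg; have gK := zak_rep_refl (closureL2_L2 fg).
  have FK := (zak_rep_space fF gK).1 fg.
  under eq_fun do rewrite (sums _ _ _ gK).
  apply/fine_cvgP; split.
    (* Convergence of extended reals is split into eventual finiteness, obtained with tolerance 1,
       and convergence of the real values. *)
    have [A hA] := dual _ FK 1 ltr01; exists A => // C /= AC.
    rewrite ge0_fin_numE ?normL2_sq_ge0//.
    by apply: lt_trans (hA _ AC) _; rewrite ltry.
  apply/cvgrPdist_lt => e e0; have [A hA] := dual _ FK e e0.
  exists A => // C /= AC; rewrite sub0r normrN ger0_norm ?fine_ge0 ?normL2_sq_ge0//.
  by rewrite -lte_fin fineK ?hA// ge0_fin_numE ?normL2_sq_ge0// (lt_trans (hA _ AC))// ltry.
Qed.

(** * Duals *)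

Section generator_pair.
Context (phi psi : G -> R[i]) (C : R).
Hypotheses (phi_L2 : L2 mu phi) (psi_L2 : L2 mu psi).
Hypothesis phi_frame :
  subspace_frame mu (span_translates Gam mu phi) (translates Gam phi).
Hypothesis psi_frame :
  subspace_frame mu (span_translates Gam mu psi) (translates Gam psi).
Local Notation br f g := (bracket muQ Z f g).
Local Notation Omega f := (bracket_support muQ Z f).
Hypothesis C0 : 0 < C.
Hypothesis C_bracket : {ae nu, forall a : D, Omega phi a -> C <= normc (br phi psi a)}.

Definition is_dual (psit : G -> R[i]) :=
  span_translates Gam mu psi psit /\
  subspace_dual mu (span_translates Gam mu phi)
    (translates Gam psit) (translates Gam phi).

Let phiE := zak_rep_refl phi_L2.
Let psiE := zak_rep_refl psi_L2.
Let LF := zak_L2 phi_L2.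
Let LH := zak_L2 psi_L2.

(** The Bessel clause for [phi] follows from its upper frame bound, so only the conditions on [P]
    remain. *)
Lemma is_dualP (psit : G -> R[i]) P : zak_rep psit P -> is_dual psit <->
  [/\ modulation_space nu muQ chi (Z psi) P,
      exists2 B, 0 <= B & bounded_weight nu muQ B P &
      modulation_dual nu muQ chi (Z phi) P].
Proof.
move=> psitP; have spaceE := zak_rep_space psiE psitP.
have dualE := zak_rep_dual phiE psitP; split.
  by move=> [/spaceE psiP /dualE[PB _ dualP]]; split.
move=> [/spaceE psi_psit PB dualP]; split => //; apply/dualE; split => //.
exact: frame_bounded_weight phi_frame.
Qed.

Lemma dual_of_symbol (m : D -> R[i]) (K : R) : cmeasurable m ->
  (forall a, normc (m a) <= K) ->
  {ae nu, forall a : D, Omega phi a -> (m a)^* * br phi psi a = 1} ->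
  exists2 psit, is_dual psit & zak_rep psit (fun p => m p.1 * Z psi p).
Proof.
move=> mm mK m1; have [B B0 FB] := frame_bounded_weight phiE phi_frame.
have [B' B'0 HB] := frame_bounded_weight psiE psi_frame.
have [HP PB dualP] := dual_of_multiplier mchi nchi chiM chiJ chi1 zak_parseval
  LF LH B0 B'0 FB HB mm mK m1.
have [psit psitP] := zak_rep_surj (closureL2_L2 HP).
exists psit => //; apply/(is_dualP psitP); split => //.
by exists (K ^+ 2 * B') => //; rewrite mulr_ge0// sqr_ge0.
Qed.

Let m0 : D -> R[i] := inverse_symbol muQ (Z phi) (Z psi) C.
Let mm0 : cmeasurable m0. Proof. exact: measurable_inverse_symbol LF LH C0. Qed.
Let m0C a : normc (m0 a) <= C^-1. Proof. exact: normc_inverse_symbol. Qed.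
Let m01 : {ae nu, forall a : D, Omega phi a -> (m0 a)^* * br phi psi a = 1}.
Proof. exact: inverse_symbolE. Qed.

Lemma dual_exists : exists psit, is_dual psit.
Proof. by have [psit] := dual_of_symbol mm0 m0C m01; exists psit. Qed.

Lemma dual_ae_unique : {ae nu, forall a : D, Omega phi a <-> Omega psi a} ->
  forall psit1 psit2, is_dual psit1 -> is_dual psit2 ->
  {ae mu, forall x : borel G, psit1 x = psit2 x}.
Proof.
move=> Omega_eq psit1 psit2 dual1 dual2.
have [B B0 FB] := frame_bounded_weight phiE phi_frame.
have [B' B'0 HB] := frame_bounded_weight psiE psi_frame.
have rep1 := zak_rep_refl (closureL2_L2 dual1.1).
have rep2 := zak_rep_refl (closureL2_L2 dual2.1).
have [HP1 [B1 B10 P1B] FP1] := (is_dualP rep1).1 dual1.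
have [HP2 [B2 B20 P2B] FP2] := (is_dualP rep2).1 dual2.
apply/(zak_rep_eq rep1 rep2).
exact: (dual_unique mchi nchi chi1 zak_parseval LF LH B0 B'0 FB HB C0 C_bracket
  Omega_eq B10 B20 P1B P2B HP1 HP2 FP1 FP2).
Qed.

(* On [Omega psi \ Omega phi] a symbol is unconstrained. *)
Lemma supports_of_unique :
  (forall psit1 psit2, is_dual psit1 -> is_dual psit2 ->
     {ae mu, forall x : borel G, psit1 x = psit2 x}) ->
  {ae nu, forall a : D, Omega phi a <-> Omega psi a}.
Proof.
(* The indicator of the part of [Omega psi] outside [Omega phi]: both [m0] and [m0 + n] are symbols
   of duals, so uniqueness forces [n Z psi = 0]. *)
move=> uniq; pose n : D -> R[i] := fun a => ((br psi psi a != 0) && (br phi phi a == 0))%:R.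
have br0 f (a : D) : (br f f a == 0) = (fine (weight muQ (Z f) a) == 0).
  have -> : br f f a = (fine (weight muQ (Z f) a))%:C := mixed_inner_self muQ (Z f) a.
  by rewrite (inj_eq (@complexI R)).
have mn : cmeasurable n.
  have mF := measurable_weight muQ LF.1; have mH := measurable_weight muQ LH.1.
  rewrite (_ : n = fun a => (if (fine (weight muQ (Z psi) a) != 0) &&
    (fine (weight muQ (Z phi) a) == 0) then 1 else 0 : R)%:C).
    apply: cmeasurable_real; apply: measurable_fun_ifT => //.
    apply: measurable_and; first apply: measurable_neg;
      by apply: measurable_fun_eqr => //; exact: measurableT_comp.
  by apply/funext => a; rewrite /n !br0; case: (_ && _).
have n1 a : normc (n a) <= 1.
  rewrite /n; case: (_ && _).
    by rewrite ComplexField.Normc.normc1.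
  by rewrite ComplexField.Normc.normc0.
have [psit1 dual1 rep1] := dual_of_symbol mm0 m0C m01.
have m0n : {ae nu, forall a : D, Omega phi a -> (m0 a + n a)^* * br phi psi a = 1}.
  apply: filterS m01 => a m0a Fa; rewrite /n.
  by rewrite (negbTE Fa : (br phi phi a == 0) = false) andbF addr0; exact: m0a.
have [||psit2 dual2 rep2] := @dual_of_symbol (fun a => m0 a + n a) (C^-1 + 1) _ _ m0n.
- exact: cmeasurableD.
- by move=> a; apply: le_trans (le_normcD _ _) _; exact: lerD.
have := (zak_rep_eq rep1 rep2).2 (uniq _ _ dual1 dual2) => P12.
have /(fstM_eq0 mn LH) n0 : {ae nuQ, forall p, n p.1 * Z psi p = 0}.
  apply: filterS P12 => p /eqP.
  by rewrite mulrDl -subr_eq0 opprD addrA subrr add0r oppr_eq0 => /eqP.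
(* One inclusion of the supports is [supp_subset]. For the other, at a point of [Omega psi] outside
   [Omega phi] the value of [n] is 1 and the bracket of [psi] with itself is nonzero, which
   contradicts [n0]. *)
apply: filterS2 n0 (supp_subset LF LH C0 C_bracket) => a n0 FH; split; first exact: FH.
move=> Ha; apply/negP => Fa; case: n0 => [|H0].
  by rewrite /n [br psi psi a != 0]Ha Fa; apply/eqP; exact: oner_neq0.
by move: Ha; rewrite /bracket_support/= => /eqP; apply; exact: H0.
Qed.

(** [dual_formula] holds a.e. on the product; [ae_prod] converts this into a.e. coset for a.e.
    character, and the indicator is 1 on [Omega phi]. *)
Lemma dual_fiber_formula (psit : G -> R[i]) : is_dual psit ->
  {ae nu, forall a : D, Omega phi a -> {ae muQ, forall c,
     (br phi psi a)^* * Z psit (a, c) = Z psi (a, c) * \1_(Omega phi) a}}.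
Proof.
move=> dual; have [B B0 FB] := frame_bounded_weight phiE phi_frame.
have [B' B'0 HB] := frame_bounded_weight psiE psi_frame.
have rep := zak_rep_refl (closureL2_L2 dual.1).
have [HP [B1 B10 PB] FP] := (is_dualP rep).1 dual.
have := dual_formula mchi nchi chi1 zak_parseval LF LH B0 B'0 FB HB B10 PB HP FP.
move=> /ae_prod; apply: filterS => a h Fa; apply: filterS h => c /(_ Fa).
by rewrite indicE mem_set// mulr1.
Qed.

End generator_pair.
End zak_modulation.

Theorem theorem3p10
  (R : realType) (G : topGroupType)
  (G_hausdorff : hausdorff_space G)
  (G_second_countable : @second_countable G)
  (G_locally_compact : locally_compact [set: G])
  (mu : {measure set (borel G) -> \bar R}) (mu_haar : left_haar mu)
  (Gam : subgroup G)
  (Gam_closed : closed (subgroup_set Gam))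
  (Gam_discrete : discrete_subgroup Gam)
  (Gam_abelian : abelian_subgroup Gam)
  (nu : probability (borel (dual R Gam)) R) (nu_haar : left_haar nu)
  (Xi : right_cosets Gam -> G) (Xi_section : borel_section Xi)
  (muQ : {sigma_finite_measure set (borel (right_cosets Gam)) -> \bar R})
  (muQ_weil : weil_formula mu Xi muQ)
  (Z : (G -> R[i]) -> borel (dual R Gam) * borel (right_cosets Gam) -> R[i])
  (Z_zak : zak_transform mu nu muQ Xi Z)
  (phi psi : G -> R[i]) (phi_L2 : L2 mu phi) (psi_L2 : L2 mu psi)
  (phi_frame : subspace_frame mu (span_translates Gam mu phi)
                 (translates Gam phi))
  (psi_frame : subspace_frame mu (span_translates Gam mu psi)
                 (translates Gam psi)) :
  let Omega_phi := bracket_support muQ Z phi in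
  let Omega_psi := bracket_support muQ Z psi in
  let is_dual (psit : G -> R[i]) :=
    span_translates Gam mu psi psit /\
    subspace_dual mu (span_translates Gam mu phi)
      (translates Gam psit) (translates Gam phi) in
  forall C : R, 0 < C ->
    {ae nu, forall a, Omega_phi a -> C <= normc (bracket muQ Z phi psi a)} ->
  [/\ exists psit, is_dual psit,
      (forall psit1 psit2, is_dual psit1 -> is_dual psit2 ->
         {ae mu, forall x, psit1 x = psit2 x})
      <-> {ae nu, forall a, Omega_phi a <-> Omega_psi a} &
      {ae nu, forall a, Omega_phi a <-> Omega_psi a} ->
      forall psit, is_dual psit ->
        {ae nu, forall a, Omega_phi a ->
           {ae muQ, forall c,
              (bracket muQ Z phi psi a)^* * Z psit (a, c)
              = Z psi (a, c) * \1_Omega_phi a}}].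
Proof.
move=> Omega_phi Omega_psi isd C C0 C_bracket.
split.
- exact: (dual_exists G_hausdorff G_second_countable mu_haar Gam_discrete Xi_section
    muQ_weil Z_zak phi_L2 psi_L2 phi_frame psi_frame C0 C_bracket).
- split.
    exact: (supports_of_unique G_hausdorff G_second_countable mu_haar Gam_discrete
      Xi_section muQ_weil Z_zak phi_L2 psi_L2 phi_frame psi_frame C0 C_bracket).
  exact: (dual_ae_unique G_hausdorff G_second_countable mu_haar Gam_discrete
    Xi_section muQ_weil Z_zak phi_L2 psi_L2 phi_frame psi_frame C0 C_bracket).
- move=> _; exact: (dual_fiber_formula G_hausdorff G_second_countable mu_haar Gam_discrete
    Xi_section muQ_weil Z_zak phi_L2 psi_L2 phi_frame psi_frame).
Qed.
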